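(* Let $$\mathcal B=\{\mathcal E_1^{(a)}\mathcal E_2^{(b)}\mathcal E_1^{(c)}\{t\},\ \mathcal E_2^{(a)}\mathcal E_1^{(b)}\mathcal E_2^{(c)}\{t\}\ :\ a,b,c\ge 0,\ b\ge a+c,\ t\in\mathbb Z\}.$$ Then, up to isomorphism, $\mathcal B$ is the set of indecomposable objects of $\dot{\mathcal U}^+_3$. No two elements of $\mathcal B$ (given by distinct choices of family and of parameters $(a,b,c,t)$) are isomorphic, except that $$\mathcal E_1^{(a)}\mathcal E_2^{(a+c)}\mathcal E_1^{(c)}\{t\}\cong\mathcal E_2^{(c)}\mathcal E_1^{(a+c)}\mathcal E_2^{(a)}\{t\}\qquad\text{for all }a,c\ge 0,\ t\in\mathbb Z.$$ Every object of $\dot{\mathcal U}^+_3$ can be decomposed as a direct sum of elements of $\mathcal B$.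
   Context: The category $\mathcal U^+_3$. Put $i\cdot i=2$ for $i\in\{1,2\}$ and $1\cdot 2=2\cdot 1=-1$. Let $\mathcal H$ be the strict monoidal $\mathbb Z$-linear category with $\mathbb Z$-graded Hom groups, generated by objects $\mathcal E_1,\mathcal E_2$ (tensor product written as juxtaposition of objects) and morphisms $x_i:\mathcal E_i\to\mathcal E_i$ of degree $2$ (a dot) and $\tau_{ij}:\mathcal E_i\mathcal E_j\to\mathcal E_j\mathcal E_i$ of degree $-i\cdot j$ (a crossing), for $i,j\in\{1,2\}$, subject to the following relations ($1$ denotes identity morphisms, products are compositions with the rightmost factor applied first): (1) $\tau_{ii}(x_i\otimes 1)-(1\otimes x_i)\tau_{ii}=1=(x_i\otimes 1)\tau_{ii}-\tau_{ii}(1\otimes x_i)$; (2) $\tau_{ii}\tau_{ii}=0$; (3) for $i\ne j$: $\tau_{ji}\tau_{ij}=x_i\otimes 1+1\otimes x_j$; (4) for $i\neq j$: $(x_j\otimes 1)\tau_{ij}=\tau_{ij}(1\otimes x_j)$ and $(1\otimes x_i)\tau_{ij}=\tau_{ij}(x_i\otimes 1)$; (5) for all $i,j,k$: $(\tau_{jk}\otimes 1)(1\otimes\tau_{ik})(\tau_{ij}\otimes 1)-(1\otimes\tau_{ij})(\tau_{ik}\otimes 1)(1\otimes\tau_{jk})$ equals $1$ if $i=k\ne j$ and equals $0$ otherwise. Objects of $\mathcal U^+_3$ are formal finite direct sums of $\mathcal E_{i_1}\cdots\mathcal E_{i_k}\{t\}$ with $t\in\mathbb Z$, $i_s\in\{1,2\}$,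 $k\geq 0$; the group $\mathrm{Hom}(X\{t\},Y\{t'\})$ is the homogeneous part of degree $t-t'$ of $\mathrm{Hom}_{\mathcal H}(X,Y)$. It is monoidal, with shifts adding under tensor product. $\dot{\mathcal U}^+_3$ is the Karoubi envelope (idempotent completion) of $\mathcal U^+_3$; its objects are pairs $(X,e)$ with $e$ an idempotent endomorphism of $X$. The shift $\{t\}$ extends to all objects. Divided powers. On $\mathcal E_i^a=\mathcal E_i\cdots\mathcal E_i$ let $x_1,\dots,x_a$ denote the dots on the strands numbered left to right, $\delta_a=x_1^{a-1}x_2^{a-2}\cdots x_{a-1}$, and $D_a$ the composite of crossings $\tau_{ii}$ along a reduced word of the longest element of the symmetric group $S_a$. Then $e_a=\delta_aD_a$ is an idempotent of degree $0$, and $\mathcal E_i^{(a)}:=(\mathcal E_i^a,e_a)\{-a(a-1)/2\}$, with $\mathcal E_i^{(0)}$ the monoidal unit. *)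

(* Defs.v *)
(* The quotient Hom groups below are formed classically, whence boolp.        *)
From HB Require Import structures.
Set Warnings "-notation-overridden,-ambiguous-paths".
From mathcomp Require Import all_boot all_order all_algebra.
From mathcomp Require Import boolp zify.

Set Implicit Arguments.
Unset Strict Implicit.
Unset Printing Implicit Defensive.

Import GRing.Theory.
Local Open Scope ring_scope.
Local Open Scope quotient_scope.

(* The index set {1, 2}: 1 is [true] and 2 is [false], so that the index      *)
(* other than i is [~~ i]. The object E_{i_1} ... E_{i_k} of H is the word    *)
(* [:: i_1; ...; i_k]; the tensor product of objects is concatenation, which  *)
(* is associative only up to a propositional equality, whence [tcast].        *)
Definition node := bool.
Definition word := seq node.

Definition cartan (i j : node) : int := if i == j then 2 else - 1.

(* Formal Z-linear combinations of formal composites. In [tcomp f g] the      *)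
(* factor g is applied first; [ttens f g] places f to the left of g.          *)
Inductive term : word -> word -> Type :=
| tid X : term X X
| tdot i : term [:: i] [:: i]
| tcross i j : term [:: i; j] [:: j; i]
| tcomp X Y Z : term Y Z -> term X Y -> term X Z
| ttens X Y X' Y' : term X Y -> term X' Y' -> term (X ++ X') (Y ++ Y')
| tzero X Y : term X Y
| tadd X Y : term X Y -> term X Y -> term X Y
| topp X Y : term X Y -> term X Y.

Arguments tzero {X Y}.

Definition tcast X X' Y Y' (eX : X = X') (eY : Y = Y') (f : term X Y) :
    term X' Y' :=
  ecast Z (term X' Z) eY (ecast Z (term Z Y) eX f).

Declare Scope term_scope.
Delimit Scope term_scope with trm.
Bind Scope term_scope with term.
Notation "f ∘ g" := (tcomp f g) (at level 40, left associativity) : term_scope.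
Notation "f ⊗ g" := (ttens f g) (at level 38, left associativity) : term_scope.
Notation "f + g" := (tadd f g) : term_scope.
Notation "- f" := (topp f) : term_scope.
Notation "f - g" := (tadd f (topp g)) : term_scope.
Notation "1_ X" := (tid X) (at level 0, X at level 1, format "1_ X") : term_scope.

(* The congruence generated by the axioms of a strict monoidal Z-linear       *)
(* category and, from [trel_nil1] on, by the defining relations of H. The     *)
(* three-strand relation is split in two, since its right-hand side 1 only    *)
(* typechecks once k has been replaced by i.                                  *)
Inductive trel : forall X Y, term X Y -> term X Y -> Prop :=
| trel_refl X Y (f : term X Y) : trel f f
| trel_sym X Y (f g : term X Y) : trel f g -> trel g f
| trel_trans X Y (f g h : term X Y) : trel f g -> trel g h -> trel f h
| trel_comp X Y Z (f f' : term Y Z) (g g' : term X Y) :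
    trel f f' -> trel g g' -> trel (f ∘ g) (f' ∘ g')
| trel_tens X Y X' Y' (f f' : term X Y) (g g' : term X' Y') :
    trel f f' -> trel g g' -> trel (f ⊗ g) (f' ⊗ g')
| trel_add X Y (f f' g g' : term X Y) :
    trel f f' -> trel g g' -> trel (f + g) (f' + g')
| trel_opp X Y (f f' : term X Y) : trel f f' -> trel (- f) (- f')
| trel_addA X Y (f g h : term X Y) : trel (f + (g + h)) (f + g + h)
| trel_addC X Y (f g : term X Y) : trel (f + g) (g + f)
| trel_add0 X Y (f : term X Y) : trel (tzero + f) f
| trel_addN X Y (f : term X Y) : trel (- f + f) tzero
| trel_compA W X Y Z (f : term Y Z) (g : term X Y) (h : term W X) :
    trel (f ∘ (g ∘ h)) (f ∘ g ∘ h)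
| trel_comp1l X Y (f : term X Y) : trel (1_Y ∘ f) f
| trel_comp1r X Y (f : term X Y) : trel (f ∘ 1_X) f
| trel_compDl X Y Z (f f' : term Y Z) (g : term X Y) :
    trel ((f + f') ∘ g) (f ∘ g + f' ∘ g)
| trel_compDr X Y Z (f : term Y Z) (g g' : term X Y) :
    trel (f ∘ (g + g')) (f ∘ g + f ∘ g')
| trel_tensDl X Y X' Y' (f f' : term X Y) (g : term X' Y') :
    trel ((f + f') ⊗ g) (f ⊗ g + f' ⊗ g)
| trel_tensDr X Y X' Y' (f : term X Y) (g g' : term X' Y') :
    trel (f ⊗ (g + g')) (f ⊗ g + f ⊗ g')
| trel_tens1 X Y : trel (1_X ⊗ 1_Y) (1_(X ++ Y))
| trel_interchange X Y Z X' Y' Z' (f : term Y Z) (g : term X Y)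
    (f' : term Y' Z') (g' : term X' Y') :
    trel ((f ⊗ f') ∘ (g ⊗ g')) ((f ∘ g) ⊗ (f' ∘ g'))
| trel_tensA X Y X' Y' X'' Y''
    (f : term X Y) (g : term X' Y') (h : term X'' Y'') :
    trel (tcast (catA X X' X'') (catA Y Y' Y'') (f ⊗ (g ⊗ h))) (f ⊗ g ⊗ h)
| trel_tens1l X Y (f : term X Y) : trel (1_[::] ⊗ f) f
| trel_tens1r X Y (f : term X Y) :
    trel (tcast (cats0 X) (cats0 Y) (f ⊗ 1_[::])) f
| trel_nil1 i :
    trel (tcross i i ∘ (tdot i ⊗ 1_[:: i]) - (1_[:: i] ⊗ tdot i) ∘ tcross i i)
         1_[:: i; i]
| trel_nil2 i :
    trel ((tdot i ⊗ 1_[:: i]) ∘ tcross i i - tcross i i ∘ (1_[:: i] ⊗ tdot i))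
         1_[:: i; i]
| trel_crossii i : trel (tcross i i ∘ tcross i i) tzero
| trel_crossij i j : i != j ->
    trel (tcross j i ∘ tcross i j) (tdot i ⊗ 1_[:: j] + 1_[:: i] ⊗ tdot j)
| trel_slidel i j : i != j ->
    trel ((tdot j ⊗ 1_[:: i]) ∘ tcross i j) (tcross i j ∘ (1_[:: i] ⊗ tdot j))
| trel_slider i j : i != j ->
    trel ((1_[:: j] ⊗ tdot i) ∘ tcross i j) (tcross i j ∘ (tdot i ⊗ 1_[:: j]))
| trel_braid i j k : ~~ ((i == k) && (k != j)) ->
    trel ((tcross j k ⊗ 1_[:: i]) ∘ (1_[:: j] ⊗ tcross i k)
            ∘ (tcross i j ⊗ 1_[:: k])
          - (1_[:: k] ⊗ tcross i j) ∘ (tcross i k ⊗ 1_[:: j])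
            ∘ (1_[:: i] ⊗ tcross j k))
         tzero
| trel_braid1 i j : i != j ->
    trel ((tcross j i ⊗ 1_[:: i]) ∘ (1_[:: j] ⊗ tcross i i)
            ∘ (tcross i j ⊗ 1_[:: i])
          - (1_[:: i] ⊗ tcross i j) ∘ (tcross i i ⊗ 1_[:: j])
            ∘ (1_[:: i] ⊗ tcross j i))
         1_[:: i; j; i].

HB.instance Definition _ X Y := gen_eqMixin (term X Y).
HB.instance Definition _ X Y := gen_choiceMixin (term X Y).

Definition trelb X Y : rel (term X Y) := fun f g => `[< trel f g >].

Lemma trelb_refl X Y : reflexive (@trelb X Y).
Proof. by move=> f; apply/asboolP; constructor. Qed.

Lemma trelb_sym X Y : symmetric (@trelb X Y).
Proof. by move=> f g; apply/asboolP/asboolP; apply: trel_sym. Qed.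

Lemma trelb_trans X Y : transitive (@trelb X Y).
Proof.
move=> g f h /asboolP fg /asboolP gh; apply/asboolP; exact: trel_trans fg gh.
Qed.

Canonical trel_equiv X Y :=
  EquivRel (@trelb X Y) (@trelb_refl X Y) (@trelb_sym X Y) (@trelb_trans X Y).

(* The Hom groups of H; the class map is [hcls]. *)
Definition hom (X Y : word) := {eq_quot (@trelb X Y)}.
HB.instance Definition _ X Y := Choice.on (hom X Y).

Definition hcls X Y (f : term X Y) : hom X Y := \pi_({eq_quot (@trelb X Y)}) f.
Definition hrep X Y (f : hom X Y) : term X Y :=
  @repr _ {eq_quot (@trelb X Y)} f.

Lemma hrepK X Y (f : hom X Y) : hcls (hrep f) = f.
Proof. exact: reprK. Qed.

Lemma hclsP X Y (f g : term X Y) : hcls f = hcls g <-> trel f g.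
Proof.
split; first by move/eqmodP/asboolP.
by move=> fg; apply/eqmodP/asboolP.
Qed.

Lemma hrep_cls X Y (f : term X Y) : trel (hrep (hcls f)) f.
Proof. by apply/hclsP; rewrite hrepK. Qed.

Definition hzero X Y : hom X Y := hcls tzero.
Definition hadd X Y (f g : hom X Y) : hom X Y := hcls (hrep f + hrep g).
Definition hopp X Y (f : hom X Y) : hom X Y := hcls (- hrep f).

Lemma hclsD X Y (f g : term X Y) : hcls (f + g) = hadd (hcls f) (hcls g).
Proof. by apply/hclsP; apply: trel_add; apply/trel_sym/hrep_cls. Qed.

Lemma hclsN X Y (f : term X Y) : hcls (- f) = hopp (hcls f).
Proof. by apply/hclsP; apply: trel_opp; apply/trel_sym/hrep_cls. Qed.

Lemma haddA X Y : associative (@hadd X Y).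
Proof.
move=> f g h; rewrite -(hrepK f) -(hrepK g) -(hrepK h) -!hclsD.
by apply/hclsP; apply: trel_addA.
Qed.

Lemma haddC X Y : commutative (@hadd X Y).
Proof.
by move=> f g; rewrite -(hrepK f) -(hrepK g) -!hclsD; apply/hclsP/trel_addC.
Qed.

Lemma hadd0 X Y : left_id (hzero X Y) (@hadd X Y).
Proof. by move=> f; rewrite -(hrepK f) -hclsD; apply/hclsP/trel_add0. Qed.

Lemma haddN X Y : left_inverse (hzero X Y) (@hopp X Y) (@hadd X Y).
Proof. by move=> f; rewrite -(hrepK f) -hclsN -hclsD; apply/hclsP/trel_addN. Qed.

HB.instance Definition _ X Y :=
  GRing.isZmodule.Build (hom X Y) (@haddA X Y) (@haddC X Y) (@hadd0 X Y)
    (@haddN X Y).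

Definition hid X : hom X X := hcls (tid X).
Definition hdot i : hom [:: i] [:: i] := hcls (tdot i).
Definition hcross i j : hom [:: i; j] [:: j; i] := hcls (tcross i j).
Definition hcomp X Y Z (f : hom Y Z) (g : hom X Y) : hom X Z :=
  hcls (hrep f ∘ hrep g).
Definition htens X Y X' Y' (f : hom X Y) (g : hom X' Y') :
    hom (X ++ X') (Y ++ Y') :=
  hcls (hrep f ⊗ hrep g).

Declare Scope hom_scope.
Delimit Scope hom_scope with hom.
Notation "f ∘ g" := (hcomp f g) : hom_scope.
Notation "f ⊗ g" := (htens f g) : hom_scope.
Notation "1_ X" := (hid X) : hom_scope.
Local Open Scope hom_scope.

Lemma hcls_comp X Y Z (f : term Y Z) (g : term X Y) :
  hcls (tcomp f g) = hcls f ∘ hcls g.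
Proof. by apply/hclsP; apply: trel_comp; apply/trel_sym/hrep_cls. Qed.

Lemma hcls_tens X Y X' Y' (f : term X Y) (g : term X' Y') :
  hcls (ttens f g) = hcls f ⊗ hcls g.
Proof. by apply/hclsP; apply: trel_tens; apply/trel_sym/hrep_cls. Qed.

Lemma hclsDE X Y (f g : term X Y) : hcls (tadd f g) = hcls f + hcls g.
Proof. exact: hclsD. Qed.

Lemma hclsNE X Y (f : term X Y) : hcls (topp f) = - hcls f.
Proof. exact: hclsN. Qed.

Lemma hcls0E X Y : hcls (@tzero X Y) = 0.
Proof. by []. Qed.

Definition hclsE := (hcls_comp, hcls_tens, hclsDE, hclsNE, hcls0E).

Lemma hcompA W X Y Z (f : hom Y Z) (g : hom X Y) (h : hom W X) :
  f ∘ (g ∘ h) = f ∘ g ∘ h.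
Proof.
rewrite -(hrepK f) -(hrepK g) -(hrepK h) -!hclsE.
by apply/hclsP; apply: trel_compA.
Qed.

Lemma hcomp1l X Y (f : hom X Y) : 1_Y ∘ f = f.
Proof. by rewrite -(hrepK f) -hclsE; apply/hclsP/trel_comp1l. Qed.

Lemma hcomp1r X Y (f : hom X Y) : f ∘ 1_X = f.
Proof. by rewrite -(hrepK f) -hclsE; apply/hclsP/trel_comp1r. Qed.

Lemma hcompDl X Y Z (f f' : hom Y Z) (g : hom X Y) :
  (f + f') ∘ g = f ∘ g + f' ∘ g.
Proof.
rewrite -(hrepK f) -(hrepK f') -(hrepK g) -!hclsE.
by apply/hclsP; apply: trel_compDl.
Qed.

Lemma hcompDr X Y Z (f : hom Y Z) (g g' : hom X Y) :
  f ∘ (g + g') = f ∘ g + f ∘ g'.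
Proof.
rewrite -(hrepK f) -(hrepK g) -(hrepK g') -!hclsE.
by apply/hclsP; apply: trel_compDr.
Qed.

Lemma htensDl X Y X' Y' (f f' : hom X Y) (g : hom X' Y') :
  (f + f') ⊗ g = f ⊗ g + f' ⊗ g.
Proof.
rewrite -(hrepK f) -(hrepK f') -(hrepK g) -!hclsE.
by apply/hclsP; apply: trel_tensDl.
Qed.

Lemma htensDr X Y X' Y' (f : hom X Y) (g g' : hom X' Y') :
  f ⊗ (g + g') = f ⊗ g + f ⊗ g'.
Proof.
rewrite -(hrepK f) -(hrepK g) -(hrepK g') -!hclsE.
by apply/hclsP; apply: trel_tensDr.
Qed.

Lemma htens1 X Y : 1_X ⊗ 1_Y = 1_(X ++ Y).
Proof. by rewrite -hclsE; apply/hclsP/trel_tens1. Qed.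

Lemma hinterchange X Y Z X' Y' Z' (f : hom Y Z) (g : hom X Y)
    (f' : hom Y' Z') (g' : hom X' Y') :
  (f ⊗ f') ∘ (g ⊗ g') = (f ∘ g) ⊗ (f' ∘ g').
Proof.
rewrite -(hrepK f) -(hrepK g) -(hrepK f') -(hrepK g') -!hclsE.
by apply/hclsP; apply: trel_interchange.
Qed.

Definition hcast X X' Y Y' (eX : X = X') (eY : Y = Y') (f : hom X Y) :
    hom X' Y' :=
  ecast Z (hom X' Z) eY (ecast Z (hom Z Y) eX f).

Lemma hcls_cast X X' Y Y' (eX : X = X') (eY : Y = Y') (f : term X Y) :
  hcls (tcast eX eY f) = hcast eX eY (hcls f).
Proof. by case: _ / eX; case: _ / eY. Qed.

Lemma htensA X Y X' Y' X'' Y'' (f : hom X Y) (g : hom X' Y') (h : hom X'' Y'') :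
  hcast (catA X X' X'') (catA Y Y' Y'') (f ⊗ (g ⊗ h)) = f ⊗ g ⊗ h.
Proof.
rewrite -(hrepK f) -(hrepK g) -(hrepK h) -!hclsE -hcls_cast.
by apply/hclsP; apply: trel_tensA.
Qed.

Lemma hcomp0l X Y Z (g : hom X Y) : (0 : hom Y Z) ∘ g = 0.
Proof. by apply: (@addrI _ (0 ∘ g)); rewrite -hcompDl !addr0. Qed.

Lemma hcomp0r X Y Z (f : hom Y Z) : f ∘ (0 : hom X Y) = 0.
Proof. by apply: (@addrI _ (f ∘ 0)); rewrite -hcompDr !addr0. Qed.

Lemma htens0l X Y X' Y' (g : hom X' Y') : (0 : hom X Y) ⊗ g = 0.
Proof. by apply: (@addrI _ (0 ⊗ g)); rewrite -htensDl !addr0. Qed.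

Lemma htens0r X Y X' Y' (f : hom X Y) : f ⊗ (0 : hom X' Y') = 0.
Proof. by apply: (@addrI _ (f ⊗ 0)); rewrite -htensDr !addr0. Qed.

Lemma hcomp_suml (I : finType) X Y Z (F : I -> hom Y Z) (g : hom X Y) :
  (\sum_i F i) ∘ g = \sum_i (F i ∘ g).
Proof.
by elim/big_rec2: _ => [|i f f' _ <-]; rewrite ?hcomp0l ?hcompDl.
Qed.

Lemma hcomp_sumr (I : finType) X Y Z (f : hom Y Z) (F : I -> hom X Y) :
  f ∘ (\sum_i F i) = \sum_i (f ∘ F i).
Proof.
by elim/big_rec2: _ => [|i g g' _ <-]; rewrite ?hcomp0r ?hcompDr.
Qed.

Lemma htens_suml (I : finType) X Y X' Y' (F : I -> hom X Y) (g : hom X' Y') :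
  (\sum_i F i) ⊗ g = \sum_i (F i ⊗ g).
Proof.
by elim/big_rec2: _ => [|i f f' _ <-]; rewrite ?htens0l ?htensDl.
Qed.

Lemma htens_sumr (I : finType) X Y X' Y' (f : hom X Y) (F : I -> hom X' Y') :
  f ⊗ (\sum_i F i) = \sum_i (f ⊗ F i).
Proof.
by elim/big_rec2: _ => [|i g g' _ <-]; rewrite ?htens0r ?htensDr.
Qed.

(* [homog d f]: f lies in the degree d part of Hom_H(X, Y), i.e. f is a sum   *)
(* of signed diagrams of degree d. The defining relations are homogeneous.    *)
Inductive homog : forall X Y, int -> hom X Y -> Prop :=
| homog_id X : homog 0 1_X
| homog_dot i : homog 2 (hdot i)
| homog_cross i j : homog (- cartan i j) (hcross i j)
| homog_comp X Y Z d d' (f : hom Y Z) (g : hom X Y) :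
    homog d f -> homog d' g -> homog (d + d') (f ∘ g)
| homog_tens X Y X' Y' d d' (f : hom X Y) (g : hom X' Y') :
    homog d f -> homog d' g -> homog (d + d') (f ⊗ g)
| homog_0 X Y d : homog d (0 : hom X Y)
| homog_add X Y d (f g : hom X Y) : homog d f -> homog d g -> homog d (f + g)
| homog_opp X Y d (f : hom X Y) : homog d f -> homog d (- f).

Lemma homog_eq X Y d d' (f : hom X Y) : d = d' -> homog d f -> homog d' f.
Proof. by move=> <-. Qed.

Lemma homog_sum (I : finType) X Y d (F : I -> hom X Y) :
  (forall i, homog d (F i)) -> homog d (\sum_i F i).
Proof. by move=> dF; elim/big_ind: _ => //; [exact: homog_0|exact: homog_add]. Qed.

(* The object (+)_k E_{uword k}{ushift k} of U^+_3. *)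
Record uobj := UObj {
  uidx : finType;
  uword : uidx -> word;
  ushift : uidx -> int }.

(* A matrix of morphisms; the entry at (k, l) goes from the k-th summand of X *)
(* to the l-th summand of Y.                                                  *)
Record uhom (X Y : uobj) := UHom {
  uent :> forall (k : uidx X) (l : uidx Y), hom (uword k) (uword l);
  uhomog : forall k l, homog (ushift k - ushift l) (uent k l) }.

Lemma uhomP X Y (f g : uhom X Y) : (forall k l, f k l = g k l) <-> f = g.
Proof.
split=> [|-> //]; case: f g => f f_h [g g_h] /= fg.
have e : f = g by apply: functional_extensionality_dep => k;
  apply: functional_extensionality_dep => l.
by case: _ / e in g_h *; congr UHom; apply: Prop_irrelevance.
Qed.

Definition ucomp_ent X Y Z (f : uhom Y Z) (g : uhom X Y)
    (k : uidx X) (m : uidx Z) : hom (uword k) (uword m) :=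
  \sum_(l : uidx Y) (f l m ∘ g k l).

Lemma ucomp_homog X Y Z (f : uhom Y Z) (g : uhom X Y) k m :
  homog (ushift k - ushift m) (ucomp_ent f g k m).
Proof.
apply: homog_sum => l.
apply: homog_eq (homog_comp (uhomog f l m) (uhomog g k l)).
by rewrite addrC addrA subrK.
Qed.

Definition ucomp X Y Z (f : uhom Y Z) (g : uhom X Y) : uhom X Z :=
  UHom (ucomp_homog f g).

Definition uid_ent X (k l : uidx X) : hom (uword k) (uword l) :=
  if @eqP _ k l is ReflectT e then
    hcast (erefl (uword k)) (congr1 (@uword X) e) (1_(uword k))
  else 0.

Lemma uid_homog X (k l : uidx X) : homog (ushift k - ushift l) (uid_ent k l).
Proof.
rewrite /uid_ent; case: eqP => [e|_]; last exact: homog_0.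
by case: _ / e; rewrite subrr /=; apply: homog_id.
Qed.

Definition uid X : uhom X X := UHom (@uid_homog X).

Definition utens_obj (X Y : uobj) : uobj :=
  @UObj (uidx X * uidx Y)%type (fun k => uword k.1 ++ uword k.2)
    (fun k => ushift k.1 + ushift k.2).

Lemma utens_homog X Y X' Y' (f : uhom X Y) (g : uhom X' Y')
    (k : uidx (utens_obj X X')) (l : uidx (utens_obj Y Y')) :
  homog (ushift k - ushift l) (f k.1 l.1 ⊗ g k.2 l.2).
Proof.
apply: homog_eq (homog_tens (uhomog f _ _) (uhomog g _ _)).
by rewrite /= opprD addrACA.
Qed.

Definition utens X Y X' Y' (f : uhom X Y) (g : uhom X' Y') :
    uhom (utens_obj X X') (utens_obj Y Y') :=
  UHom (utens_homog f g).

Definition ushift_obj (t : int) (X : uobj) : uobj :=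
  @UObj (uidx X) (@uword X) (fun k => ushift k + t).

Lemma ushift_homog t X Y (f : uhom X Y)
    (k : uidx (ushift_obj t X)) (l : uidx (ushift_obj t Y)) :
  homog (ushift k - ushift l) (f k l).
Proof. by rewrite /= opprD addrACA subrr addr0; apply: uhomog. Qed.

Definition ushift_hom t X Y (f : uhom X Y) :
    uhom (ushift_obj t X) (ushift_obj t Y) :=
  UHom (ushift_homog (t := t) f).

Definition uzero_obj : uobj :=
  @UObj void (fun=> [::]) (fun=> 0).

Definition uzero_hom X Y : uhom X Y :=
  UHom (fun k l => homog_0 (uword k) (uword l) (ushift k - ushift l)).

Definition usum_obj (X Y : uobj) : uobj :=
  @UObj (uidx X + uidx Y)%type
    (fun k => match k with inl k => uword k | inr k => uword k end)
    (fun k => match k with inl k => ushift k | inr k => ushift k end).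

Definition usum_ent X Y X' Y' (f : uhom X Y) (g : uhom X' Y')
    (k : uidx (usum_obj X X')) (l : uidx (usum_obj Y Y')) :
    hom (uword k) (uword l) :=
  match k, l with
  | inl k, inl l => f k l
  | inr k, inr l => g k l
  | inl k, inr l => 0
  | inr k, inl l => 0
  end.

Lemma usum_homog X Y X' Y' (f : uhom X Y) (g : uhom X' Y') k l :
  homog (ushift k - ushift l) (@usum_ent X Y X' Y' f g k l).
Proof. by case: k l => k [] l /=; do ?[exact: homog_0|exact: uhomog]. Qed.

Definition usum X Y X' Y' (f : uhom X Y) (g : uhom X' Y') :
    uhom (usum_obj X X') (usum_obj Y Y') :=
  UHom (usum_homog f g).

Lemma ucompA W X Y Z (f : uhom Y Z) (g : uhom X Y) (h : uhom W X) :
  ucomp f (ucomp g h) = ucomp (ucomp f g) h.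
Proof.
apply/uhomP => k m /=; rewrite /ucomp_ent /=.
under eq_bigr do rewrite hcomp_sumr.
rewrite exchange_big /=; apply: eq_bigr => l _.
by rewrite hcomp_suml; apply: eq_bigr => l' _; rewrite hcompA.
Qed.

Lemma uid_entk X (k : uidx X) : uid_ent k k = 1_(uword k).
Proof. by rewrite /uid_ent; case: eqP => // e; rewrite (eq_axiomK e). Qed.

Lemma uid_ent0 X (k l : uidx X) : k != l -> uid_ent k l = 0.
Proof. by rewrite /uid_ent; case: eqP. Qed.

Lemma ucomp1l X Y (f : uhom X Y) : ucomp (uid Y) f = f.
Proof.
apply/uhomP => k l /=; rewrite /ucomp_ent (bigD1 l) //= uid_entk hcomp1l.
by rewrite big1 ?addr0 // => m ml; rewrite uid_ent0 // hcomp0l.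
Qed.

Lemma ucomp1r X Y (f : uhom X Y) : ucomp f (uid X) = f.
Proof.
apply/uhomP => k l /=; rewrite /ucomp_ent (bigD1 k) //= uid_entk hcomp1r.
by rewrite big1 ?addr0 // => m mk; rewrite uid_ent0 1?eq_sym // hcomp0r.
Qed.

Lemma ucomp_tens X Y Z X' Y' Z' (f : uhom Y Z) (g : uhom X Y)
    (f' : uhom Y' Z') (g' : uhom X' Y') :
  ucomp (utens f f') (utens g g') = utens (ucomp f g) (ucomp f' g').
Proof.
apply/uhomP => k m /=; rewrite /ucomp_ent /= htens_suml.
under [RHS]eq_bigr do rewrite htens_sumr.
by rewrite pair_bigA; apply: eq_bigr => -[l l'] _ /=; rewrite hinterchange.
Qed.

Lemma ucomp_shift t X Y Z (f : uhom Y Z) (g : uhom X Y) :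
  ucomp (ushift_hom t f) (ushift_hom t g) = ushift_hom t (ucomp f g).
Proof. exact/uhomP. Qed.

Lemma ucomp_sum X Y Z X' Y' Z' (f : uhom Y Z) (g : uhom X Y)
    (f' : uhom Y' Z') (g' : uhom X' Y') :
  ucomp (usum f f') (usum g g') = usum (ucomp f g) (ucomp f' g').
Proof.
apply/uhomP => -[] k [] m /=; rewrite /ucomp_ent big_sumType /=.
- by rewrite [X in _ + X]big1 ?addr0 // => l _; rewrite hcomp0r.
- by rewrite !big1 ?addr0 // => l _; rewrite ?hcomp0l ?hcomp0r.
- by rewrite !big1 ?addr0 // => l _; rewrite ?hcomp0l ?hcomp0r.
- by rewrite big1 ?add0r // => l _; rewrite hcomp0r.
Qed.

(* The Karoubi envelope of U^+_3: its morphisms (X, e) -> (Y, e') are the g   *)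
(* with e' g e = g, the identity of (X, e) being e.                           *)
Record kobj := KObj {
  kbase : uobj;
  kidem : uhom kbase kbase;
  kidemP : ucomp kidem kidem = kidem }.

Record khom (X Y : kobj) := KHom {
  kmor :> uhom (kbase X) (kbase Y);
  kmorP : ucomp (kidem Y) (ucomp kmor (kidem X)) = kmor }.

Lemma kid_subproof X : ucomp (kidem X) (ucomp (kidem X) (kidem X)) = kidem X.
Proof. by rewrite !kidemP. Qed.

Definition kid X : khom X X := KHom (kid_subproof X).

Lemma kcomp_subproof X Y Z (f : khom Y Z) (g : khom X Y) :
  ucomp (kidem Z) (ucomp (ucomp f g) (kidem X)) = ucomp f g.
Proof.
rewrite -(kmorP f) -(kmorP g) !ucompA kidemP.
by rewrite -[X in X = _]ucompA kidemP.
Qed.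

Definition kcomp X Y Z (f : khom Y Z) (g : khom X Y) : khom X Z :=
  KHom (kcomp_subproof f g).

Definition kiso (X Y : kobj) : Prop :=
  exists (f : khom X Y) (g : khom Y X),
    kcomp g f = kid X /\ kcomp f g = kid Y.

Lemma kshift_subproof t X :
  ucomp (ushift_hom t (kidem X)) (ushift_hom t (kidem X))
  = ushift_hom t (kidem X).
Proof. by rewrite ucomp_shift kidemP. Qed.

Definition kshift (t : int) (X : kobj) : kobj := KObj (kshift_subproof t X).

Lemma ktens_subproof X Y :
  ucomp (utens (kidem X) (kidem Y)) (utens (kidem X) (kidem Y))
  = utens (kidem X) (kidem Y).
Proof. by rewrite ucomp_tens !kidemP. Qed.

Definition ktens (X Y : kobj) : kobj := KObj (ktens_subproof X Y).

Lemma kzero_subproof :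
  ucomp (uzero_hom uzero_obj uzero_obj) (uzero_hom uzero_obj uzero_obj)
  = uzero_hom uzero_obj uzero_obj.
Proof. by apply/uhomP => -[]. Qed.

Definition kzero : kobj := KObj kzero_subproof.

Lemma ksum_subproof X Y :
  ucomp (usum (kidem X) (kidem Y)) (usum (kidem X) (kidem Y))
  = usum (kidem X) (kidem Y).
Proof. by rewrite ucomp_sum !kidemP. Qed.

Definition ksum (X Y : kobj) : kobj := KObj (ksum_subproof X Y).

Definition indecomposable (X : kobj) : Prop :=
  ~ kiso X kzero /\
  forall Y Z, kiso X (ksum Y Z) -> kiso Y kzero \/ kiso Z kzero.

(* x_i^m on a single strand. *)
Definition dotpow (i : node) (m : nat) : hom [:: i] [:: i] :=
  iter m (hcomp (hdot i)) 1_[:: i].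

(* delta_a = x_1^(a-1) x_2^(a-2) ... x_(a-1), strand by strand. *)
Fixpoint delta (i : node) (a : nat) : hom (nseq a i) (nseq a i) :=
  match a with
  | 0 => 1_[::]
  | a'.+1 => dotpow i a' ⊗ delta i a'
  end.

(* s_a ... s_2 s_1 on a + 1 strands, s_k being the crossing tau_ii of the     *)
(* strands k and k + 1.                                                       *)
Fixpoint cyc (i : node) (a : nat) : hom (nseq a.+1 i) (nseq a.+1 i) :=
  match a with
  | 0 => 1_[:: i]
  | a'.+1 => (1_[:: i] ⊗ cyc i a') ∘ (hcross i i ⊗ 1_(nseq a' i))
  end.

(* D_a, along the reduced word w_(a+1) = (s_a ... s_2 s_1) w_a^+, where w_a^+ *)
(* is the word w_a of the longest element of S_a shifted to s_2, ..., s_a.    *)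
Fixpoint longcross (i : node) (a : nat) : hom (nseq a i) (nseq a i) :=
  match a with
  | 0 => 1_[::]
  | a'.+1 => cyc i a' ∘ (1_[:: i] ⊗ longcross i a')
  end.

Definition dividem (i : node) (a : nat) : hom (nseq a i) (nseq a i) :=
  delta i a ∘ longcross i a.

Lemma hcrossxl i :
  hcross i i ∘ (hdot i ⊗ 1_[:: i])
  = (1_[:: i] ⊗ hdot i) ∘ hcross i i + 1_[:: i; i].
Proof.
have /hclsP := trel_nil1 i; rewrite !hclsE => /eqP.
rewrite subr_eq addrC => /eqP e.
rewrite -[hdot i ⊗ _]hcls_tens -[1_(_) ⊗ _]hcls_tens; exact: e.
Qed.

Lemma hcross2 i : hcross i i ∘ hcross i i = 0.
Proof. by have /hclsP := trel_crossii i; rewrite !hclsE => e; exact: e. Qed.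

Lemma hbraid i :
  (hcross i i ⊗ 1_[:: i]) ∘ (1_[:: i] ⊗ hcross i i) ∘ (hcross i i ⊗ 1_[:: i])
  = (1_[:: i] ⊗ hcross i i) ∘ (hcross i i ⊗ 1_[:: i])
    ∘ (1_[:: i] ⊗ hcross i i).
Proof.
have ii : ~~ ((i == i) && (i != i)) by rewrite eqxx.
have /hclsP := trel_braid ii.
rewrite !(hcls_comp, hclsDE, hclsNE, hcls0E) => /eqP; rewrite subr_eq0 => /eqP e.
rewrite -[hcross i i ⊗ _]hcls_tens -[1_(_) ⊗ _]hcls_tens; exact: e.
Qed.

Lemma htens1l X Y (f : hom X Y) : 1_[::] ⊗ f = f.
Proof. by rewrite -(hrepK f) -hclsE; apply/hclsP/trel_tens1l. Qed.

Lemma hcast_id X Y (eX : X = X) (eY : Y = Y) (f : hom X Y) : hcast eX eY f = f.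
Proof. by rewrite (eq_axiomK eX) (eq_axiomK eY). Qed.

Lemma htensA2 i j X Y (f : hom X Y) :
  1_[:: i] ⊗ (1_[:: j] ⊗ f) = 1_[:: i; j] ⊗ f.
Proof.
have := htensA 1_[:: i] 1_[:: j] f.
by rewrite (hcast_id (X := i :: j :: X) (Y := i :: j :: Y)) htens1.
Qed.

Lemma htensA1 i j X Y (f : hom [:: i] [:: i]) (g : hom [:: j] [:: j])
    (h : hom X Y) :
  f ⊗ (g ⊗ h) = (f ⊗ g) ⊗ h.
Proof.
by rewrite -htensA (hcast_id (X := i :: j :: X) (Y := i :: j :: Y)).
Qed.

Lemma htensA3 i j k l m Z (f : hom [:: i; j] [:: k; l]) :
  1_[:: m] ⊗ (f ⊗ 1_Z) = (1_[:: m] ⊗ f) ⊗ 1_Z.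
Proof.
by rewrite -htensA
  (hcast_id (X := [:: m, i, j & Z]) (Y := [:: m, k, l & Z])).
Qed.

Lemma htensA4 i j k l m Z (f : hom [:: i; j] [:: k; l]) :
  f ⊗ 1_(m :: Z) = (f ⊗ 1_[:: m]) ⊗ 1_Z.
Proof.
rewrite -htensA htens1.
by rewrite (hcast_id (X := [:: i, j, m & Z]) (Y := [:: k, l, m & Z])).
Qed.

(* The three operations below fix the shape of the source and target words,   *)
(* which the unifier does not see through the concatenations.                 *)
Definition whisk i X Y (f : hom X Y) : hom (i :: X) (i :: Y) := 1_[:: i] ⊗ f.
Definition crossl i Z : hom [:: i, i & Z] [:: i, i & Z] := hcross i i ⊗ 1_Z.
Definition dotl i Z : hom (i :: Z) (i :: Z) := hdot i ⊗ 1_Z.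
Definition dotpowl i q Z : hom (i :: Z) (i :: Z) := dotpow i q ⊗ 1_Z.

Lemma whiskD i X Y (f g : hom X Y) : whisk i (f + g) = whisk i f + whisk i g.
Proof. exact: (htensDr 1_[:: i] f g). Qed.

Lemma whisk0 i X Y : whisk i (0 : hom X Y) = 0.
Proof. exact: (htens0r X Y 1_[:: i]). Qed.

Lemma whisk1 i X : whisk i 1_X = 1_(i :: X).
Proof. exact: (htens1 [:: i]). Qed.

Lemma whiskM i X Y Z (f : hom Y Z) (g : hom X Y) :
  whisk i (f ∘ g) = whisk i f ∘ whisk i g.
Proof.
by have := hinterchange 1_[:: i] 1_[:: i] f g; rewrite hcomp1l => e; exact: esym e.
Qed.

Lemma crossl2 i Z : crossl i Z ∘ crossl i Z = 0.
Proof.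
etransitivity; first exact: (hinterchange (hcross i i) (hcross i i) 1_Z 1_Z).
by rewrite hcross2 htens0l.
Qed.

Lemma whisk_crossl i Z :
  whisk i (crossl i Z) = (1_[:: i] ⊗ hcross i i : hom [:: i; i; i] _) ⊗ 1_Z.
Proof. exact: (htensA3 i Z (hcross i i)). Qed.

Lemma crossl_cons i Z :
  crossl i (i :: Z) = (hcross i i ⊗ 1_[:: i] : hom [:: i; i; i] _) ⊗ 1_Z.
Proof. exact: (htensA4 i Z (hcross i i)). Qed.

Lemma crossl_braid i Z :
  crossl i (i :: Z) ∘ whisk i (crossl i Z) ∘ crossl i (i :: Z)
  = whisk i (crossl i Z) ∘ crossl i (i :: Z) ∘ whisk i (crossl i Z).
Proof.
rewrite whisk_crossl crossl_cons.
have M (f g h : hom [:: i; i; i] [:: i; i; i]) :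
    ((f ⊗ 1_Z) ∘ (g ⊗ 1_Z) ∘ (h ⊗ 1_Z)) = (f ∘ g ∘ h) ⊗ 1_Z.
  by rewrite !hinterchange !hcomp1l.
etransitivity; first exact: M.
etransitivity; last exact: esym (M _ _ _).
exact: (congr1 (fun f : hom [:: i; i; i] [:: i; i; i] => f ⊗ 1_Z) (hbraid i)).
Qed.

Lemma crossl_far i Z W (f : hom Z W) :
  crossl i W ∘ whisk i (whisk i f) = whisk i (whisk i f) ∘ crossl i Z.
Proof.
have -> : whisk i (whisk i f) = 1_[:: i; i] ⊗ f by exact: htensA2.
etransitivity; first exact: (hinterchange (hcross i i) 1_[:: i; i] 1_W f).
etransitivity; last exact: esym (hinterchange 1_[:: i; i] (hcross i i) f 1_Z).
by rewrite !hcomp1l !hcomp1r.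
Qed.

Lemma dotl_far i Z W (f : hom Z W) :
  dotl i W ∘ whisk i f = whisk i f ∘ dotl i Z.
Proof.
etransitivity; first exact: (hinterchange (hdot i) 1_[:: i] 1_W f).
etransitivity; last exact: esym (hinterchange 1_[:: i] (hdot i) f 1_Z).
by rewrite !hcomp1l !hcomp1r.
Qed.

Lemma dotpowl0 i Z : dotpowl i 0 Z = 1_(i :: Z).
Proof. exact: (htens1 [:: i]). Qed.

Lemma dotpowlS i q Z : dotpowl i q.+1 Z = dotl i Z ∘ dotpowl i q Z.
Proof.
have := hinterchange (hdot i) (dotpow i q) 1_Z 1_Z; rewrite hcomp1l => e.
exact: esym e.
Qed.

Lemma dotlC i q Z : dotpowl i q Z ∘ dotl i Z = dotl i Z ∘ dotpowl i q Z.
Proof.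
elim: q => [|q IH]; first by rewrite dotpowl0 hcomp1l hcomp1r.
by rewrite !dotpowlS -hcompA IH.
Qed.

Lemma crossl_dotl i Z :
  crossl i Z ∘ dotl i (i :: Z)
  = whisk i (dotl i Z) ∘ crossl i Z + 1_[:: i, i & Z].
Proof.
have -> : dotl i (i :: Z) = (hdot i ⊗ 1_[:: i] : hom [:: i; i] _) ⊗ 1_Z.
  rewrite -[RHS](htensA1 (hdot i) 1_[:: i] 1_Z).
  exact: (congr1 (htens (hdot i)) (esym (whisk1 i Z))).
have -> : whisk i (dotl i Z) = (1_[:: i] ⊗ hdot i : hom [:: i; i] _) ⊗ 1_Z.
  exact: htensA1.
have M (f g : hom [:: i; i] [:: i; i]) :
    (f ⊗ 1_Z) ∘ (g ⊗ 1_Z) = (f ∘ g) ⊗ 1_Z by rewrite hinterchange hcomp1l.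
etransitivity; first exact: M.
have E : (1_[:: i; i] ⊗ 1_Z : hom [:: i, i & Z] _) = 1_[:: i, i & Z].
  exact: (htens1 [:: i; i]).
rewrite -E; etransitivity; last exact: (congr1 (fun f => f + _) (esym (M _ _))).
etransitivity; last exact: (htensDl _ 1_[:: i; i] 1_Z).
exact: (congr1 (fun f : hom [:: i; i] [:: i; i] => f ⊗ 1_Z) (hcrossxl i)).
Qed.

(* [simple_cross s]: s is one of the crossings s_1, ..., s_(a-1). *)
Fixpoint simple_cross (i : node) (a : nat) :
    hom (nseq a i) (nseq a i) -> Prop :=
  match a with
  | 0 => fun=> False
  | a'.+1 => fun s =>
      (exists2 s', simple_cross (a := a') s' & s = whisk i s') \/
      match a' return hom (nseq a'.+1 i) (nseq a'.+1 i) -> Prop with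
      | 0 => fun=> False
      | b.+1 => fun s => s = crossl i (nseq b i)
      end s
  end.

Lemma cycS i a : cyc i a.+1 = whisk i (cyc i a) ∘ crossl i (nseq a i).
Proof. by []. Qed.

Lemma longcrossS i a :
  longcross i a.+1 = cyc i a ∘ whisk i (longcross i a).
Proof. by []. Qed.

Lemma cross_cyc i a (s : hom (nseq a.+1 i) (nseq a.+1 i)) :
  simple_cross s -> s ∘ cyc i a = 0 \/
  exists2 s', simple_cross s' & s ∘ cyc i a = cyc i a ∘ whisk i s'.
Proof.
elim: a s => [|b IH] s; first by case=> // -[].
case=> [[s' s's ->]|->].
  rewrite cycS hcompA -whiskM.
  have [->|[s2 s2s ->]] := IH _ s's; first by left; rewrite whisk0 hcomp0l.
  right; exists (whisk i s2); first by left; exists s2.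
  by rewrite whiskM -!hcompA crossl_far.
case: b IH {s} => [|d] _.
  left; rewrite cycS (_ : whisk i (cyc i 0) = 1_[:: i; i]) ?hcomp1l ?crossl2 //.
  exact: whisk1.
right; exists (crossl i (nseq d i)); first by right.
rewrite cycS cycS whiskM !hcompA.
rewrite (crossl_far i (cyc i d)) -!hcompA; congr (_ ∘ _).
by rewrite !hcompA; exact: crossl_braid.
Qed.

Lemma cross_longcross i a (s : hom (nseq a i) (nseq a i)) :
  simple_cross s -> s ∘ longcross i a = 0.
Proof.
elim: a s => [|a IH] s // ss; rewrite longcrossS hcompA.
have [->|[s' s's ->]] := cross_cyc ss; first by rewrite hcomp0l.
by rewrite -hcompA -whiskM IH // whisk0 hcomp0r.
Qed.

(* h_(q-1)(x_1, x_2), the Demazure operator applied to x_1^q. *)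
Fixpoint dotpow_diff (i : node) (q : nat) Z : hom [:: i, i & Z] [:: i, i & Z] :=
  match q with
  | 0 => 0
  | q'.+1 => whisk i (dotpowl i q' Z) + dotl i (i :: Z) ∘ dotpow_diff i q' Z
  end.

Lemma dotpow_diffC i q Z :
  dotpow_diff i q Z ∘ dotl i (i :: Z) = dotl i (i :: Z) ∘ dotpow_diff i q Z.
Proof.
elim: q => [|q IH] /=; first by rewrite hcomp0l hcomp0r.
by rewrite hcompDl hcompDr -hcompA IH dotl_far.
Qed.

Lemma crossl_dotpowl i q Z :
  crossl i Z ∘ dotpowl i q (i :: Z)
  = whisk i (dotpowl i q Z) ∘ crossl i Z + dotpow_diff i q Z.
Proof.
elim: q => [|q IH].
  by rewrite !dotpowl0 whisk1 hcomp1l hcomp1r addr0.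
rewrite dotpowlS -dotlC hcompA IH hcompDl -hcompA crossl_dotl hcompDr hcomp1r.
by rewrite dotpow_diffC -addrA hcompA -whiskM dotpowlS dotlC.
Qed.

Record hmorph (W X : word) := HMorph {
  hfun :> hom W W -> hom X X;
  hfunD : forall f g, hfun (f + g) = hfun f + hfun g;
  hfunM : forall f g, hfun (f ∘ g) = hfun f ∘ hfun g;
  hfun1 : hfun 1_W = 1_X }.

Lemma hmorph_whisk W X i (F : hmorph (i :: W) X) :
  exists F' : hmorph W X, forall f, F' f = F (whisk i f).
Proof.
unshelve eexists (@HMorph W X (fun f => F (whisk i f)) _ _ _) => //.
- by move=> f g /=; rewrite whiskD hfunD.
- by move=> f g /=; rewrite whiskM hfunM.
- by rewrite /= whisk1 hfun1.
Qed.

Lemma hfun0 W X (F : hmorph W X) : F 0 = 0.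
Proof. by apply: (@addrI _ (F 0)); rewrite -hfunD !addr0. Qed.

Lemma cyc_absorb i a V X (F : hmorph (nseq a.+1 i) X) (z : hom V X) q :
  (forall s, simple_cross s -> F s ∘ z = 0) -> (q <= a)%N ->
  F (cyc i a ∘ dotpowl i q (nseq a i)) ∘ z = if q == a then z else 0.
Proof.
elim: a F q => [|b IH] F q Fz.
  rewrite leqn0 => /eqP ->; rewrite eqxx dotpowl0.
  by rewrite (hcomp1r (cyc i 0)) (hfun1 F) hcomp1l.
have [F' F'E] := @hmorph_whisk (nseq b.+1 i) X i F.
have F'z s : simple_cross s -> F' s ∘ z = 0.
  by move=> ss; rewrite F'E; apply: Fz; left; exists s.
have step r : (r <= b.+1)%N ->
    F (whisk i (cyc i b) ∘ dotpow_diff i r (nseq b i)) ∘ z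
    = if r == b.+1 then z else 0.
  elim: r => [_|r IHr rb]; first by rewrite hcomp0r hfun0 hcomp0l.
  rewrite [dotpow_diff _ _ _]/= hcompDr hfunD hcompDl.
  rewrite -whiskM -F'E (IH F' r F'z) // eqSS.
  rewrite hcompA -dotl_far -hcompA hfunM -hcompA IHr ?(ltnW rb) //.
  by rewrite (ltn_eqF rb) hcomp0r addr0.
move=> qb; rewrite -step // cycS -hcompA crossl_dotpowl.
rewrite hcompDr hfunD hcompDl hcompA hfunM -!hcompA Fz ?hcomp0r ?add0r //.
by right.
Qed.

Lemma longcross_delta_absorb i a V X (F : hmorph (nseq a i) X) (z : hom V X) :
  (forall s, simple_cross s -> F s ∘ z = 0) ->
  F (longcross i a ∘ delta i a) ∘ z = z.
Proof.
elim: a F => [|a IH] F Fz; first by rewrite /= hcomp1l hfun1 hcomp1l.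
have [F' F'E] := @hmorph_whisk (nseq a i) X i F.
have -> : longcross i a.+1 ∘ delta i a.+1
  = (cyc i a ∘ dotpowl i a (nseq a i))
    ∘ whisk i (longcross i a ∘ delta i a).
  rewrite longcrossS whiskM -!hcompA; congr (_ ∘ _); rewrite !hcompA.
  have -> : dotpowl i a (nseq a i) ∘ whisk i (longcross i a)
          = whisk i (longcross i a) ∘ dotpowl i a (nseq a i).
    elim: (X in dotpowl i X _) => [|q IHq].
      by rewrite dotpowl0 hcomp1l hcomp1r.
    by rewrite dotpowlS -hcompA IHq !hcompA dotl_far.
  rewrite -hcompA; congr (_ ∘ _); apply: esym.
  etransitivity; first exact: (hinterchange (dotpow i a) 1_[:: i]).
  by rewrite hcomp1l hcomp1r.
rewrite hfunM -hcompA -F'E IH; first by rewrite cyc_absorb // eqxx.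
by move=> s ss; rewrite F'E; apply: Fz; left; exists s.
Qed.

Lemma dividem_idem i a : dividem i a ∘ dividem i a = dividem i a.
Proof.
rewrite /dividem -hcompA; congr (_ ∘ _); rewrite hcompA.
pose F := @HMorph _ _ id (fun _ _ => erefl) (fun _ _ => erefl)
                (erefl 1_(nseq a i)).
exact: (longcross_delta_absorb (F := F) (@cross_longcross i a)).
Qed.

Lemma dotpow_homog i m : homog (m%:Z *+ 2) (dotpow i m).
Proof.
elim: m => [|m IH]; first exact: homog_id.
apply: homog_eq (homog_comp (homog_dot i) IH).
by rewrite intS mulrnDl.
Qed.

Lemma cyc_homog i a : homog (- a%:Z *+ 2) (cyc i a).
Proof.
elim: a => [|a IH]; first exact: homog_id.
have hl : homog (0 + - a%:Z *+ 2) (whisk i (cyc i a)).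
  exact: (homog_tens (homog_id [:: i]) IH).
have hr : homog (- cartan i i + 0) (crossl i (nseq a i)).
  exact: (homog_tens (homog_cross i i) (homog_id (nseq a i))).
apply: homog_eq (homog_comp hl hr).
by rewrite /cartan eqxx; lia.
Qed.

Lemma dividem_homog i a : homog 0 (dividem i a).
Proof.
rewrite /dividem.
suff [d [dd dc]] : exists d, homog d (delta i a) /\ homog (- d) (longcross i a).
  by apply: homog_eq (homog_comp dd dc); rewrite subrr.
elim: a => [|a [d [dd dc]]].
  by exists 0; split; rewrite ?oppr0; apply: homog_id.
exists (a%:Z *+ 2 + d); split; first exact: (homog_tens (dotpow_homog i a) dd).
have hr : homog (0 - d) (whisk i (longcross i a)).
  exact: (homog_tens (homog_id [:: i]) dc).
apply: homog_eq (homog_comp (cyc_homog i a) hr).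
lia.
Qed.

Definition uword_obj (w : word) : uobj := @UObj unit (fun=> w) (fun=> 0).

Lemma uword_homog w (f : hom w w) : homog 0 f ->
  forall k l : uidx (uword_obj w), homog (ushift k - ushift l) f.
Proof. by move=> f0 k l; rewrite subrr. Qed.

Definition divu (i : node) (a : nat) :
    uhom (uword_obj (nseq a i)) (uword_obj (nseq a i)) :=
  UHom (uword_homog (dividem_homog i a)).

Lemma divu_idem i a : ucomp (divu i a) (divu i a) = divu i a.
Proof.
apply/uhomP => -[] [] /=; rewrite /ucomp_ent /= (bigD1 tt) //=.
by rewrite dividem_idem big1 ?addr0 // => -[].
Qed.

(* The divided power E_i^(a). For a = 0 both [delta] and [longcross] are      *)
(* identities of the empty word, so this is the monoidal unit.                *)
Definition divpow (i : node) (a : nat) : kobj :=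
  kshift (- ((a * a.-1) %/ 2)%:Z) (KObj (divu_idem i a)).

(* [Label i a b c t] is the object E_i^(a) E_j^(b) E_i^(c) {t}, where j is the *)
(* index other than i; i is the choice of one of the two families.           *)
Record label := Label {
  lnode : node; la : nat; lb : nat; lc : nat; lshift : int }.

Definition Bobj (p : label) : kobj :=
  kshift (lshift p)
    (ktens (ktens (divpow (lnode p) (la p)) (divpow (~~ lnode p) (lb p)))
           (divpow (lnode p) (lc p))).

Definition in_calB (p : label) : bool := (la p + lc p <= lb p)%N.

Definition kdirect_sum (s : seq kobj) : kobj := foldr ksum kzero s.

(* Main.v *)
(* In the quotient of H by the words E_i^a E_j^b E_i^c with b >= a + c, the    *)
(* degree three relation on E_i E_j E_i, together with the nilHecke algebras,  *)
(* kills the identity of every word; so each object is a retract of a sum of   *)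
(* shifts of objects of B. As the homs out of a word are spanned by dotted     *)
(* permutation diagrams, counting crossings shows that between objects of B    *)
(* (one taken from each isomorphism class) there are no homs of negative       *)
(* degree, none of degree 0 unless the two objects are equal, and that those   *)
(* form Z in that case. So an endomorphism of a sum of such objects is,        *)
(* modulo a nilpotent ideal, a family of integer matrices, and integer         *)
(* idempotents split: this gives the decomposition over Z. The same count,     *)
(* applied to E_1^(a) E_2^(a+c) E_1^(c) and E_2^(c) E_1^(a+c) E_2^(a), leaves  *)
(* a single pair of homs for the identity to factor through, and these are     *)
(* inverse isomorphisms.                                                       *)
From Pilot Require Import Defs.
From HB Require Import structures.
Set Warnings "-notation-overridden,-ambiguous-paths".
From mathcomp Require Import all_boot all_order all_algebra.
From mathcomp Require Import boolp zify ring.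
(* [hom] is shadowed by the vector library. *)
Import Pilot.Defs.

Set Implicit Arguments.
Unset Strict Implicit.
Unset Printing Implicit Defensive.

Import Order.TTheory GRing.Theory Num.Theory.
Local Open Scope ring_scope.
Local Open Scope hom_scope.

(** * Crossings and dots on a word *)

(** Over a field a count of graded dimensions would do. Over Z, two facts replace it: every object
    is a retract of a sum of objects of B, and the homs between objects of B are triangular for the
    shifts, with Z on the diagonal.

    Retracts. A word is a retract of a sum of shifts of other words once its identity lies in the
    ideal [idl] of theirs. The degree three relation on E_i E_j E_i, together with the removal of
    products of dots in nilHecke algebras ([idl_reduce]), merges the outer blocks of i^a j^b i^c
    ([idl_three_blocks]); adding letters one by one, every word is reached from the words with b >=
    a + c ([idl_canon]). The identity of i^a factors through e_a ([idl_dividem]), so that the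
    identity of every object factors through objects of B ([kid_factors]).

    Homs. Pulling the strands to the left end one at a time ([homog_psum]) gives a lower bound for
    the degrees of homs between words, with a cyclic group in the degree of the bound
    ([lowdeg_same], [lowdeg_split]). As e_a is delta_a D_a, these bounds pass to divided powers.
    Because b >= a + c they leave, between distinct canonical labels, homs in one direction of the
    shift only ([khomB_canon]), and make every endomorphism of an object of B an integer
    ([khomB_endo]); the polynomial representation shows that there is no torsion ([hid_mulz_eq0]).

    Conclusion. Objects of B have no idempotents besides 0 and 1, and an endomorphism factoring
    through another canonical object is 0 ([khomB_orth]); this gives indecomposability and
    non-isomorphism. If the identity of X is the sum of the a_k b_k, the coefficients of the b_l a_m
    form idempotent integer matrices, and the Smith normal form splits off a summand as long as one
    of them is nonzero ([kdirect_sum_retract]). In the exceptional case b = a + c the degree bound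
    exceeds the admissible degree by (m - c)^2, so that the identity factors through one single
    object ([kiso_cross]). *)

Lemma hcompNl X Y Z (f : hom Y Z) (g : hom X Y) : (- f) ∘ g = - (f ∘ g).
Proof. by apply: (@addIr _ (f ∘ g)); rewrite -hcompDl !addNr hcomp0l. Qed.

Lemma hcompNr X Y Z (f : hom Y Z) (g : hom X Y) : f ∘ (- g) = - (f ∘ g).
Proof. by apply: (@addIr _ (f ∘ g)); rewrite -hcompDr !addNr hcomp0r. Qed.

Lemma hcompMn X Y Z (f : hom Y Z) (g : hom X Y) n :
  (f *+ n) ∘ g = (f ∘ g) *+ n.
Proof. by elim: n => [|n IH]; rewrite ?mulr0n ?hcomp0l // !mulrS hcompDl IH. Qed.

Lemma hcompMnr X Y Z (f : hom Y Z) (g : hom X Y) n :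
  f ∘ (g *+ n) = (f ∘ g) *+ n.
Proof. by elim: n => [|n IH]; rewrite ?mulr0n ?hcomp0r // !mulrS hcompDr IH. Qed.

Lemma hcompMzl X Y Z (f : hom Y Z) (g : hom X Y) (z : int) :
  (f *~ z) ∘ g = (f ∘ g) *~ z.
Proof. by case: z => n; rewrite /intmul ?hcompNl hcompMn. Qed.

Lemma hcompMzr X Y Z (f : hom Y Z) (g : hom X Y) (z : int) :
  f ∘ (g *~ z) = (f ∘ g) *~ z.
Proof. by case: z => n; rewrite /intmul ?hcompNr hcompMnr. Qed.

Definition crs i j Z : hom [:: i, j & Z] [:: j, i & Z] := hcross i j ⊗ 1_Z.

Lemma tens1M X Y Z W (f : hom Y Z) (g : hom X Y) :
  (f ⊗ 1_W) ∘ (g ⊗ 1_W) = (f ∘ g) ⊗ 1_W.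
Proof. by rewrite hinterchange hcomp1l. Qed.

Lemma tens1M2 i j k l m n Z (f : hom [:: k; l] [:: m; n])
    (g : hom [:: i; j] [:: k; l]) :
  (f ⊗ 1_Z : hom [:: k, l & Z] [:: m, n & Z])
    ∘ (g ⊗ 1_Z : hom [:: i, j & Z] [:: k, l & Z])
  = (f ∘ g) ⊗ 1_Z.
Proof. exact: (@tens1M [:: i; j] [:: k; l] [:: m; n] Z f g). Qed.

Lemma whiskN i X Y (f : hom X Y) : whisk i (- f) = - whisk i f.
Proof. by apply: (@addIr _ (whisk i f)); rewrite -whiskD !addNr whisk0. Qed.

Lemma crs_cons i j k Z :
  crs i j (k :: Z) = (hcross i j ⊗ 1_[:: k] : hom [:: i; j; k] _) ⊗ 1_Z.
Proof. exact: (htensA4 k Z (hcross i j)). Qed.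

Lemma whisk_crs k i j Z :
  whisk k (crs i j Z) = (1_[:: k] ⊗ hcross i j : hom [:: k; i; j] _) ⊗ 1_Z.
Proof. exact: (htensA3 k Z (hcross i j)). Qed.

Lemma dotl_cons i j Z :
  dotl i (j :: Z) = (hdot i ⊗ 1_[:: j] : hom [:: i; j] _) ⊗ 1_Z.
Proof.
rewrite -[RHS](htensA1 (hdot i) 1_[:: j] 1_Z).
exact: (congr1 (htens (hdot i)) (esym (whisk1 j Z))).
Qed.

Lemma whisk_dotl i j Z :
  whisk i (dotl j Z) = (1_[:: i] ⊗ hdot j : hom [:: i; j] _) ⊗ 1_Z.
Proof. exact: htensA1. Qed.

Lemma id2_tens i j Z : 1_[:: i, j & Z] = (1_[:: i; j] ⊗ 1_Z : hom [:: i, j & Z] _).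
Proof. by apply: esym; exact: (htens1 [:: i; j]). Qed.

Lemma id3_tens i j k Z :
  1_[:: i, j, k & Z] = (1_[:: i; j; k] ⊗ 1_Z : hom [:: i, j, k & Z] _).
Proof. by apply: esym; exact: (htens1 [:: i; j; k]). Qed.

Lemma crs_dotl i Z :
  crs i i Z ∘ dotl i (i :: Z) = whisk i (dotl i Z) ∘ crs i i Z + 1_[:: i, i & Z].
Proof. exact: crossl_dotl. Qed.

Lemma crs_crs i Z : crs i i Z ∘ crs i i Z = 0.
Proof. exact: crossl2. Qed.

Lemma dotl_crs i Z :
  dotl i (i :: Z) ∘ crs i i Z = crs i i Z ∘ whisk i (dotl i Z) + 1_[:: i, i & Z].
Proof.
rewrite dotl_cons whisk_dotl id2_tens.
etransitivity; first exact: tens1M2.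
etransitivity; last exact: (congr1 (fun f => f + _) (esym (tens1M2 _ _ _))).
etransitivity; last exact: (htensDl _ 1_[:: i; i] 1_Z).
apply: (congr1 (fun f : hom [:: i; i] [:: i; i] => f ⊗ 1_Z)).
have /hclsP := trel_nil2 i; rewrite !(hcls_comp, hclsDE, hclsNE, hcls0E) => /eqP.
rewrite subr_eq addrC => /eqP e.
rewrite -[hdot i ⊗ _]hcls_tens -[1_(_) ⊗ _]hcls_tens; exact: e.
Qed.

Lemma crs_crsN i j Z : i != j ->
  crs j i Z ∘ crs i j Z = dotl i (j :: Z) + whisk i (dotl j Z).
Proof.
move=> ij; rewrite dotl_cons whisk_dotl.
etransitivity; first exact: tens1M2.
etransitivity; last exact: (@htensDl [:: i; j] [:: i; j] _ _ _ _ 1_Z).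
apply: (congr1 (fun f : hom [:: i; j] [:: i; j] => f ⊗ 1_Z)).
have /hclsP := trel_crossij ij; rewrite !(hcls_comp, hclsDE, hclsNE, hcls0E) => e.
rewrite -[hdot i ⊗ _]hcls_tens -[1_(_) ⊗ _]hcls_tens; exact: e.
Qed.

Lemma dotl_crsN i j Z : i != j ->
  dotl j (i :: Z) ∘ crs i j Z = crs i j Z ∘ whisk i (dotl j Z).
Proof.
move=> ij; rewrite dotl_cons whisk_dotl.
etransitivity; first exact: tens1M2.
etransitivity; last exact: esym (tens1M2 _ _ _).
apply: (congr1 (fun f : hom [:: i; j] [:: j; i] => f ⊗ 1_Z)).
have /hclsP := trel_slidel ij; rewrite !(hcls_comp, hclsDE, hclsNE, hcls0E) => e.
rewrite -[hdot j ⊗ _]hcls_tens -[1_(_) ⊗ _]hcls_tens; exact: e.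
Qed.

Lemma crs_dotlN i j Z : i != j ->
  crs i j Z ∘ dotl i (j :: Z) = whisk j (dotl i Z) ∘ crs i j Z.
Proof.
move=> ij; rewrite dotl_cons whisk_dotl; apply: esym.
etransitivity; first exact: tens1M2.
etransitivity; last exact: esym (tens1M2 _ _ _).
apply: (congr1 (fun f : hom [:: i; j] [:: j; i] => f ⊗ 1_Z)).
have /hclsP := trel_slider ij; rewrite !(hcls_comp, hclsDE, hclsNE, hcls0E) => e.
rewrite -[hdot i ⊗ _]hcls_tens -[1_(_) ⊗ _]hcls_tens; exact: e.
Qed.

Lemma tens1M3 i j k i1 j1 k1 i2 j2 k2 i3 j3 k3 Z
    (f : hom [:: i2; j2; k2] [:: i3; j3; k3])
    (g : hom [:: i1; j1; k1] [:: i2; j2; k2])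
    (h : hom [:: i; j; k] [:: i1; j1; k1]) :
  (f ⊗ 1_Z : hom [:: i2, j2, k2 & Z] [:: i3, j3, k3 & Z])
    ∘ (g ⊗ 1_Z : hom [:: i1, j1, k1 & Z] [:: i2, j2, k2 & Z])
    ∘ (h ⊗ 1_Z : hom [:: i, j, k & Z] [:: i1, j1, k1 & Z])
  = (f ∘ g ∘ h) ⊗ 1_Z.
Proof.
rewrite -(@tens1M [:: i; j; k] [:: i1; j1; k1] [:: i3; j3; k3] Z (f ∘ g) h).
rewrite -(@tens1M [:: i1; j1; k1] [:: i2; j2; k2] [:: i3; j3; k3] Z f g).
by [].
Qed.

Lemma crs_braid i j k Z : ~~ ((i == k) && (k != j)) ->
  crs j k (i :: Z) ∘ whisk j (crs i k Z) ∘ crs i j (k :: Z)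
  = whisk k (crs i j Z) ∘ crs i k (j :: Z) ∘ whisk i (crs j k Z).
Proof.
move=> ijk; rewrite !whisk_crs !crs_cons.
etransitivity; first exact: tens1M3.
etransitivity; last exact: esym (tens1M3 _ _ _ _).
apply: (congr1 (fun f : hom [:: i; j; k] [:: k; j; i] => f ⊗ 1_Z)).
have /hclsP := trel_braid ijk.
rewrite !(hcls_comp, hclsDE, hclsNE, hcls0E) => /eqP; rewrite subr_eq0 => /eqP e.
rewrite -[hcross j k ⊗ _]hcls_tens -[hcross i j ⊗ _]hcls_tens.
rewrite -[hcross i k ⊗ _]hcls_tens -[1_[:: j] ⊗ _]hcls_tens.
by rewrite -[1_[:: k] ⊗ _]hcls_tens -[1_[:: i] ⊗ _]hcls_tens; exact: e.
Qed.

Lemma crs_braid1 i j Z : i != j ->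
  crs j i (i :: Z) ∘ whisk j (crs i i Z) ∘ crs i j (i :: Z)
  = whisk i (crs i j Z) ∘ crs i i (j :: Z) ∘ whisk i (crs j i Z)
    + 1_[:: i, j, i & Z].
Proof.
move=> ij; rewrite !whisk_crs !crs_cons id3_tens.
etransitivity; first exact: tens1M3.
etransitivity; last exact: (congr1 (fun f => f + _) (esym (tens1M3 _ _ _ _))).
etransitivity; last exact: (htensDl _ 1_[:: i; j; i] 1_Z).
apply: (congr1 (fun f : hom [:: i; j; i] [:: i; j; i] => f ⊗ 1_Z)).
have /hclsP := trel_braid1 ij.
rewrite !(hcls_comp, hclsDE, hclsNE, hcls0E) => /eqP.
rewrite subr_eq addrC => /eqP e.
rewrite -[hcross j i ⊗ _]hcls_tens -[hcross i j ⊗ _]hcls_tens.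
rewrite -[hcross i i ⊗ _]hcls_tens -[1_[:: j] ⊗ _]hcls_tens.
by rewrite -[1_[:: i] ⊗ hcross i j]hcls_tens -[1_[:: i] ⊗ _]hcls_tens; exact: e.
Qed.

Lemma crs_far i j Z W (f : hom Z W) :
  crs i j W ∘ whisk i (whisk j f) = whisk j (whisk i f) ∘ crs i j Z.
Proof.
have -> : whisk i (whisk j f) = 1_[:: i; j] ⊗ f by exact: htensA2.
have -> : whisk j (whisk i f) = 1_[:: j; i] ⊗ f by exact: htensA2.
etransitivity; first exact: (hinterchange (hcross i j) 1_[:: i; j] 1_W f).
etransitivity; last exact: esym (hinterchange 1_[:: j; i] (hcross i j) f 1_Z).
by rewrite !hcomp1l !hcomp1r.
Qed.

Lemma homog_whisk i X Y d (f : hom X Y) : homog d f -> homog d (whisk i f).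
Proof. by move=> fd; apply: homog_eq (homog_tens (homog_id [:: i]) fd); rewrite add0r. Qed.

Lemma homog_dotl i Z : homog 2 (dotl i Z).
Proof. by apply: homog_eq (homog_tens (homog_dot i) (homog_id Z)); rewrite addr0. Qed.

Lemma homog_crs i j Z : homog (- cartan i j) (crs i j Z).
Proof.
by apply: homog_eq (homog_tens (homog_cross i j) (homog_id Z)); rewrite addr0.
Qed.

Lemma homog_dotpowl i q Z : homog (q%:Z *+ 2) (dotpowl i q Z).
Proof. by apply: homog_eq (homog_tens (dotpow_homog i q) (homog_id Z)); rewrite addr0. Qed.

(** * Homogeneous ideals *)

Definition eset := forall Y : word, int -> hom Y Y -> Prop.

(* [idl S d f]: f lies in the degree d part of the two-sided ideal generated  *)
(* by the homogeneous endomorphisms in S.                                     *)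
Inductive idl (S : eset) : forall X Z, int -> hom X Z -> Prop :=
| idl_0 X Z d : idl S d (0 : hom X Z)
| idl_add X Z d (f g : hom X Z) : idl S d f -> idl S d g -> idl S d (f + g)
| idl_gen X Y Z d1 d d2 (g : hom Y Z) (e : hom Y Y) (h : hom X Y) :
    S Y d e -> homog d1 g -> homog d2 h -> idl S (d1 + d + d2) (g ∘ e ∘ h).

Lemma idl_eq S X Z d d' (f : hom X Z) : d = d' -> idl S d f -> idl S d' f.
Proof. by move=> <-. Qed.

Lemma idl_compl S X Y Z d d' (g : hom Y Z) (f : hom X Y) :
  homog d g -> idl S d' f -> idl S (d + d') (g ∘ f).
Proof.
move=> gd fi; elim: fi Z g gd => {X Y d' f}
  [X Y d'|X Y d' f f' _ IH _ IH'|X Y Y' d1 d' d2 h e k Se hd kd] Z g gd.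
- by rewrite hcomp0r; apply: idl_0.
- by rewrite hcompDr; apply: idl_add; [apply: IH|apply: IH'].
rewrite !hcompA; apply: idl_eq (idl_gen Se (homog_comp gd hd) kd).
by rewrite !addrA.
Qed.

Lemma idl_compr S X Y Z d d' (f : hom Y Z) (g : hom X Y) :
  idl S d f -> homog d' g -> idl S (d + d') (f ∘ g).
Proof.
move=> fi; elim: fi X g d' => {Y Z d f}
  [Y Z d|Y Z d f f' _ IH _ IH'|Y Y' Z d1 d d2 h e k Se hd kd] X g d' gd.
- by rewrite hcomp0l; apply: idl_0.
- by rewrite hcompDl; apply: idl_add; [apply: IH|apply: IH'].
rewrite -!hcompA (hcompA h); apply: idl_eq (idl_gen Se hd (homog_comp kd gd)).
by rewrite !addrA.
Qed.

Lemma idl_opp S X Z d (f : hom X Z) : idl S d f -> idl S d (- f).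
Proof.
move=> fi; have := idl_compl (homog_opp (homog_id Z)) fi.
by rewrite hcompNl hcomp1l add0r.
Qed.

Lemma idl_sub S X Z d (f g : hom X Z) : idl S d f -> idl S d g -> idl S d (f - g).
Proof. by move=> fi gi; apply: idl_add (idl_opp gi). Qed.

Lemma idl_mem (S : eset) Y d e : S Y d e -> idl S d e.
Proof.
move=> Se; have := idl_gen Se (homog_id Y) (homog_id Y).
by rewrite hcomp1l hcomp1r add0r addr0.
Qed.

Lemma idl_trans (S S' : eset) X Z d (f : hom X Z) :
  idl S d f -> (forall Y d e, S Y d e -> idl S' d e) -> idl S' d f.
Proof.
move=> fi SS'; elim: fi => {X Z d f}
  [X Z d|X Z d f f' _ IH _ IH'|X Y Z d1 d d2 h e k Se hd kd].
- exact: idl_0.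
- exact: idl_add.
by apply: idl_compr => //; apply: idl_compl => //; apply: SS'.
Qed.

Lemma idl_whisk (S S' : eset) i X Z d (f : hom X Z) :
  idl S d f -> (forall Y d e, S Y d e -> idl S' d (whisk i e)) ->
  idl S' d (whisk i f).
Proof.
move=> fi SS'; elim: fi => {X Z d f}
  [X Z d|X Z d f f' _ IH _ IH'|X Y Z d1 d d2 h e k Se hd kd].
- by rewrite whisk0; apply: idl_0.
- by rewrite whiskD; apply: idl_add.
rewrite !whiskM; apply: idl_compr; last exact: homog_whisk.
by apply: idl_compl; [apply: homog_whisk|apply: SS'].
Qed.

Inductive sone Y0 d0 (e0 : hom Y0 Y0) : eset :=
  SOne : sone d0 e0 d0 e0.

(** That 1_X lies in this ideal in degree 0 is the ideal-theoretic form of: X is a retract of a sum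
    of shifts of words satisfying [W]. *)
Inductive swords (W : word -> Prop) : eset :=
  SWord Y : W Y -> swords W 0 1_Y.

Lemma idl_via (W : word -> Prop) X Y Z d d' (g : hom Y Z) (h : hom X Y) :
  W Y -> homog d g -> homog d' h -> idl (swords W) (d + d') (g ∘ h).
Proof.
by move=> WY gd hd; have := idl_gen (SWord WY) gd hd; rewrite hcomp1r addr0.
Qed.

Lemma idl1_whisk (W W' : word -> Prop) i X :
  idl (swords W) 0 1_X -> (forall Y, W Y -> idl (swords W') 0 1_(i :: Y)) ->
  idl (swords W') 0 1_(i :: X).
Proof.
move=> XW WW'; rewrite -whisk1; apply: idl_whisk XW _ => Y d e [Y' WY'].
by rewrite whisk1; apply: WW'.
Qed.

Lemma idl1_trans (W W' : word -> Prop) X :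
  idl (swords W) 0 1_X -> (forall Y, W Y -> idl (swords W') 0 1_Y) ->
  idl (swords W') 0 1_X.
Proof. by move=> XW WW'; apply: idl_trans XW _ => Y d e [Y' WY']; apply: WW'. Qed.

Lemma idl1_mem (W : word -> Prop) X : W X -> idl (swords W) 0 1_X.
Proof. by move=> WX; apply: idl_mem; constructor. Qed.

(** * Moving a strand around a block, and the products of dots that result *)

Fixpoint wh i a X Y (f : hom X Y) : hom (nseq a i ++ X) (nseq a i ++ Y) :=
  match a with 0 => f | a'.+1 => whisk i (wh i a' f) end.

Lemma whS i a X Y (f : hom X Y) : wh i a.+1 f = whisk i (wh i a f).
Proof. by []. Qed.

Lemma whM i a X Y Z (f : hom Y Z) (g : hom X Y) :
  wh i a (f ∘ g) = wh i a f ∘ wh i a g.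
Proof. by elim: a => [|a IH] //; rewrite !whS IH whiskM. Qed.

Lemma whD i a X Y (f g : hom X Y) : wh i a (f + g) = wh i a f + wh i a g.
Proof. by elim: a => [|a IH] //; rewrite !whS IH whiskD. Qed.

Lemma whN i a X Y (f : hom X Y) : wh i a (- f) = - wh i a f.
Proof. by elim: a => [|a IH] //; rewrite !whS IH whiskN. Qed.

Lemma wh0 i a X Y : wh i a (0 : hom X Y) = 0.
Proof. by elim: a => [|a IH] //; rewrite whS IH whisk0. Qed.

Lemma wh1 i a X : wh i a 1_X = 1_(nseq a i ++ X).
Proof. by elim: a => [|a IH] //; rewrite !whS IH whisk1. Qed.

Lemma homog_wh i a X Y d (f : hom X Y) : homog d f -> homog d (wh i a f).
Proof. by move=> fd; elim: a => [|a IH] //; rewrite whS; apply: homog_whisk. Qed.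

Lemma idl_wh (S S' : eset) i a X Z d (f : hom X Z) :
  idl S d f -> (forall Y d e, S Y d e -> idl S' d (wh i a e)) ->
  idl S' d (wh i a f).
Proof.
move=> fi SS'; elim: fi => {X Z d f}
  [X Z d|X Z d f f' _ IH _ IH'|X Y Z d1 d d2 h e k Se hd kd].
- by rewrite wh0; apply: idl_0.
- by rewrite whD; apply: idl_add.
rewrite !whM; apply: idl_compr; last exact: homog_wh.
by apply: idl_compl; [apply: homog_wh|apply: SS'].
Qed.

(* The product of (x_k + t) over the first a strands. *)
Fixpoint dotprod i a Z (t : hom Z Z) : hom (nseq a i ++ Z) (nseq a i ++ Z) :=
  match a with
  | 0 => 1_Z
  | a'.+1 => dotl i (nseq a' i ++ Z) ∘ whisk i (dotprod i a' t)
             + whisk i (dotprod i a' t ∘ wh i a' t)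
  end.

Lemma dotprodS i a Z (t : hom Z Z) :
  dotprod i a.+1 t = dotl i (nseq a i ++ Z) ∘ whisk i (dotprod i a t)
                     + whisk i (dotprod i a t ∘ wh i a t).
Proof. by []. Qed.

Lemma wh_dotprod i a Z Z' (t : hom Z Z) (t' : hom Z' Z') (f : hom Z Z') :
  f ∘ t = t' ∘ f -> wh i a f ∘ dotprod i a t = dotprod i a t' ∘ wh i a f.
Proof.
move=> ft; elim: a => [|a IH]; first by rewrite /= hcomp1l hcomp1r.
rewrite !dotprodS whS hcompDl hcompDr !hcompA -dotl_far -!hcompA -!whiskM.
by rewrite hcompA IH -!hcompA -!whM ft.
Qed.

Lemma homog_dotprod i a Z (t : hom Z Z) :
  homog 2 t -> homog (a%:Z *+ 2) (dotprod i a t).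
Proof.
move=> t2; elim: a => [|a IH]; first exact: homog_id.
rewrite dotprodS; apply: homog_add.
  by apply: homog_eq (homog_comp (homog_dotl _ _) (homog_whisk _ IH)); lia.
apply: homog_eq (homog_whisk _ (homog_comp IH (homog_wh i a t2))); lia.
Qed.

(* Moving one strand j to the left, resp. back to the right, across i^a. *)
Fixpoint upn i j a V : hom (nseq a i ++ j :: V) (j :: nseq a i ++ V) :=
  match a with
  | 0 => 1_(j :: V)
  | a'.+1 => crs i j (nseq a' i ++ V) ∘ whisk i (upn i j a' V)
  end.

Fixpoint dnn i j a V : hom (j :: nseq a i ++ V) (nseq a i ++ j :: V) :=
  match a with
  | 0 => 1_(j :: V)
  | a'.+1 => whisk i (dnn i j a' V) ∘ crs j i (nseq a' i ++ V)
  end.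

Lemma dotl_upn i j a V : i != j ->
  dotl j (nseq a i ++ V) ∘ upn i j a V = upn i j a V ∘ wh i a (dotl j V).
Proof.
move=> ij; elim: a => [|a IH]; first by rewrite /= hcomp1l hcomp1r.
rewrite [upn _ _ _ _]/= whS hcompA (dotl_crsN _ ij) -!hcompA -!whiskM.
by rewrite IH.
Qed.

(** The strand j meets each strand of the block twice, and each double crossing becomes the sum of
    the two dots. *)
Lemma dnn_upn i j a V : i != j ->
  dnn i j a V ∘ upn i j a V = dotprod i a (dotl j V).
Proof.
move=> ij; elim: a => [|a IH]; first by rewrite /= hcomp1l.
rewrite dotprodS [dnn _ _ _ _]/= [upn _ _ _ _]/=.
rewrite -hcompA (hcompA (crs j i _)) (crs_crsN _ ij) hcompDl hcompDr.
rewrite hcompA -dotl_far -hcompA -!whiskM IH; congr (_ + whisk i _).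
by rewrite dotl_upn // hcompA IH.
Qed.

Lemma cartanN i j : i != j -> - cartan i j = 1.
Proof. by rewrite /cartan => /negbTE ->; rewrite opprK. Qed.

Lemma homog_crsN i j Z : i != j -> homog 1 (crs i j Z).
Proof. by move=> /cartanN <-; apply: homog_crs. Qed.

Lemma homog_crsii i Z : homog (- 2%:Z) (crs i i Z).
Proof. by have := homog_crs i i Z; rewrite /cartan eqxx. Qed.

Lemma homog_upn i j a V : i != j -> homog a%:Z (upn i j a V).
Proof.
move=> ij; elim: a => [|a IH]; first exact: homog_id.
by apply: homog_eq (homog_comp (homog_crsN _ ij) (homog_whisk _ IH)); lia.
Qed.

Lemma homog_dnn i j a V : i != j -> homog a%:Z (dnn i j a V).
Proof.
rewrite eq_sym => ij; elim: a => [|a IH]; first exact: homog_id.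
by apply: homog_eq (homog_comp (homog_whisk _ IH) (homog_crsN _ ij)); lia.
Qed.

(** * Ideals of nilHecke algebras *)

(* With H = (y + T) G and y = x_2: sHs = - sG, whence G = (x_1 + T) sG - sH.  *)
Lemma idl_dotprod_right j b i V :
  idl (sone (b%:Z *+ 2) (whisk j (dotprod j b (dotl i V)))) 0
      1_(j :: nseq b j ++ i :: V).
Proof.
elim: b => [|b IH].
  by apply: idl_mem; rewrite [dotprod _ _ _]/= whisk1; constructor.
set S := sone _ _.
have : idl (sone (b%:Z *+ 2) (whisk j (whisk j (dotprod j b (dotl i V)))))
           0 1_[:: j, j & nseq b j ++ i :: V].
  rewrite -whisk1; apply: (idl_whisk IH) => Y d e [].
  by apply: idl_mem; constructor.
move/idl_trans; apply=> Y d e [] {Y d e}.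
set G := whisk j (whisk j _).
pose T := whisk j (whisk j (wh j b (dotl i V))).
pose s := crs j j (nseq b j ++ i :: V).
pose x := dotl j (j :: nseq b j ++ i :: V).
pose y := whisk j (dotl j (nseq b j ++ i :: V)).
have GT : G ∘ T = T ∘ G.
  rewrite /G /T -!whiskM; congr (whisk j (whisk j _)).
  exact: esym (@wh_dotprod j b _ _ (dotl i V) (dotl i V) (dotl i V) erefl).
have sG : s ∘ G = G ∘ s by rewrite /s /G crs_far.
have sT : s ∘ T = T ∘ s by rewrite /s /T crs_far.
have sx : s ∘ x = y ∘ s + 1_[:: j, j & nseq b j ++ i :: V] by exact: crs_dotl.
have xs : x ∘ s = s ∘ y + 1_[:: j, j & nseq b j ++ i :: V] by exact: dotl_crs.
have ss : s ∘ s = 0 by exact: crs_crs.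
have s2 : homog (- 2%:Z) s by exact: homog_crsii.
have x2 : homog 2 x by exact: homog_dotl.
have T2 : homog 2 T by do 2 apply: homog_whisk; apply/homog_wh/homog_dotl.
pose H := y ∘ G + T ∘ G.
have HS : idl S ((b.+1)%:Z *+ 2) H.
  have -> : H = whisk j (dotprod j b.+1 (dotl i V)).
    by rewrite /H -GT dotprodS whiskD !whiskM.
  by apply: idl_mem; constructor.
(* From s y = x s - 1, s^2 = 0 and the fact that s commutes with G and T. *)
have sGE : s ∘ G = - (s ∘ H ∘ s).
  have z : T ∘ s ∘ G ∘ s = 0.
    by rewrite -(hcompA T) sG -hcompA -(hcompA G) ss !hcomp0r.
  rewrite /H hcompDr hcompDl !hcompA sT z addr0.
  rewrite -[s ∘ y](addrK 1_[:: j, j & nseq b j ++ i :: V]) -xs.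
  rewrite -hcompA -sG hcompDl hcompA -(hcompA x) ss hcomp0r hcomp0l add0r.
  by rewrite hcompNl hcomp1l opprK.
have GE : G = (x + T) ∘ (s ∘ G) - s ∘ H.
  rewrite /H hcompDl hcompDr !hcompA sT xs [X in X + _ - _]hcompDl hcomp1l.
  by rewrite (addrC (s ∘ y ∘ G)) -(addrA G) addrK.
have sGS : idl S (b%:Z *+ 2 - 2) (s ∘ G).
  rewrite sGE; apply: idl_opp.
  by apply: idl_eq (idl_compr (idl_compl s2 HS) s2); lia.
rewrite GE; apply: idl_sub.
  by apply: idl_eq (idl_compl (homog_add x2 T2) sGS); lia.
by apply: idl_eq (idl_compl s2 HS); lia.
Qed.

(** Both t and g act to the right of a + 1 strands i. Crossings and dots on these strands belong to
    the commutant, and they are all that the nilHecke argument multiplies by, apart from t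
    itself. *)
Definition commutant i a Z (t g : hom Z Z)
    (k : hom (nseq a i ++ i :: Z) (nseq a i ++ i :: Z)) : Prop :=
  k ∘ wh i a (whisk i t) = wh i a (whisk i t) ∘ k /\
  k ∘ wh i a (whisk i g) = wh i a (whisk i g) ∘ k.

Lemma commutant_whisk i a Z (t g : hom Z Z) k :
  @commutant i a Z t g k -> @commutant i a.+1 Z t g (whisk i k).
Proof. by move=> [kt kg]; split; rewrite whS -!whiskM ?kt ?kg. Qed.

(** The witnesses are the crossing of the two leftmost strands and the dot on the second one. For a
    = 0 the second strand is the extra i to the right of the counted block, whence the two cases. *)
Lemma commutant_head i a Z (t g : hom Z Z) :
  exists s y : hom (nseq a.+1 i ++ i :: Z) (nseq a.+1 i ++ i :: Z),
  [/\ homog (- 2%:Z) s, homog 2 y, @commutant i a.+1 Z t g s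
    & @commutant i a.+1 Z t g y /\ s ∘ s = 0 /\
      s ∘ dotl i (nseq a i ++ i :: Z)
      = y ∘ s + 1_(nseq a.+1 i ++ i :: Z)].
Proof.
case: a => [|a].
  exists (crs i i Z), (whisk i (dotl i Z)); split.
  - exact: homog_crsii.
  - exact/homog_whisk/homog_dotl.
  - by split; exact: crs_far.
  split; last by split; [exact: crs_crs|exact: crs_dotl].
  by split; rewrite [wh _ _ _]/= -!whiskM dotl_far.
exists (crs i i (nseq a i ++ i :: Z)), (whisk i (dotl i (nseq a i ++ i :: Z))).
split.
- exact: homog_crsii.
- exact/homog_whisk/homog_dotl.
- by split; exact: crs_far.
split; last by split; [exact: crs_crs|exact: crs_dotl].
by split; rewrite !whS -!whiskM dotl_far.
Qed.

(* The induction peels the leftmost strand, whose factor x_0 + t is not       *)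
(* removed first: it is absorbed into J, which is therefore only assumed      *)
(* stable under the commutant.                                                *)
Lemma dotprod_left i a Z (t g : hom Z Z)
    (J : int -> hom (nseq a i ++ i :: Z) (nseq a i ++ i :: Z) -> Prop) d :
  homog 2 t -> g ∘ t = t ∘ g ->
  (forall e f f', J e f -> J e f' -> J e (f + f')) ->
  (forall e e' f k, commutant t g k -> homog e' k -> J e f -> J (e' + e) (k ∘ f)) ->
  (forall e e' f k, commutant t g k -> homog e' k -> J e f -> J (e + e') (f ∘ k)) ->
  J d (dotprod i a (whisk i t) ∘ wh i a (whisk i g)) ->
  J (d - a%:Z *+ 2) (wh i a (whisk i g)).
Proof.
move=> t2 gt; elim: a J d => [|a IH] J d JD Jl Jr.
  rewrite [dotprod _ _ _]/= hcomp1l => H.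
  by have -> : d - 0%:Z *+ 2 = d by lia.
set W := nseq a i ++ i :: Z.
pose T := wh i a (whisk i t); pose G := wh i a (whisk i g).
have TG : T ∘ G = G ∘ T by rewrite /T /G -!whM -!whiskM gt.
rewrite dotprodS !whS -/T -/G -/W => JH.
have T2 : homog 2 (whisk i T) by exact/homog_whisk/homog_wh/homog_whisk.
have kT : @commutant i a.+1 Z t g (whisk i T).
  by split; rewrite whS -!whiskM // -/T -/G TG.
(* [J'] is [J] with the factor of the leftmost strand absorbed. It is stable under right
   multiplication by k because k commutes with T. *)
pose J' e f := J (e + 2) (dotl i W ∘ whisk i f + whisk i f ∘ whisk i T).
have {}IH : J' (d - 2 - a%:Z *+ 2) G.
  apply: (IH J').
  - move=> e f f'; rewrite /J' => Jf Jf'.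
    by rewrite whiskD hcompDl hcompDr addrACA; apply: JD.
  - move=> e e' f k kK ke Jf; rewrite /J' -addrA whiskM hcompA dotl_far -!hcompA.
    by rewrite -hcompDr; apply: Jl => //; [exact: commutant_whisk|exact: homog_whisk].
  - move=> e e' f k kK ke Jf; rewrite /J' whiskM -(hcompA _ _ (whisk i T)).
    have [kt _] := kK.
    rewrite -(whiskM i k T) kt whiskM !hcompA -hcompDl addrAC.
    by apply: Jr => //; [exact: commutant_whisk|exact: homog_whisk].
  rewrite /J' subrK; move: JH; rewrite hcompDl !whiskM -!hcompA -!(whiskM i).
  by rewrite TG.
move: IH; rewrite /J' -/W.
have [s [y [s2 y2 sK [yK [ss sx]]]]] := commutant_head i a t g.
pose x := dotl i W; pose H := x ∘ whisk i G + whisk i G ∘ whisk i T.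
rewrite -/x -/H => {}JH.
have sG : s ∘ whisk i G = whisk i G ∘ s by have [_] := sK; rewrite whS.
have sT : s ∘ whisk i T = whisk i T ∘ s by have [+ _] := sK; rewrite whS.
have sH : s ∘ H = y ∘ (whisk i G ∘ s) + whisk i G + whisk i G ∘ s ∘ whisk i T.
  have e : y ∘ (whisk i G ∘ s) = y ∘ s ∘ whisk i G by rewrite -sG hcompA.
  by rewrite e /H hcompDr !hcompA sx hcompDl hcomp1l !sG.
have sHs : s ∘ H ∘ s = whisk i G ∘ s.
  rewrite sH !hcompDl -!hcompA ss !hcomp0r add0r -sT.
  by rewrite (hcompA s) ss hcomp0l hcomp0r addr0.
(* [sH] expresses s H by G and G s, and G s is s H s; solving for G uses only multiplications by
   elements of the commutant. *)
have GE : whisk i G = s ∘ H + ((- y) ∘ (s ∘ H ∘ s) + (s ∘ H ∘ s) ∘ (- whisk i T)).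
  by rewrite sHs sH hcompNl hcompNr [y ∘ _ + _]addrC -opprD -(addrA (whisk i G)) addrK.
have kN k : @commutant i a.+1 Z t g k -> commutant t g (- k).
  by move=> [k1 k2]; split; rewrite hcompNl hcompNr ?k1 ?k2.
have J1 : J (d - a.+1%:Z *+ 2) (s ∘ H).
  have := Jl _ _ _ _ sK s2 JH.
  by rewrite (_ : - 2%:Z + _ = d - a.+1%:Z *+ 2) //; lia.
have J2 : J (d - a.+1%:Z *+ 2 - 2) (s ∘ H ∘ s) by exact: Jr.
rewrite GE; apply: (JD) => //; apply: (JD).
  have := Jl _ _ _ _ (kN _ yK) (homog_opp y2) J2.
  by rewrite addrC subrK.
have := Jr _ _ _ _ (kN _ kT) (homog_opp T2) J2.
by rewrite subrK.
Qed.

(* On i^a (iji) j^b V the relation of degree three is 1 = A - B. B factors    *)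
(* through the first word; A, multiplied by the product P of the x_k + y over *)
(* the first a strands, factors through the second one, since P is what the   *)
(* strand j picks up on its way around i^a. Hence P times the similar product *)
(* for i around j^b lies in the ideal, and the nilHecke algebras remove both  *)
(* products.                                                                  *)
Lemma idl_reduce i j a b V (W : word -> Prop) : i != j ->
  W (nseq a i ++ [:: i, i, j & nseq b j ++ V]) ->
  W (j :: nseq a i ++ [:: i, i & nseq b j ++ V]) ->
  idl (swords W) 0 1_(nseq a i ++ [:: i, j & nseq b j ++ i :: V]).
Proof.
move=> ij W1 W2; have ji : j != i by rewrite eq_sym.
set S := swords W; set Y := nseq b j ++ V.
have SQ : idl S (a%:Z *+ 2) (dotprod i a (dotl j [:: i, i & Y])).
  rewrite -dnn_upn //.
  by apply: idl_eq (idl_via W2 (homog_dnn _ _ ij) (homog_upn _ _ ij)); lia.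
pose t : hom [:: i, j, i & Y] [:: i, j, i & Y] := whisk i (dotl j (i :: Y)).
have SP : idl S (a%:Z *+ 2) (dotprod i a t).
  pose A := crs j i (i :: Y) ∘ whisk j (crs i i Y) ∘ crs i j (i :: Y).
  pose B := whisk i (crs i j Y) ∘ crs i i (j :: Y) ∘ whisk i (crs j i Y).
  have AB : 1_[:: i, j, i & Y] = A - B.
    by rewrite /A (crs_braid1 _ ij) -/B addrC addrA addNr add0r.
  have t2 : homog 2 t by exact/homog_whisk/homog_dotl.
  have E : dotprod i a t = wh i a A ∘ dotprod i a t - wh i a B ∘ dotprod i a t.
    by rewrite -hcompNl -hcompDl -[LHS]hcomp1l -wh1 AB whD whN.
  rewrite E; apply: idl_sub.
    rewrite /A whM -hcompA (@wh_dotprod i a _ _ t (dotl j [:: i, i & Y])); last first.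
      by rewrite -(dotl_crsN _ ij).
    rewrite hcompA; apply: idl_eq (idl_compr (idl_compl _ SQ) _).
    - shelve.
    - apply: homog_wh; apply: homog_comp; first exact: homog_crsN.
      by apply: homog_whisk; exact: homog_crsii.
    - by apply: homog_wh; exact: homog_crsN.
  have : idl S 0 (wh i a B).
    rewrite /B -hcompA whM; apply: idl_eq (idl_via W1 _ _).
    - shelve.
    - by apply/homog_wh/homog_whisk/homog_crsN.
    - apply/homog_wh/homog_comp; first exact: homog_crsii.
      by apply: homog_whisk; exact: homog_crsN.
  by move=> BS; apply: idl_eq (idl_compr BS (homog_dotprod i a t2)); rewrite add0r.
pose Z := j :: nseq b j ++ i :: V.
pose g : hom Z Z := whisk j (dotprod j b (dotl i V)).
have gt : g ∘ dotl j (nseq b j ++ i :: V) = dotl j (nseq b j ++ i :: V) ∘ g.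
  by rewrite /g dotl_far.
have SH : idl S (a%:Z *+ 2 + b%:Z *+ 2)
    (dotprod i a (whisk i (dotl j (nseq b j ++ i :: V))) ∘ wh i a (whisk i g)).
  rewrite /g -dnn_upn // whiskM whiskM whM hcompA.
  rewrite -(@wh_dotprod i a _ _ t); last by rewrite /t -!whiskM dotl_far.
  apply: idl_eq (idl_compr (idl_compl _ SP) _); first shelve.
    by apply/homog_wh/homog_whisk/homog_whisk/homog_dnn.
  by apply/homog_wh/homog_whisk/homog_whisk/homog_upn.
have SG : idl S (b%:Z *+ 2) (wh i a (whisk i g)).
  have := @dotprod_left i a Z (dotl j _) g (fun d f => idl S d f) _ (homog_dotl _ _) gt.
  move=> /(_ (a%:Z *+ 2 + b%:Z *+ 2)).
  rewrite [X in X - _]addrC addrK; apply=> //.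
  - by move=> *; apply: idl_add.
  - by move=> *; apply: idl_compl.
  - by move=> *; apply: idl_compr.
rewrite -[1_(_)](wh1 i a [:: i, j & _]) -whisk1.
apply: (@idl_wh (sone (b%:Z *+ 2) (whisk i g))).
  apply: idl_whisk (idl_dotprod_right j b i V) _ => Y' d e [].
  by apply: idl_mem; constructor.
by move=> Y' d e [].
Unshelve.
all: lia.
Qed.

Lemma nseq_cons_cat (T : Type) a (x : T) s : nseq a x ++ x :: s = x :: nseq a x ++ s.
Proof. by elim: a => //= a ->. Qed.

(** Each use of [idl_reduce] moves one i from the last block to the first, possibly sending one j to
    the far left as well; hence an induction on the length of the last block. *)
Lemma idl_three_blocks i j a b c V : i != j ->
  idl (swords (fun Y => exists m n, (m + n = b)%N /\
         Y = nseq m j ++ nseq (a + c) i ++ nseq n j ++ V))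
      0 1_(nseq a i ++ nseq b j ++ nseq c i ++ V).
Proof.
move=> ij; elim: c a b => [|c IH] a b.
  by rewrite addn0; apply: idl1_mem; exists 0%N, b.
case: b => [|b].
  by apply: idl1_mem; exists 0%N, 0%N; rewrite (nseqD a c.+1) -catA.
case: a => [|a].
  by apply: idl1_mem; exists b.+1, 0%N; rewrite addn0.
have -> : nseq a.+1 i ++ nseq b.+1 j ++ nseq c.+1 i ++ V
        = nseq a i ++ [:: i, j & nseq b j ++ i :: nseq c i ++ V].
  by rewrite nseq_cons_cat.
pose W Y := Y = nseq a.+2 i ++ nseq b.+1 j ++ nseq c i ++ V \/
            Y = j :: nseq a.+2 i ++ nseq b j ++ nseq c i ++ V.
apply: (@idl1_trans W).
  apply: (idl_reduce ij); rewrite !nseq_cons_cat; [by left|by right].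
move=> Y [->|->].
  apply: idl1_trans (IH _ _) _ => Y' [m [n [mn ->]]].
  by apply: idl1_mem; exists m, n; split => //; rewrite addnS !addSn.
apply: (idl1_whisk (IH _ _)) => Y' [m [n [mn ->]]].
by apply: idl1_mem; exists m.+1, n; rewrite addSn mn; split => //; rewrite addnS !addSn.
Qed.

Definition bword i a b c : word := nseq a i ++ nseq b (~~ i) ++ nseq c i.

(* For b = a + c the objects of the two families are isomorphic in pairs;     *)
(* those of the first family are kept.                                        *)
Definition canonical i a b c : bool := if i then (a + c <= b)%N else (a + c < b)%N.

Definition canon_word (Y : word) : Prop :=
  exists i a b c, canonical i a b c /\ Y = bword i a b c.

(** A new letter i lengthens the first block of i^a j^b i^c; if the inequality breaks,
    [idl_three_blocks] yields words j^m i^(a+1+c) j^n with m + n = b, canonical for the other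
    family. A new letter j is merged into j^b, giving i^m j^(b+1) i^(n+c) with m + n = a. *)
Lemma idl_canon X : idl (swords canon_word) 0 1_X.
Proof.
elim: X => [|l X IH]; first by apply: idl1_mem; exists true, 0%N, 0%N, 0%N.
apply: (idl1_whisk IH) => Y [i [a [b [c [iabc ->]]]]]; rewrite /bword.
have [-> | li] := eqVneq l i.
  have [abc|abc] := boolP (canonical i a.+1 b c).
    by apply: idl1_mem; exists i, a.+1, b, c.
  have ii : i != ~~ i by case: (i).
  have := idl_three_blocks a.+1 b c [::] ii; rewrite cats0.
  move/idl1_trans; apply=> Y' [m [n [mn ->]]]; apply: idl1_mem.
  exists (~~ i), m, (a.+1 + c)%N, n; rewrite /bword negbK cats0; split => //.
  by case: (i) iabc abc => /=; lia.
have -> : l = ~~ i by case: l i li {iabc} => [] [].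
have ii : ~~ i != i by case: (i).
have := idl_three_blocks 1 a b (nseq c i) ii.
move/idl1_trans; apply=> Y' [m [n [mn ->]]]; apply: idl1_mem.
exists i, m, b.+1, (n + c)%N; rewrite /bword (nseqD n c); split => //.
by case: (i) iabc => /=; lia.
Qed.

(** * The identity of i^a factors through the divided power *)

(* s_b ... s_2 s_1 on the first b + 1 of n strands. *)
Fixpoint partcyc i b n : hom (nseq n i) (nseq n i) :=
  match b with
  | 0 => 1_(nseq n i)
  | b'.+1 =>
      match n return hom (nseq n i) (nseq n i) with
      | m.+2 => whisk i (partcyc i b' m.+1) ∘ crossl i (nseq m i)
      | n0 => 1_(nseq n0 i)
      end
  end.

Lemma partcycS i b m :
  partcyc i b.+1 m.+2 = whisk i (partcyc i b m.+1) ∘ crossl i (nseq m i).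
Proof. by []. Qed.

Lemma cyc_partcyc i a : cyc i a = partcyc i a a.+1.
Proof. by elim: a => [|a IH] //; rewrite cycS IH. Qed.

(** Passing the dot through s_1, ..., s_(b+1) leaves terms in which one crossing s_k is missing. If
    k <= b, then s_(k+1) commutes past s_(k-1), ..., s_1 and kills z; only the term without s_(b+1)
    survives. *)
Lemma partcyc_dotl i b m : (b <= m)%N ->
  exists2 y : hom (nseq m.+2 i) (nseq m.+2 i), homog 2 y &
  forall X (F : hmorph (nseq m.+2 i) X) V (z : hom V X),
    (forall s : hom (nseq m.+1 i) (nseq m.+1 i), simple_cross s ->
       F (whisk i s) ∘ z = 0) ->
    F (partcyc i b.+1 m.+2 ∘ dotl i (nseq m.+1 i)) ∘ z
    = F y ∘ (F (partcyc i b.+1 m.+2) ∘ z) + F (partcyc i b m.+2) ∘ z.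
Proof.
elim: b m => [|b IH] m bm.
  exists (whisk i (dotl i (nseq m i))) => [|X F V z Fz].
    exact/homog_whisk/homog_dotl.
  rewrite partcycS [partcyc i 0 _]/= whisk1 hcomp1l crossl_dotl.
  by rewrite hfunD hcompDl hfunM -hcompA.
case: m bm => // m bm; have [y y2 yE] := IH m bm.
exists (whisk i y) => [|X F V z Fz]; first exact: homog_whisk.
rewrite partcycS -hcompA crossl_dotl hcompDr hcomp1r hfunD hcompDl.
have -> : F (whisk i (partcyc i b.+1 m.+2)) ∘ z = 0.
  rewrite partcycS whiskM hfunM -hcompA Fz ?hcomp0r //; by right.
have [F' F'E] := @hmorph_whisk (nseq m.+2 i) X i F.
rewrite addr0 (hcompA (whisk i (partcyc i b.+1 m.+2))) -whiskM hfunM -hcompA -F'E yE; last first.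
  move=> s ss; rewrite F'E hcompA -hfunM.
  rewrite -(crossl_far i s) hfunM -hcompA Fz ?hcomp0r //.
  by left; exists s.
rewrite !F'E hfunM -hcompA; congr (_ + _).
by rewrite (partcycS i b m.+1) hfunM -hcompA.
Qed.

(** [partcyc_dotl], solved for its last term, removes one crossing and raises the degree by 2; b
    such steps leave z alone. *)
Lemma idl_partcyc S i b m d (z : hom (nseq m.+1 i) (nseq m.+1 i)) :
  (b <= m.+1)%N ->
  (forall s, simple_cross s -> s ∘ z = 0) ->
  idl S d (partcyc i b m.+2 ∘ whisk i z) ->
  idl S (d + b%:Z *+ 2) (whisk i z).
Proof.
move=> bm sz; elim: b d bm => [|b IH] d bm.
  by rewrite hcomp1l => /(idl_eq _); apply; lia.
have [y y2 yE] := partcyc_dotl i (bm : (b <= m)%N).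
pose F := @HMorph (nseq m.+2 i) (nseq m.+2 i) id (fun _ _ => erefl)
            (fun _ _ => erefl) erefl.
have {}yE : partcyc i b.+1 m.+2 ∘ dotl i (nseq m.+1 i) ∘ whisk i z
    = y ∘ (partcyc i b.+1 m.+2 ∘ whisk i z) + partcyc i b m.+2 ∘ whisk i z.
  by apply: (yE _ F) => s ss; rewrite /= -whiskM sz // whisk0.
move=> Sb.
have -> : d + b.+1%:Z *+ 2 = (d + 2) + b%:Z *+ 2 by lia.
apply: IH; first exact: ltnW.
have <- : partcyc i b.+1 m.+2 ∘ whisk i z ∘ dotl i (nseq m.+1 i)
     - y ∘ (partcyc i b.+1 m.+2 ∘ whisk i z) = partcyc i b m.+2 ∘ whisk i z.
  have -> : partcyc i b.+1 m.+2 ∘ whisk i z ∘ dotl i (nseq m.+1 i)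
          = partcyc i b.+1 m.+2 ∘ dotl i (nseq m.+1 i) ∘ whisk i z.
    by rewrite -hcompA -dotl_far hcompA.
  by rewrite yE addrC addrA addNr add0r.
apply: idl_sub; first exact: idl_compr Sb (homog_dotl _ _).
by rewrite addrC; apply: idl_compl.
Qed.

Definition ldeg (a : nat) : int := - ((a * a.-1)%N)%:Z.

Lemma homog_longcross i a : homog (ldeg a) (longcross i a).
Proof.
elim: a => [|a IH]; first exact: homog_id.
rewrite longcrossS.
apply: homog_eq (homog_comp (cyc_homog i a) (homog_whisk i IH)).
by rewrite /ldeg; case: a {IH} => //= a; lia.
Qed.

Lemma homog_delta i a : homog (- ldeg a) (delta i a).
Proof.
elim: a => [|a IH]; first exact: homog_id.
apply: homog_eq (homog_tens (dotpow_homog i a) IH).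
by rewrite /ldeg; case: a {IH} => //= a; lia.
Qed.

Lemma longcross_dividem i a : longcross i a ∘ dividem i a = longcross i a.
Proof.
rewrite /dividem hcompA.
pose F := @HMorph (nseq a i) (nseq a i) id (fun _ _ => erefl)
            (fun _ _ => erefl) erefl.
exact: (longcross_delta_absorb (F := F) (@cross_longcross i a)).
Qed.

(** D_(a+1) is a cycle times the whiskered D_a, which every crossing of its strands kills;
    [idl_partcyc] strips off the cycle, so the whiskered D_a lies in the ideal of D_(a+1). *)
Lemma idl_longcross i a : idl (sone (ldeg a) (longcross i a)) 0 1_(nseq a i).
Proof.
elim: a => [|a IH]; first by apply: idl_mem; constructor.
rewrite -[1_(_)]whisk1; apply: (idl_whisk IH) => Y d e [] {Y d e}.
have mem : idl (sone (ldeg a.+1) (longcross i a.+1)) (ldeg a.+1) (longcross i a.+1).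
  by apply: idl_mem; constructor.
case: a mem {IH} => [|a] mem.
  by move: mem; rewrite longcrossS [cyc i 0]/= hcomp1l.
have -> : ldeg a.+1 = ldeg a.+2 + a.+1%:Z *+ 2 by rewrite /ldeg /=; lia.
apply: (idl_partcyc (leqnn a.+1) (@cross_longcross i a.+1)).
by move: mem; rewrite longcrossS cyc_partcyc.
Qed.

Lemma idl_dividem i a : idl (sone 0 (dividem i a)) 0 1_(nseq a i).
Proof.
apply: idl_trans (idl_longcross i a) _ => Y d e [] {Y d e}.
rewrite -longcross_dividem -[ldeg a]addr0.
apply: idl_compl; first exact: homog_longcross.
by apply: idl_mem; constructor.
Qed.

Lemma idl_tens (S S' S'' : eset) X Z X' Z' d d' (f : hom X Z) (f' : hom X' Z') :
  (forall Y e (g : hom Y Y) Y' e' (g' : hom Y' Y'),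
     S Y e g -> S' Y' e' g' -> idl S'' (e + e') (g ⊗ g')) ->
  idl S d f -> idl S' d' f' -> idl S'' (d + d') (f ⊗ f').
Proof.
move=> SS fS; elim: fS => {X Z d f}
  [X Z d|X Z d f g _ IH _ IH'|X Y Z d1 d d2 h e k Se hd kd] f'S.
- by rewrite htens0l; apply: idl_0.
- by rewrite htensDl; apply: idl_add; [apply: IH|apply: IH'].
elim: f'S => {X' Z' d' f'}
  [X' Z' d'|X' Z' d' f' g' _ IH _ IH'|X' Y' Z' d1' d' d2' h' e' k' Se' hd' kd'].
- by rewrite htens0r; apply: idl_0.
- by rewrite htensDr; apply: idl_add.
rewrite -!hinterchange.
have := idl_compr (idl_compl (homog_tens hd hd') (SS _ _ _ _ _ _ Se Se'))
          (homog_tens kd kd').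
by apply: idl_eq; lia.
Qed.

(** * The polynomial representation *)

Definition pt := {x : nat -> rat | injective x}.

Lemma pt_eq (x y : pt) : sval x =1 sval y -> x = y.
Proof.
case: x y => x xi [y yi] /= /funext xy; case: _ / xy in yi *.
by congr exist; apply: Prop_irrelevance.
Qed.

Definition swn (k r : nat) : nat :=
  if r == k then k.+1 else if r == k.+1 then k else r.

Lemma swnK k : involutive (swn k).
Proof. by move=> r; rewrite /swn; do ![case: eqP => //]; lia. Qed.

Lemma psw_subproof k (x : pt) : injective (sval x \o swn k).
Proof. by apply: inj_comp (svalP x) (inv_inj (swnK k)). Qed.

Definition psw k (x : pt) : pt := exist _ _ (@psw_subproof k x).

Lemma pt_neq (x : pt) k l : k != l -> sval x k - sval x l != 0.
Proof. by move=> kl; rewrite subr_eq0 (inj_eq (svalP x)). Qed.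

(* The polynomial representation on n strands, extended to functions of       *)
(* infinitely many distinct variables so that it needs no division of         *)
(* polynomials and no case distinction on n: [rep t k] acts on the variables  *)
(* from the k-th one on.                                                      *)
Fixpoint rep X Y (t : term X Y) (k : nat) (F : pt -> rat) {struct t} : pt -> rat :=
  match t with
  | tid _ => F
  | tdot _ => fun x => sval x k * F x
  | tcross i j => fun x =>
      if i == j then (F x - F (psw k x)) / (sval x k - sval x k.+1)
      else if i then F (psw k x) else (sval x k + sval x k.+1) * F (psw k x)
  | tcomp _ _ _ f g => rep f k (rep g k F)
  | ttens X _ _ _ f g => rep f k (rep g (k + size X) F)
  | tzero _ _ => fun=> 0
  | tadd _ _ f g => fun x => rep f k F x + rep g k F x
  | topp _ _ f => fun x => - rep f k F x
  end.

Lemma repD X Y (t : term X Y) k F G :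
  rep t k (fun x => F x + G x) = fun x => rep t k F x + rep t k G x.
Proof.
elim: t k F G => {X Y} //=.
- by move=> i k F G; apply: funext => x; rewrite mulrDr.
- move=> i j k F G; apply: funext => x; case: eqP => _.
    by rewrite -mulrDl opprD addrACA.
  by case: i => //; rewrite mulrDr.
- by move=> X Y Z f IHf g IHg k F G; rewrite IHg IHf.
- by move=> X Y X' Y' f IHf g IHg k F G; rewrite IHg IHf.
- by move=> X Y f IHf g IHg k F G; apply: funext => x; rewrite IHf IHg addrACA.
- by move=> X Y f IHf k F G; apply: funext => x; rewrite IHf opprD.
Qed.

Definition additive_op (A : (pt -> rat) -> pt -> rat) : Prop :=
  forall F G, A (fun x => F x + G x) = fun x => A F x + A G x.

Lemma additive_op0 A : additive_op A -> A (fun=> 0) = fun=> 0.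
Proof.
move=> AD; apply: funext => x.
have : A (fun=> 0) x = A (fun=> 0) x + A (fun=> 0) x.
  rewrite -{1}[LHS]/(A (fun=> 0) x); have := congr1 (@^~ x) (AD (fun=> 0) (fun=> 0)).
  by rewrite /= addr0.
by rewrite -{1}[LHS]addr0 => /addrI.
Qed.

Lemma additive_opN A F : additive_op A -> A (fun x => - F x) = fun x => - A F x.
Proof.
move=> AD; apply: funext => x; apply: (addrI (A F x)).
have := congr1 (@^~ x) (AD F (fun x => - F x)) => /= <-.
rewrite subrr -[RHS](congr1 (@^~ x) (additive_op0 AD)); congr (A _ x).
by apply: funext => y; rewrite subrr.
Qed.

Lemma rep0 X Y (t : term X Y) k : rep t k (fun=> 0) = fun=> 0.
Proof. by apply: additive_op0 => F G; apply: repD. Qed.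

(** A tensor factor shifts the variables of the next one by the length of its source, so the
    interchange law needs source and target of equal length whenever the action is nonzero. *)
Lemma rep_size X Y (t : term X Y) k F :
  size X != size Y -> rep t k F = fun=> 0.
Proof.
elim: t k F => {X Y} //=.
- by move=> X k F; rewrite eqxx.
- move=> X Y Z f IHf g IHg k F XZ.
  have [XY|XY] := eqVneq (size X) (size Y); first by rewrite IHf // -XY.
  by rewrite IHg // rep0.
- move=> X Y X' Y' f IHf g IHg k F; rewrite !size_cat => XY.
  have [e|e] := eqVneq (size X) (size Y); last by rewrite IHf.
  by rewrite IHg ?rep0 // -(eqn_add2l (size X)) {2}e.
- by move=> X Y f IHf g IHg k F XY; apply: funext => x; rewrite IHf // IHg // addr0.
- by move=> X Y f IHf k F XY; apply: funext => x; rewrite IHf // oppr0.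
Qed.

(** The Demazure operator is characterized by its product with x_l - x_(l+1), which vanishes nowhere
    on [pt]; so commuting with coordinates and exchanges suffices. *)
Lemma rep_local A l X Y (t : term X Y) F :
  additive_op A ->
  (forall r G, (l <= r < l + size X)%N ->
     A (fun x => sval x r * G x) = fun x => sval x r * A G x) ->
  (forall r G, (l <= r)%N -> (r.+1 < l + size X)%N ->
     A (fun x => G (psw r x)) = fun x => A G (psw r x)) ->
  A (rep t l F) = rep t l (A F).
Proof.
move=> AD; have A0 := additive_op0 AD.
elim: t l F => {X Y} //=.
- by move=> i l F Am _; apply: Am; lia.
- move=> i j l F Am As.
  have Ad G : A (fun x => (sval x l - sval x l.+1) * G x)
             = fun x => (sval x l - sval x l.+1) * A G x.
    transitivity (A (fun x => sval x l * G x + - (sval x l.+1 * G x))).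
      by congr A; apply: funext => x; rewrite mulrBl.
    by rewrite AD additive_opN // !Am; try lia; apply: funext => x; rewrite mulrBl.
  case: eqP => _.
    apply: funext => x.
    have nz (y : pt) : sval y l - sval y l.+1 != 0 by apply: pt_neq; lia.
    apply: (mulfI (nz x)); rewrite -[LHS](congr1 (@^~ x) (Ad _)).
    rewrite [RHS]mulrC divfK //.
    transitivity (A (fun x => F x + - F (psw l x)) x).
      by congr (A _ x); apply: funext => y; rewrite mulrC divfK.
    by rewrite AD additive_opN // As //; lia.
  case: i; first by apply: As; lia.
  transitivity (A (fun x => sval x l * F (psw l x) + sval x l.+1 * F (psw l x))).
    by congr A; apply: funext => x; rewrite mulrDl.
  rewrite AD !Am; try lia.
  by rewrite As; try lia; apply: funext => x; rewrite mulrDl.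
- move=> X Y Z f IHf g IHg l F Am As.
  have [e|e] := eqVneq (size X) (size Y).
    by rewrite IHf ?IHg // -e.
  by rewrite !(rep_size g) // !rep0 A0.
- move=> X Y X' Y' f IHf g IHg l F; rewrite size_cat => Am As.
  rewrite IHf ?IHg // => r G rl.
  + by apply: Am; lia.
  + by move=> rl'; apply: As; lia.
  + by apply: Am; lia.
  + by move=> rl'; apply: As; lia.
- move=> X Y f IHf g IHg l F Am As.
  by rewrite AD IHf // IHg.
- by move=> X Y f IHf l F Am As; rewrite additive_opN // IHf.
Qed.

Lemma psw_far r k (x : pt) : (r.+1 < k)%N || (k.+1 < r)%N ->
  psw r (psw k x) = psw k (psw r x).
Proof.
move=> rk; apply: pt_eq => n /=; congr (sval x _); rewrite /swn.
by do ![case: eqP => //]; lia.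
Qed.

(** This carries the interchange law. [rep_local] is applied to t', and twice more to t in order to
    verify its own hypotheses. *)
Lemma rep_comm X Y (t : term X Y) X' Y' (t' : term X' Y') k l F :
  (k + size X <= l)%N -> rep t k (rep t' l F) = rep t' l (rep t k F).
Proof.
move=> kl; apply: rep_local => [G H|r G rl|r G rl rl']; first exact: repD.
- apply: esym; apply: (rep_local (A := fun G x => sval x r * G x)).
  + by move=> G1 G2; apply: funext => x; rewrite mulrDr.
  + by move=> r' G' r'l; apply: funext => x; rewrite mulrCA.
  + move=> r' G' r'k r'l; apply: funext => x /=.
    by rewrite /swn; do ![case: eqP => //]; lia.
apply: esym; apply: (rep_local (A := fun G x => G (psw r x))) => //.
- move=> r' G' r'l; apply: funext => x /=.
  by rewrite /swn; do ![case: eqP => //]; lia.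
- by move=> r' G' r'k r'l; apply: funext => x; rewrite psw_far //; lia.
Qed.

Lemma rep_cast X X' Y Y' (eX : X = X') (eY : Y = Y') (t : term X Y) :
  rep (tcast eX eY t) = rep t.
Proof. by case: _ / eX; case: _ / eY. Qed.

Lemma swn_l k : swn k k = k.+1.
Proof. by rewrite /swn eqxx. Qed.

Lemma swn_r k : swn k k.+1 = k.
Proof. by rewrite /swn eqxx gtn_eqF. Qed.

Lemma swn_lt k : swn k.+1 k = k.
Proof. by rewrite /swn !ltn_eqF. Qed.

Lemma swn_gt k : swn k k.+2 = k.+2.
Proof. by rewrite /swn !gtn_eqF. Qed.

Definition swnE := (swn_l, swn_r, swn_lt, swn_gt).

Lemma pswK k x : psw k (psw k x) = x.
Proof. by apply: pt_eq => n /=; rewrite swnK. Qed.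

Lemma psw_braid k x :
  psw k.+1 (psw k (psw k.+1 x)) = psw k (psw k.+1 (psw k x)).
Proof.
apply: pt_eq => n /=; congr (sval x _); rewrite /swn.
by do ![case: eqP => //]; lia.
Qed.

Lemma rep_rel X Y (f g : term X Y) : trel f g -> forall k F, rep f k F = rep g k F.
Proof.
move=> fg; elim: fg => {X Y f g}; try by [].
- by move=> X Y f g h _ IH _ IH' k F; rewrite IH.
- by move=> X Y Z f f' g g' _ IHf _ IHg k F /=; rewrite IHg IHf.
- by move=> X Y X' Y' f f' g g' _ IHf _ IHg k F /=; rewrite IHg IHf.
- by move=> X Y f f' g g' _ IHf _ IHg k F /=; rewrite IHg IHf.
- by move=> X Y f f' _ IH k F /=; rewrite IH.
- by move=> X Y f g h k F; apply: funext => x /=; rewrite addrA.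
- by move=> X Y f g k F; apply: funext => x /=; rewrite addrC.
- by move=> X Y f k F; apply: funext => x /=; rewrite add0r.
- by move=> X Y f k F; apply: funext => x /=; rewrite addNr.
- by move=> X Y Z f g g' k F; rewrite /= repD.
- by move=> X Y X' Y' f g g' k F; rewrite /= repD.
- move=> X Y Z X' Y' Z' f g f' g' k F /=.
  have [e|e] := eqVneq (size X) (size Y); last first.
    by rewrite !(rep_size g) // !rep0.
  by rewrite -e (rep_comm g f').
- move=> X Y X' Y' X'' Y'' f g h k F; rewrite rep_cast /=.
  by rewrite size_cat addnA.
- by move=> X Y f k F; rewrite /= addn0.
- by move=> X Y f k F; rewrite rep_cast.
- move=> i k F; apply: funext => x /=; rewrite eqxx addn1 /= swnE.
  have d : sval x k - sval x k.+1 != 0 by apply: pt_neq; lia.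
  by field.
- move=> i k F; apply: funext => x /=; rewrite eqxx addn1 /= swnE.
  have d : sval x k - sval x k.+1 != 0 by apply: pt_neq; lia.
  by field.
- move=> i k F; apply: funext => x /=; rewrite eqxx /= !swnE pswK.
  by rewrite -[sval x k.+1 - _]opprB; field; apply: pt_neq; lia.
- move=> i j ij k F; apply: funext => x /=; rewrite eq_sym (negbTE ij) addn1 /=.
  by case: i j ij => [] [] //= _; rewrite ?swnE pswK; ring.
- move=> i j ij k F; apply: funext => x /=; rewrite (negbTE ij) addn1 /=.
  by case: i j ij => [] [] //= _; rewrite ?swnE; ring.
- move=> i j ij k F; apply: funext => x /=; rewrite (negbTE ij) addn1 /=.
  by case: i j ij => [] [] //= _; rewrite ?swnE; ring.
- move=> i j l ijl k F; apply: funext => x /=; rewrite !addn1 /=.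
  have d1 : sval x k - sval x k.+1 != 0 by apply: pt_neq; lia.
  have d2 : sval x k.+1 - sval x k.+2 != 0 by apply: pt_neq; lia.
  have d3 : sval x k - sval x k.+2 != 0 by apply: pt_neq; lia.
  have d4 : sval x k.+1 - sval x k != 0 by apply: pt_neq; lia.
  have d5 : sval x k.+2 - sval x k.+1 != 0 by apply: pt_neq; lia.
  by case: i j l ijl => [] [] [] //= _; rewrite ?swnE ?pswK ?psw_braid;
     field; rewrite ?d1 ?d2 ?d3 ?d4 ?d5.
- move=> i j ij k F; apply: funext => x /=; rewrite !addn1 /=.
  have d1 : sval x k - sval x k.+1 != 0 by apply: pt_neq; lia.
  have d2 : sval x k.+1 - sval x k.+2 != 0 by apply: pt_neq; lia.
  have d3 : sval x k - sval x k.+2 != 0 by apply: pt_neq; lia.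
  have d4 : sval x k.+1 - sval x k != 0 by apply: pt_neq; lia.
  have d5 : sval x k.+2 - sval x k.+1 != 0 by apply: pt_neq; lia.
  by case: i j ij => [] [] //= _; rewrite ?swnE ?pswK ?psw_braid;
     field; rewrite ?d1 ?d2 ?d3 ?d4 ?d5.
Qed.

(** The multiple z of the identity sends the constant function 1 to z; it is evaluated at the point
    with coordinates 0, 1, 2, ... *)
Lemma hid_mulz_eq0 X (z : int) : 1_X *~ z = 0 -> z = 0.
Proof.
pose r (f : hom X X) := rep (hrep f) 0 (fun=> 1).
have rE t : r (hcls t) = rep t 0 (fun=> 1) by apply/rep_rel/hrep_cls.
have rD f g x : r (f + g) x = r f x + r g x.
  by rewrite -(hrepK f) -(hrepK g) -hclsDE !rE.
have r0 x : r 0 x = 0 by rewrite rE.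
have rN f x : r (- f) x = - r f x by rewrite -(hrepK f) -hclsNE !rE.
have rn n x : r (1_X *+ n) x = n%:R.
  by elim: n => [|n IH]; rewrite ?mulr0n ?r0 // mulrS rD IH rE /= -natr1 addrC.
have xi : injective (fun n : nat => n%:R : rat).
  by move=> m n /eqP; rewrite eqr_nat => /eqP.
pose x : pt := exist _ _ xi.
case: z => n; rewrite /intmul => /(congr1 (fun f => r f x)); rewrite ?rN r0 rn.
  by move/eqP; rewrite pnatr_eq0 => /eqP ->.
by move/eqP; rewrite oppr_eq0 pnatr_eq0.
Qed.

(** * Spanning sets of diagrams *)

Lemma hom_perm X Y (f : hom X Y) : ~~ perm_eq X Y -> f = 0.
Proof.
suff H U V (t : term U V) : ~~ perm_eq U V -> hcls t = 0.
  by rewrite -(hrepK f); apply: H.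
elim: t => {U V} /=.
- by move=> U; rewrite perm_refl.
- by move=> i; rewrite perm_refl.
- by move=> i j; rewrite (perm_catC [:: i] [:: j]) perm_refl.
- move=> U V W t IH t' IH' UW; rewrite hcls_comp.
  have [UV|UV] := boolP (perm_eq U V); last by rewrite IH' // hcomp0r.
  by rewrite IH ?hcomp0l //; apply: (contraNN _ UW) => VW; exact: perm_trans UV VW.
- move=> U V U' V' t IH t' IH' UV; rewrite hcls_tens.
  have [e|e] := boolP (perm_eq U V); last by rewrite IH // htens0l.
  by rewrite IH' ?htens0r //; apply: (contraNN _ UV) => VW; exact: perm_cat e VW.
- by [].
- by move=> U V t IH t' IH' UV; rewrite hclsDE IH // IH' // addr0.
- by move=> U V t IH UV; rewrite hclsNE IH // oppr0.
Qed.

Inductive gen : forall X Y, int -> hom X Y -> Prop :=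
| gen_dot i Z : gen 2 (dotl i Z)
| gen_crs i j Z : gen (- cartan i j) (crs i j Z)
| gen_whisk i X Y d (f : hom X Y) : gen d f -> gen d (whisk i f).

(** The form of [homog] without tensor products: one dot or crossing is added at a time on the
    source side, which permits induction on diagrams. *)
Inductive dspan : forall X Y, int -> hom X Y -> Prop :=
| dspan_id X : dspan 0 1_X
| dspan_step X Y Z d d' (f : hom Y Z) (g : hom X Y) :
    dspan d f -> gen d' g -> dspan (d + d') (f ∘ g)
| dspan_0 X Y d : dspan d (0 : hom X Y)
| dspan_add X Y d (f g : hom X Y) : dspan d f -> dspan d g -> dspan d (f + g)
| dspan_opp X Y d (f : hom X Y) : dspan d f -> dspan d (- f).

Lemma dspan_comp X Y Z d d' (f : hom Y Z) (g : hom X Y) :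
  dspan d f -> dspan d' g -> dspan (d + d') (f ∘ g).
Proof.
move=> fd gd; elim: gd Z f d fd => {X Y d' g}
  [X|X Y W d1 d2 g h _ IH hd|X Y d1|X Y d1 g h _ IH _ IH'|X Y d1 g _ IH] Z f d fd.
- by rewrite hcomp1r addr0.
- by rewrite hcompA addrA; apply: dspan_step => //; apply: IH.
- by rewrite hcomp0r; apply: dspan_0.
- by rewrite hcompDr; apply: dspan_add; [apply: IH|apply: IH'].
- by rewrite hcompNr; apply: dspan_opp; apply: IH.
Qed.

Lemma dspan_whisk i X Y d (f : hom X Y) : dspan d f -> dspan d (whisk i f).
Proof.
elim=> {X Y d f}
  [X|X Y W d1 d2 g h _ IH hd|X Y d1|X Y d1 g h _ IH _ IH'|X Y d1 g _ IH].
- by rewrite whisk1; apply: dspan_id.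
- by rewrite whiskM; apply: dspan_step => //; apply: gen_whisk.
- by rewrite whisk0; apply: dspan_0.
- by rewrite whiskD; apply: dspan_add.
- by rewrite whiskN; apply: dspan_opp.
Qed.

Lemma dspan_tensl X Y Z d (f : hom Y Z) : dspan d f -> dspan d (1_X ⊗ f).
Proof.
move=> fd; elim: X => [|i X IH]; first by rewrite htens1l.
suff -> : 1_(i :: X) ⊗ f = whisk i (1_X ⊗ f) by exact: dspan_whisk.
rewrite -whisk1; apply: esym; etransitivity; last exact: (htensA 1_[:: i] 1_X f).
by rewrite (hcast_id (X := i :: (X ++ Y)) (Y := i :: (X ++ Z))).
Qed.

Lemma gen_tensr X Y W d (f : hom X Y) : gen d f -> gen d (f ⊗ 1_W).
Proof.
elim=> {X Y d f} [i Z|i j Z|i X Y d f _ IH].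
- have -> : dotl i Z ⊗ 1_W = dotl i (Z ++ W).
    etransitivity; first exact: (esym (htensA (hdot i) 1_Z 1_W)).
    by rewrite (hcast_id (X := i :: (Z ++ W)) (Y := i :: (Z ++ W))) htens1.
  exact: gen_dot.
- have -> : crs i j Z ⊗ 1_W = crs i j (Z ++ W).
    etransitivity; first exact: (esym (htensA (hcross i j) 1_Z 1_W)).
    by rewrite (hcast_id (X := [:: i, j & Z ++ W]) (Y := [:: j, i & Z ++ W]))
               htens1.
  exact: gen_crs.
have -> : whisk i f ⊗ 1_W = whisk i (f ⊗ 1_W).
  etransitivity; first exact: (esym (htensA 1_[:: i] f 1_W)).
  by rewrite (hcast_id (X := i :: (X ++ W)) (Y := i :: (Y ++ W))).
exact: gen_whisk.
Qed.

Lemma dspan_tensr X Y W d (f : hom X Y) : dspan d f -> dspan d (f ⊗ 1_W).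
Proof.
elim=> {X Y d f}
  [X|X Y V d1 d2 g h _ IH hd|X Y d1|X Y d1 g h _ IH _ IH'|X Y d1 g _ IH].
- by rewrite htens1; apply: dspan_id.
- by rewrite -tens1M; apply: dspan_step => //; apply: gen_tensr.
- by rewrite htens0l; apply: dspan_0.
- by rewrite htensDl; apply: dspan_add.
- suff -> : (- g) ⊗ 1_W = - (g ⊗ 1_W) by exact: dspan_opp.
  by apply: (@addIr _ (g ⊗ 1_W)); rewrite -htensDl !addNr htens0l.
Qed.

Lemma htens1r X Y (f : hom X Y) : hcast (cats0 X) (cats0 Y) (f ⊗ 1_[::]) = f.
Proof.
by rewrite -(hrepK f) -hclsE -hcls_cast; apply/hclsP/trel_tens1r.
Qed.

Lemma dspan_homog X Y d (f : hom X Y) : homog d f -> dspan d f.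
Proof.
elim=> {X Y d f}.
- exact: dspan_id.
- move=> i; have <- : dotl i [::] = hdot i.
    etransitivity; last exact: htens1r.
    by rewrite (hcast_id (X := [:: i]) (Y := [:: i])).
  rewrite -[dotl i _]hcomp1l -[2]add0r.
  by apply: dspan_step (dspan_id _) _; exact: gen_dot.
- move=> i j; have <- : crs i j [::] = hcross i j.
    etransitivity; last exact: htens1r.
    by rewrite (hcast_id (X := [:: i; j]) (Y := [:: j; i])).
  rewrite -[crs i j _]hcomp1l -[- _]add0r.
  by apply: dspan_step (dspan_id _) _; exact: gen_crs.
- by move=> *; apply: dspan_comp.
- move=> X Y X' Y' d d' f g _ fd _ gd.
  have -> : f ⊗ g = (f ⊗ 1_Y') ∘ (1_X ⊗ g) by rewrite hinterchange hcomp1l hcomp1r.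
  by apply: dspan_comp; [exact: dspan_tensr|exact: dspan_tensl].
- by move=> *; apply: dspan_0.
- by move=> *; apply: dspan_add.
- by move=> *; apply: dspan_opp.
Qed.

Fixpoint del k (X : word) : word :=
  match X, k with
  | [::], _ => [::]
  | _ :: X', 0 => X'
  | i :: X', k'.+1 => i :: del k' X'
  end.

Fixpoint pull (X : word) (k : nat) : hom X (nth true X k :: del k X) :=
  match X, k return hom X (nth true X k :: del k X) with
  | [::], _ => 0
  | i :: X', 0 => 1_(i :: X')
  | i :: X', k'.+1 => crs i (nth true X' k') (del k' X') ∘ whisk i (pull X' k')
  end.

Fixpoint pdeg (X : word) (k : nat) : int :=
  match X, k with
  | i :: X', k'.+1 => pdeg X' k' - cartan i (nth true X' k')
  | _, _ => 0
  end.

Lemma homog_pull X k : homog (pdeg X k) (pull X k).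
Proof.
elim: X k => [|i X IH] [|k]; try exact: homog_0; first exact: homog_id.
apply: homog_eq (homog_comp (homog_crs _ _ _) (homog_whisk i (IH k))).
by rewrite addrC.
Qed.

(* Sums of diagrams in which the strand arriving at the left end is first     *)
(* moved there across the others, then dotted, and takes no further part.     *)
Inductive psum (X : word) : forall Z, int -> hom X Z -> Prop :=
| psum_gen k m d Y (g : hom (del k X) Y) : (k < size X)%N -> homog d g ->
    psum (d + m%:Z *+ 2 + pdeg X k)
         (whisk (nth true X k) g ∘ dotpowl (nth true X k) m (del k X) ∘ pull X k)
| psum_0 Z d : psum d (0 : hom X Z)
| psum_add Z d (f g : hom X Z) : psum d f -> psum d g -> psum d (f + g)
| psum_opp Z d (f : hom X Z) : psum d f -> psum d (- f).

Lemma psum_eq X Z d d' (f : hom X Z) : d = d' -> psum d f -> psum d' f.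
Proof. by move=> <-. Qed.

Lemma psum_head i X Z d (g : hom X Z) m :
  homog d g -> psum (d + m%:Z *+ 2) (whisk i g ∘ dotpowl i m X).
Proof.
move=> gd; have := @psum_gen (i :: X) 0 m d Z g isT gd.
by rewrite /= hcomp1r addr0.
Qed.

Lemma psum_whisk i X Z d (g : hom X Z) : homog d g -> psum d (whisk i g).
Proof.
move=> gd; have := psum_head i 0 gd.
by rewrite dotpowl0 hcomp1r; apply: psum_eq; lia.
Qed.

(** The part of a generator to the right of the first strand absorbs g. Matching on the target
    states the claim for [j :: Z'] without a cast, as in [psum_dot] and [psum_crs]. *)
Lemma psum_left X Z d (f : hom X Z) : psum d f ->
  match Z return hom X Z -> Prop with
  | [::] => fun=> True
  | j :: Z' => fun f => forall W e (g : hom Z' W), homog e g ->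
      psum (e + d) (whisk j g ∘ f)
  end f.
Proof.
elim=> {Z d f} [k m d Y g kX gd|[|j Z] d|[|j Z] d f f' _ IH _ IH'|[|j Z] d f _ IH]
  // W e h hd.
- rewrite !hcompA -whiskM; apply: psum_eq (psum_gen m kX (homog_comp hd gd)).
  by rewrite !addrA.
- by rewrite hcomp0r; apply: psum_0.
- by rewrite hcompDr; apply: psum_add; [apply: IH|apply: IH'].
- by rewrite hcompNr; apply: psum_opp; apply: IH.
Qed.

Lemma psum_dot X Z d (f : hom X Z) : psum d f ->
  match Z return hom X Z -> Prop with
  | [::] => fun=> True
  | j :: Z' => fun f => psum (2 + d) (dotl j Z' ∘ f)
  end f.
Proof.
elim=> {Z d f} [k m d Y g kX gd|[|j Z] d|[|j Z] d f f' _ IH _ IH'|[|j Z] d f _ IH] //.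
- rewrite !hcompA dotl_far -(hcompA _ (dotl _ _)) -dotpowlS.
  by apply: psum_eq (psum_gen m.+1 kX gd); lia.
- by rewrite hcomp0r; apply: psum_0.
- by rewrite hcompDr; apply: psum_add.
- by rewrite hcompNr; apply: psum_opp.
Qed.

Lemma psum_pull X k : (k < size X)%N -> psum (pdeg X k) (pull X k).
Proof.
move=> kX; have := psum_gen 0 kX (homog_id (del k X)).
by rewrite whisk1 dotpowl0 !hcomp1l; apply: psum_eq; lia.
Qed.

(** The dot slides out of the crossing; for i = j a term without crossing remains, where the strand
    i itself is the one at the left end. *)
Lemma psum_crs_dot i j X Y d (f : hom X (j :: Y)) :
  homog d f -> psum (d - cartan i j) (crs i j Y ∘ whisk i f) ->
  psum (2 + d - cartan i j) (crs i j Y ∘ whisk i (dotl j Y ∘ f)).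
Proof.
have [ij|ij] := eqVneq i j; last first.
  move=> _ /psum_dot; rewrite whiskM !hcompA (dotl_crsN _ ij).
  by apply: psum_eq; lia.
case: _ / ij in f * => fd /psum_dot h.
have -> : crs i i Y ∘ whisk i (dotl i Y ∘ f)
        = dotl i (i :: Y) ∘ (crs i i Y ∘ whisk i f) - whisk i f.
  by rewrite hcompA dotl_crs hcompDl hcomp1l addrK whiskM hcompA.
apply: psum_add; first by apply: psum_eq h; lia.
apply: psum_opp; have := psum_whisk i fd; rewrite /cartan eqxx.
by apply: psum_eq; lia.
Qed.

Lemma psum_crs_pull i X k m : (k < size X)%N ->
  psum (m%:Z *+ 2 + pdeg X k - cartan i (nth true X k))
    (crs i (nth true X k) (del k X)
       ∘ whisk i (dotpowl (nth true X k) m (del k X) ∘ pull X k)).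
Proof.
move=> kX; have pk := homog_pull X k.
elim: m => [|m IH].
  rewrite dotpowl0 hcomp1l add0r.
  exact: (@psum_pull (i :: X) k.+1).
rewrite dotpowlS -hcompA.
have := psum_crs_dot (homog_comp (homog_dotpowl _ m _) pk) IH.
by apply: psum_eq; lia.
Qed.

Lemma psum_crs i X Z d (f : hom X Z) : psum d f ->
  match Z return hom X Z -> Prop with
  | [::] => fun=> True
  | j :: Z' => fun f => psum (d - cartan i j) (crs i j Z' ∘ whisk i f)
  end f.
Proof.
elim=> {Z d f} [k m d Y g kX gd|[|j Z] d|[|j Z] d f f' _ IH _ IH'|[|j Z] d f _ IH] //.
- rewrite -hcompA whiskM hcompA crs_far -hcompA.
  have := psum_left (psum_crs_pull i m kX) _ _ _ (homog_whisk i gd).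
  by apply: psum_eq; lia.
- by rewrite whisk0 hcomp0r; apply: psum_0.
- by rewrite whiskD hcompDr; apply: psum_add.
- by rewrite whiskN hcompNr; apply: psum_opp.
Qed.

Lemma gen_homog X Y d (f : hom X Y) : gen d f -> homog d f.
Proof.
by elim=> *; [exact: homog_dotl|exact: homog_crs|exact: homog_whisk].
Qed.

Lemma psum_crs_dotl i j X Y d (c : hom X (j :: Y)) :
  homog d c -> psum d c ->
  psum (2 + d - cartan i j) (crs i j Y ∘ whisk i c ∘ dotl i X).
Proof.
move=> cd ps; rewrite -hcompA -dotl_far hcompA.
have pc := psum_crs i ps.
have [ij|ij] := eqVneq i j; last first.
  rewrite (crs_dotlN _ ij) -hcompA.
  have := psum_left pc _ _ _ (homog_dotl i Y).
  by apply: psum_eq; lia.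
case: _ / ij in c cd pc {ps} *.
rewrite crs_dotl hcompDl hcomp1l -hcompA; apply: psum_add.
  have := psum_left pc _ _ _ (homog_dotl i Y).
  by apply: psum_eq; lia.
have := psum_whisk i cd; rewrite /cartan eqxx.
by apply: psum_eq; lia.
Qed.

Lemma psum_crs_crs i j Z : psum (- cartan j i - cartan i j) (crs j i Z ∘ crs i j Z).
Proof.
have [<-|ij] := eqVneq i j; first by rewrite crs_crs; apply: psum_0.
rewrite (crs_crsN _ ij); apply: psum_add.
  have := psum_head i 1 (homog_id (j :: Z)).
  rewrite whisk1 hcomp1l dotpowlS dotpowl0 hcomp1r.
  by apply: psum_eq; rewrite !cartanN //; rewrite eq_sym.
have := psum_whisk i (homog_dotl j Z).
by apply: psum_eq; rewrite !cartanN //; rewrite eq_sym.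
Qed.

(** The braid relation moves the crossing of i and j to the target side, where it avoids the pulled
    strand l. The extra term 1, for i = l != j, leaves the first strand i in place and is again a
    [psum]. *)
Lemma psum_crs_braid i j l X Y d (c : hom X (l :: Y)) : homog d c -> psum d c ->
  psum (d - cartan i l - cartan j l - cartan i j)
       (crs j l (i :: Y) ∘ whisk j (crs i l Y ∘ whisk i c) ∘ crs i j X).
Proof.
move=> cd ps.
have E : crs j l (i :: Y) ∘ whisk j (crs i l Y ∘ whisk i c) ∘ crs i j X
  = crs j l (i :: Y) ∘ whisk j (crs i l Y) ∘ crs i j (l :: Y)
    ∘ whisk i (whisk j c).
  by rewrite whiskM -!hcompA -crs_far.
have p := psum_left (psum_crs i (psum_crs j ps)) _ _ _ (homog_crs i j Y).
have F : whisk l (crs i j Y) ∘ (crs i l (j :: Y) ∘ whisk i (crs j l Y ∘ whisk j c))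
  = whisk l (crs i j Y) ∘ crs i l (j :: Y) ∘ whisk i (crs j l Y)
    ∘ whisk i (whisk j c).
  by rewrite whiskM !hcompA.
rewrite E; have [ijl|ijl] := boolP ((i == l) && (l != j)); last first.
  by rewrite crs_braid // -F; apply: psum_eq p; lia.
have /andP[/eqP il lj] := ijl; case: _ / il in c cd p lj {ps ijl E} F *.
rewrite (crs_braid1 _ lj) hcompDl hcomp1l -F; apply: psum_add.
  by apply: psum_eq p; lia.
have := psum_whisk i (homog_whisk j cd).
by apply: psum_eq; rewrite /cartan !eqxx (negbTE lj) eq_sym (negbTE lj); lia.
Qed.

Lemma psum_pull_gen X Y d (f : hom X Y) k : gen d f -> (k < size Y)%N ->
  psum (pdeg Y k + d) (pull Y k ∘ f).
Proof.
move=> fg; elim: fg k => {X Y d f} [i Z|i j Z|i X Y d f fg IH] [|k] kY /=.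
- rewrite hcomp1l add0r; have := psum_head i 1 (homog_id Z).
  by rewrite whisk1 hcomp1l dotpowlS dotpowl0 hcomp1r.
- have := psum_crs_dotl i (homog_pull Z k) (@psum_pull Z k kY).
  by apply: psum_eq; lia.
- rewrite hcomp1l add0r.
  have := @psum_pull [:: i, j & Z] 1 isT.
  by rewrite /= whisk1 hcomp1r sub0r.
- case: k kY => [|k] kY /=.
    rewrite whisk1 hcomp1r.
    by have := psum_crs_crs i j Z; apply: psum_eq; lia.
  have := psum_crs_braid i j (homog_pull Z k) (@psum_pull Z k kY).
  by apply: psum_eq; lia.
- by rewrite hcomp1l add0r; apply/psum_whisk/gen_homog.
rewrite -hcompA -whiskM.
have := psum_crs i (IH k kY).
by apply: psum_eq; lia.
Qed.

(** The generator meets the pull first ([psum_pull_gen]); the dots and the rest of the diagram are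
    then put back on the target side. *)
Lemma psum_gen_right X Y Z d d' (f : hom Y Z) (g : hom X Y) :
  psum d f -> gen d' g -> psum (d + d') (f ∘ g).
Proof.
move=> fp gg; elim: fp => {Z d f}
  [k m d Z f kY fd|Z d|Z d f f' _ IH _ IH'|Z d f _ IH].
- rewrite -!hcompA; have p := psum_pull_gen gg kY.
  have {}p : psum (m%:Z *+ 2 + (pdeg Y k + d'))
               (dotpowl (nth true Y k) m (del k Y) ∘ (pull Y k ∘ g)).
    elim: m => [|m IH]; first by rewrite dotpowl0 hcomp1l add0r.
    rewrite dotpowlS -hcompA.
    by apply: psum_eq (psum_dot IH); lia.
  by apply: psum_eq (psum_left p _ _ _ fd); lia.
- by rewrite hcomp0l; apply: psum_0.
- by rewrite hcompDl; apply: psum_add.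
- by rewrite hcompNl; apply: psum_opp.
Qed.

Lemma dspan_psum X Z d (f : hom X Z) : dspan d f -> Z != [::] -> psum d f.
Proof.
elim=> {X Z d f}
  [X|X Y Z d d' f g _ IH gd|X Y d|X Y d f f' _ IH _ IH'|X Y d f _ IH] Z0.
- case: X Z0 => // i X _; have := @psum_pull (i :: X) 0 isT; exact.
- by apply: psum_gen_right => //; apply: IH.
- exact: psum_0.
- by apply: psum_add; [apply: IH|apply: IH'].
- by apply: psum_opp; apply: IH.
Qed.

Lemma homog_psum X j Z d (f : hom X (j :: Z)) : homog d f -> psum d f.
Proof. by move=> fd; apply: dspan_psum => //; apply: dspan_homog. Qed.

(** * Lowest degrees of homs *)

(** The degree M part is only claimed to be cyclic, possibly zero; this lets the bound be weakened
    ([lowdeg_le]). *)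
Definition lowdeg (X Y : word) (M : int) : Prop :=
  (forall d (f : hom X Y), homog d f -> (d < M)%R -> f = 0) /\
  (exists2 u : hom X Y, homog M u &
     forall f : hom X Y, homog M f -> exists z : int, f = u *~ z).

Lemma lowdeg_le X Y M M' : (M' <= M)%R -> lowdeg X Y M -> lowdeg X Y M'.
Proof.
rewrite le_eqVlt => /orP[/eqP -> //|M'M] [H _].
split=> [d f fd dM|]; first by apply: H fd _; lia.
exists 0; first exact: homog_0.
by move=> f fd; exists 0; rewrite mulr0z; apply: H fd _.
Qed.

Lemma hcast0 X X' Y Y' (eX : X = X') (eY : Y = Y') :
  hcast eX eY (0 : hom X Y) = 0.
Proof. by case: _ / eX; case: _ / eY. Qed.

Lemma hcastD X X' Y Y' (eX : X = X') (eY : Y = Y') (f g : hom X Y) :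
  hcast eX eY (f + g) = hcast eX eY f + hcast eX eY g.
Proof. by case: _ / eX; case: _ / eY. Qed.

Lemma hcastN X X' Y Y' (eX : X = X') (eY : Y = Y') (f : hom X Y) :
  hcast eX eY (- f) = - hcast eX eY f.
Proof. by case: _ / eX; case: _ / eY. Qed.

(** The target of a generator begins with [nth true X k] instead of j, whence the cast along e. *)
Lemma psum_ind_to X j Y (P : int -> hom X (j :: Y) -> Prop) :
  (forall d, P d 0) ->
  (forall d f f', P d f -> P d f' -> P d (f + f')) ->
  (forall d f, P d f -> P d (- f)) ->
  (forall k m d (g : hom (del k X) Y) (e : nth true X k = j), (k < size X)%N ->
     homog d g ->
     P (d + m%:Z *+ 2 + pdeg X k)
       (hcast erefl (congr1 (cons^~ Y) e)
         (whisk (nth true X k) g ∘ dotpowl (nth true X k) m (del k X) ∘ pull X k))) ->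
  forall d f, psum d f -> P d f.
Proof.
move=> P0 PD PN Pgen d f fp.
suff H Z (f' : hom X Z) : psum d f' -> forall e : Z = j :: Y, P d (hcast erefl e f').
  by have := H _ _ fp erefl.
move=> {f fp}; elim=> {Z d f'}
  [k m d Z g kX gd|Z d|Z d f f' _ IH _ IH'|Z d f _ IH] e.
- have [e1 e2] : nth true X k = j /\ Z = Y by case: e.
  subst Z; rewrite (eq_irrelevance e (congr1 (cons^~ Y) e1)).
  exact: Pgen.
- by rewrite hcast0.
- by rewrite hcastD; apply: PD.
- by rewrite hcastN; apply: PN.
Qed.

(** In [homog_psum] dots only raise the degree, so degree M is reached by undotted pulls alone. The
    bound raised by 1 excludes all positions but k0, whose generator gives the generator here. *)
Lemma lowdeg_cons X j Y M (k0 : nat) :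
  (forall k, (k < size X)%N -> nth true X k = j ->
     lowdeg (del k X) Y (M - pdeg X k) /\
     (k != k0 -> lowdeg (del k X) Y (M - pdeg X k + 1))) ->
  lowdeg X (j :: Y) M.
Proof.
move=> H; split=> [d f|].
  move/homog_psum => fp; move: fp; move: d f.
  apply: (@psum_ind_to X j Y (fun d f => (d < M)%R -> f = 0)) => //.
  - by move=> d f f' IH IH' dM; rewrite IH // IH' // addr0.
  - by move=> d f IH dM; rewrite IH // oppr0.
  move=> k m d g e kX gd dM.
  have [[g0 _] _] := H k kX e.
  by rewrite (g0 _ _ gd) ?whisk0 ?hcomp0l ?hcast0 //; lia.
have [/andP[k0X /eqP e0]|k0X] :=
    (* If k0 is not a position of the letter j, no summand reaches degree M and the generator is
       0. *)
    boolP ((k0 < size X)%N && (nth true X k0 == j)); last first.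
  exists 0 => [|f]; first exact: homog_0.
  move/homog_psum => fp.
  suff -> : f = 0 by exists 0; rewrite mulr0z.
  move: (erefl M) fp; move: {1 3}M f => M' f MM' fp; move: M' f fp MM'.
  apply: (@psum_ind_to X j Y (fun d f => d = M -> f = 0)) => //.
  - by move=> d f f' IH IH' dM; rewrite IH // IH' // addr0.
  - by move=> d f IH dM; rewrite IH // oppr0.
  move=> k m d g e kX gd dM.
  have kk0 : k != k0 by apply: contraNneq k0X => <-; rewrite kX e eqxx.
  have [_ /(_ kk0)[g0 _]] := H k kX e.
  by rewrite (g0 _ _ gd) ?whisk0 ?hcomp0l ?hcast0 //; lia.
case: _ / e0 in H *.
have [[g0 [u ud uP]] _] := H k0 k0X erefl.
exists (whisk (nth true X k0) u ∘ pull X k0) => [|f].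
  by apply: homog_eq (homog_comp (homog_whisk _ ud) (homog_pull X k0)); rewrite subrK.
move/homog_psum => fp.
move: (erefl M) fp; move: {1 3}M f => M' f MM' fp; move: M' f fp MM'.
apply: (@psum_ind_to X _ Y (fun d f => d = M -> exists z : int, f = _ *~ z)).
- by exists 0; rewrite mulr0z.
- move=> d f f' IH IH' dM; have [z ->] := IH dM; have [z' ->] := IH' dM.
  by exists (z + z'); rewrite mulrzDr.
- move=> d f IH dM; have [z ->] := IH dM.
  by exists (- z); rewrite mulrNz.
move=> k m d g e kX gd dM.
have [kk0|kk0] := eqVneq k k0; last first.
  have [_ /(_ kk0)[h0 _]] := H k kX e.
  exists 0; rewrite mulr0z (h0 _ _ gd) ?whisk0 ?hcomp0l ?hcast0 //; lia.
case: _ / kk0 in k0X H u g0 ud uP e *.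
rewrite hcast_id; case: m dM => [|m] dM; last first.
  exists 0; rewrite mulr0z (g0 _ _ gd) ?whisk0 ?hcomp0l //; lia.
have [|z ->] := uP g; first by apply: homog_eq gd; lia.
exists z; rewrite dotpowl0 hcomp1r -hcompMzl; congr (_ ∘ _).
suff wM (n : nat) : whisk (nth true X k) (u *+ n) = whisk (nth true X k) u *+ n.
  by case: z => n; rewrite /intmul ?whiskN wM.
by elim: n => [|n IH]; rewrite ?mulr0n ?whisk0 // !mulrS whiskD IH.
Qed.

Lemma gen_src X Y d (f : hom X Y) : gen d f -> X != [::].
Proof. by case. Qed.

Lemma lowdeg_nil : lowdeg [::] [::] 0.
Proof.
have H X Y d (f : hom X Y) : dspan d f ->
  match X, Y return hom X Y -> Prop with
  | [::], [::] => fun f => exists2 z : int, f = 1_[::] *~ z & d != 0 -> z = 0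
  | _, _ => fun=> True
  end f.
  elim=> {X Y d f}
    [[|//]|[|//] Y [|//] d d' f g _ _ /gen_src //|[|//] [|//] d
    |[|//] [|//] d f f' _ [z -> dz] _ [z' -> dz']|[|//] [|//] d f _ [z -> dz]].
  - by exists 1.
  - by exists 0; rewrite ?mulr0z.
  - by exists (z + z') => [|d0]; [rewrite mulrzDr|rewrite dz // dz' // addr0].
  - by exists (- z) => [|d0]; [rewrite mulrNz|rewrite dz // oppr0].
split=> [d f /dspan_homog /H[z -> dz] d0|].
  by rewrite dz ?mulr0z //; lia.
exists 1_[::]; first exact: homog_id.
by move=> f /dspan_homog /H[z -> _]; exists z.
Qed.

(** * Degree bounds for words made of two or three blocks *)

Lemma nth_block p i Z k : (k < p)%N -> nth true (nseq p i ++ Z) k = i.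
Proof. by move=> kp; rewrite nth_cat size_nseq kp nth_nseq kp. Qed.

Lemma del_block p i Z k : (k < p)%N -> del k (nseq p i ++ Z) = nseq p.-1 i ++ Z.
Proof.
by elim: p k => // [] [|p] IH [|k] //= kp; rewrite -/(nseq _ _) IH.
Qed.

Lemma pdeg_block p i Z k : (k < p)%N -> pdeg (nseq p i ++ Z) k = - (k%:Z *+ 2).
Proof.
elim: p k => // p IH [|k] //= kp; rewrite -/(nseq _ _) nth_block // IH //.
by rewrite /cartan eqxx; lia.
Qed.

Lemma nth_skip p i Z k : nth true (nseq p i ++ Z) (p + k) = nth true Z k.
Proof. by elim: p. Qed.

Lemma del_skip p i Z k : del (p + k) (nseq p i ++ Z) = nseq p i ++ del k Z.
Proof. by elim: p => //= p ->. Qed.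

Lemma pdeg_skip p i Z k :
  pdeg (nseq p i ++ Z) (p + k) = pdeg Z k - cartan i (nth true Z k) * p%:Z.
Proof.
elim: p => [|p IH]; first by rewrite mulr0 subr0.
by rewrite /= -/(nseq _ _) IH nth_skip; lia.
Qed.

(* b tells which of the two blocks of i may contribute in degree M. *)
Lemma lowdeg_outer (b : bool) i j p q u Y M : i != j ->
  ((0 < p)%N -> lowdeg (nseq p.-1 i ++ nseq q j ++ nseq u i) Y
                       (M + p.-1%:Z *+ 2 + b%:Z)) ->
  ((0 < u)%N -> lowdeg (nseq p i ++ nseq q j ++ nseq u.-1 i) Y
                       (M + p%:Z *+ 2 - q%:Z + u.-1%:Z *+ 2 + (~~ b)%:Z)) ->
  lowdeg (nseq p i ++ nseq q j ++ nseq u i) (i :: Y) M.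
Proof.
move=> ij L R.
apply: (@lowdeg_cons _ _ _ _ (if b then (p + (q + u.-1))%N else p.-1)) => k.
rewrite !size_cat !size_nseq => kX.
have [kp|pk] := ltnP k p.
  rewrite (del_block _ _ kp) (pdeg_block _ _ kp) => _.
  have {}L := L (leq_ltn_trans (leq0n k) kp).
  split; first by apply: lowdeg_le L; case: (b); lia.
  by move=> kk0; apply: lowdeg_le L; case: (b) kk0; lia.
rewrite -(subnKC pk) in kX *; move: (k - p)%N kX => e kX.
rewrite nth_skip del_skip pdeg_skip.
have [eq|qe] := ltnP e q.
  by rewrite nth_block // => ji; rewrite ji eqxx in ij.
rewrite -(subnKC qe) in kX *; move: (e - q)%N kX => {qe} {}e kX.
have eu : (e < u)%N by lia.
rewrite !nth_skip del_skip pdeg_skip (nth_nseq true u i e) eu => _.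
have := pdeg_block i [::] eu; have := del_block i [::] eu; rewrite !cats0 => -> ->.
have {}R := R (leq_ltn_trans (leq0n e) eu).
rewrite /cartan eqxx eq_sym (negbTE ij); split.
  by apply: lowdeg_le R; case: (b); lia.
by move=> kk0; apply: lowdeg_le R; case: (b) kk0; lia.
Qed.

Lemma lowdeg_inner i j p q u Y M : i != j ->
  ((0 < q)%N -> lowdeg (nseq p i ++ nseq q.-1 j ++ nseq u i) Y
                       (M - p%:Z + q.-1%:Z *+ 2)) ->
  lowdeg (nseq p i ++ nseq q j ++ nseq u i) (j :: Y) M.
Proof.
move=> ij L; apply: (@lowdeg_cons _ _ _ _ (p + q.-1)%N) => k.
rewrite !size_cat !size_nseq => kX.
have [kp|pk] := ltnP k p.
  by rewrite nth_block // => ji; rewrite ji eqxx in ij.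
rewrite -(subnKC pk) in kX *; move: (k - p)%N kX => e kX.
rewrite nth_skip del_skip pdeg_skip.
have [eq|qe] := ltnP e q; last first.
  rewrite -(subnKC qe) nth_skip nth_nseq; case: ifP => [_ ji|]; last by lia.
  by rewrite ji eqxx in ij.
rewrite nth_block // (del_block _ _ eq) (pdeg_block _ _ eq) => _.
have {}L := L (leq_ltn_trans (leq0n e) eq).
rewrite /cartan (negbTE ij); split.
  by apply: lowdeg_le L; lia.
by move=> kk0; apply: lowdeg_le L; lia.
Qed.

Lemma lowdeg_one i n : lowdeg (nseq n i) (nseq n i) (- (n%:Z * (n%:Z - 1))).
Proof.
suff H : lowdeg (nseq 0 (~~ i) ++ nseq n i ++ nseq 0 (~~ i)) (nseq n i)
                (- (n%:Z * (n%:Z - 1))) by rewrite cats0 in H.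
have ii : ~~ i != i by case: i.
elim: n => [|n IH]; first exact: lowdeg_nil.
apply: (lowdeg_inner ii) => _; apply: lowdeg_le IH; lia.
Qed.

(** The bound is the degree of a diagram in which u strands i cross n strands j and the strands of
    each colour cross pairwise. As long as u > 0, only a pull from the right block reaches it. *)
Lemma lowdeg_split0 i j p u n : i != j ->
  lowdeg (nseq p i ++ nseq n j ++ nseq u i) (nseq (p + u) i ++ nseq n j)
    (u%:Z * n%:Z - (p%:Z + u%:Z) * (p%:Z + u%:Z - 1) - n%:Z * (n%:Z - 1)).
Proof.
move=> ij; move Nu : (p + u)%N => N.
elim: N p u Nu => [|N IH] p u Nu.
  have [-> ->] : p = 0%N /\ u = 0%N by lia.
  by rewrite cats0; apply: lowdeg_le (lowdeg_one j n); lia.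
apply: (@lowdeg_outer (0 < u)%N) => // u0.
  have Nu' : (p.-1 + u)%N = N by lia.
  by apply: lowdeg_le (IH _ _ Nu'); case: p u0 Nu Nu' => // p _ _ _; case: u => [|u] /=; lia.
have Nu' : (p + u.-1)%N = N by lia.
by apply: lowdeg_le (IH _ _ Nu'); case: u u0 Nu Nu' => // u _ _ _ /=; lia.
Qed.

Lemma lowdeg_split i j p u m n : i != j ->
  lowdeg (nseq p i ++ nseq (m + n) j ++ nseq u i)
         (nseq m j ++ nseq (p + u) i ++ nseq n j)
    (p%:Z * m%:Z + u%:Z * n%:Z - (p%:Z + u%:Z) * (p%:Z + u%:Z - 1)
     - (m%:Z + n%:Z) * (m%:Z + n%:Z - 1)).
Proof.
move=> ij; elim: m => [|m IH].
  by apply: lowdeg_le (lowdeg_split0 p u n ij); lia.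
by apply: (lowdeg_inner ij) => _; apply: lowdeg_le IH; rewrite /=; lia.
Qed.

(** The degree of the cheapest diagram i^p j^q i^u to i^n j^q i^m: |p - n| strands i change sides
    across j^q, and all pairs of equal colour cross, except a strand i staying on the left with one
    staying on the right. *)
Definition lowdeg_bound (p q u n : nat) : int :=
  (if (n <= p)%N then (p%:Z - n%:Z) * q%:Z + n%:Z * u%:Z *+ 2
   else (n%:Z - p%:Z) * q%:Z + p%:Z * (u%:Z - n%:Z + p%:Z) *+ 2)
  - (p%:Z + u%:Z) * (p%:Z + u%:Z - 1) - q%:Z * (q%:Z - 1).

(** Exchanging one more pair of strands i across j^q would cost 2q and save less, since p + u <=
    q. *)
Lemma lowdeg_same i j p q u n m : i != j -> (p + u = n + m)%N -> (p + u <= q)%N ->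
  lowdeg (nseq p i ++ nseq q j ++ nseq u i) (nseq n i ++ nseq q j ++ nseq m i)
         (lowdeg_bound p q u n).
Proof.
move=> ij; elim: n p u => [|n IH] p u pu puq.
  have := lowdeg_split p u q 0 ij; rewrite addn0 cats0 pu.
  by apply: lowdeg_le; rewrite /lowdeg_bound leq0n; lia.
(* The target block now has n + 1 strands, so [p <= n] says that the left block is too short and the
   right one must contribute. *)
apply: (@lowdeg_outer (p <= n)%N) => // pos.
  have pu' : (p.-1 + u = n + m)%N by lia.
  have le' : (p.-1 + u <= q)%N by lia.
  apply: lowdeg_le (IH _ _ pu' le'); case: p pos pu puq {pu' le'} => // p _ pu puq.
  by rewrite /lowdeg_bound /=; do ![case: ltnP => ?|case: leqP => ?]; nia.
have pu' : (p + u.-1 = n + m)%N by lia.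
have le' : (p + u.-1 <= q)%N by lia.
apply: lowdeg_le (IH _ _ pu' le'); case: u pos pu puq {pu' le'} => // u _ pu puq.
by rewrite /lowdeg_bound /=; do ![case: ltnP => ?|case: leqP => ?]; nia.
Qed.

(** * Additive structure of the Karoubi envelope *)

HB.instance Definition _ X Y := gen_eqMixin (khom X Y).
HB.instance Definition _ X Y := gen_choiceMixin (khom X Y).

Lemma khomP X Y (f g : khom X Y) : (forall k l, f k l = g k l) -> f = g.
Proof.
move=> fg; have {fg} : kmor f = kmor g by apply/uhomP.
case: f g => f fP [g gP] /= fg; case: _ / fg in gP *.
by congr KHom; apply: Prop_irrelevance.
Qed.

Definition uadd X Y (f g : uhom X Y) : uhom X Y :=
  UHom (fun k l => homog_add (uhomog f k l) (uhomog g k l)).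

Definition uopp X Y (f : uhom X Y) : uhom X Y :=
  UHom (fun k l => homog_opp (uhomog f k l)).

Lemma ucompDl X Y Z (f f' : uhom Y Z) (g : uhom X Y) :
  ucomp (uadd f f') g = uadd (ucomp f g) (ucomp f' g).
Proof.
apply/uhomP => k l; rewrite /= /ucomp_ent -big_split /=.
by apply: eq_bigr => m _; rewrite hcompDl.
Qed.

Lemma ucompDr X Y Z (f : uhom Y Z) (g g' : uhom X Y) :
  ucomp f (uadd g g') = uadd (ucomp f g) (ucomp f g').
Proof.
apply/uhomP => k l; rewrite /= /ucomp_ent -big_split /=.
by apply: eq_bigr => m _; rewrite hcompDr.
Qed.

Lemma ucompNl X Y Z (f : uhom Y Z) (g : uhom X Y) :
  ucomp (uopp f) g = uopp (ucomp f g).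
Proof.
apply/uhomP => k l; rewrite /= /ucomp_ent -sumrN.
by apply: eq_bigr => m _; rewrite hcompNl.
Qed.

Lemma ucompNr X Y Z (f : uhom Y Z) (g : uhom X Y) :
  ucomp f (uopp g) = uopp (ucomp f g).
Proof.
apply/uhomP => k l; rewrite /= /ucomp_ent -sumrN.
by apply: eq_bigr => m _; rewrite hcompNr.
Qed.

Lemma ucomp0l X Y Z (g : uhom X Y) : ucomp (uzero_hom Y Z) g = uzero_hom X Z.
Proof. by apply/uhomP => k l; rewrite /= /ucomp_ent big1 // => m _; rewrite hcomp0l. Qed.

Lemma ucomp0r X Y Z (f : uhom Y Z) : ucomp f (uzero_hom X Y) = uzero_hom X Z.
Proof. by apply/uhomP => k l; rewrite /= /ucomp_ent big1 // => m _; rewrite hcomp0r. Qed.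

HB.instance Definition _ X Y := gen_eqMixin (uhom X Y).
HB.instance Definition _ X Y := gen_choiceMixin (uhom X Y).

Lemma uaddA X Y : associative (@uadd X Y).
Proof. by move=> f g h; apply/uhomP => k l /=; rewrite addrA. Qed.

Lemma uaddC X Y : commutative (@uadd X Y).
Proof. by move=> f g; apply/uhomP => k l /=; rewrite addrC. Qed.

Lemma uadd0 X Y : left_id (uzero_hom X Y) (@uadd X Y).
Proof. by move=> f; apply/uhomP => k l /=; rewrite add0r. Qed.

Lemma uaddN X Y : left_inverse (uzero_hom X Y) (@uopp X Y) (@uadd X Y).
Proof. by move=> f; apply/uhomP => k l /=; rewrite addNr. Qed.

HB.instance Definition _ X Y :=
  GRing.isZmodule.Build (uhom X Y) (@uaddA X Y) (@uaddC X Y) (@uadd0 X Y)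
    (@uaddN X Y).

Lemma usum_ent_seq (I : Type) (r : seq I) X Y (F : I -> uhom X Y) k l :
  (\sum_(i <- r) F i) k l = \sum_(i <- r) F i k l.
Proof. by elim/big_rec2: _ => [|i f f' _ <-]. Qed.

Section KHomZmod.
Variables X Y : kobj.

Lemma kadd_subproof (f g : khom X Y) :
  ucomp (kidem Y) (ucomp (uadd f g) (kidem X)) = uadd f g.
Proof. by rewrite ucompDl ucompDr !kmorP. Qed.

Lemma kopp_subproof (f : khom X Y) :
  ucomp (kidem Y) (ucomp (uopp f) (kidem X)) = uopp f.
Proof. by rewrite ucompNl ucompNr !kmorP. Qed.

Lemma kzero_hom_subproof :
  ucomp (kidem Y) (ucomp (uzero_hom _ _) (kidem X)) = uzero_hom (kbase X) (kbase Y).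
Proof. by rewrite ucomp0l ucomp0r. Qed.

Definition kadd (f g : khom X Y) : khom X Y := KHom (kadd_subproof f g).
Definition kopp (f : khom X Y) : khom X Y := KHom (kopp_subproof f).
Definition kzero_hom : khom X Y := KHom kzero_hom_subproof.

Lemma kaddA : associative kadd.
Proof. by move=> f g h; apply: khomP => k l /=; rewrite addrA. Qed.
Lemma kaddC : commutative kadd.
Proof. by move=> f g; apply: khomP => k l /=; rewrite addrC. Qed.
Lemma kadd0 : left_id kzero_hom kadd.
Proof. by move=> f; apply: khomP => k l /=; rewrite add0r. Qed.
Lemma kaddN : left_inverse kzero_hom kopp kadd.
Proof. by move=> f; apply: khomP => k l /=; rewrite addNr. Qed.

End KHomZmod.

HB.instance Definition _ X Y :=
  GRing.isZmodule.Build (khom X Y) (@kaddA X Y) (@kaddC X Y) (@kadd0 X Y)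
    (@kaddN X Y).

Lemma kaddE X Y (f g : khom X Y) k l : (f + g) k l = f k l + g k l.
Proof. by []. Qed.

Lemma kmulzE X Y (f : khom X Y) (z : int) k l : (f *~ z) k l = f k l *~ z.
Proof.
have H n : (f *+ n) k l = f k l *+ n.
  by elim: n => [|n IH]; rewrite ?mulr0n // !mulrS kaddE IH.
by case: z => n; rewrite /intmul -?H.
Qed.

Lemma kcompA W X Y Z (f : khom Y Z) (g : khom X Y) (h : khom W X) :
  kcomp f (kcomp g h) = kcomp (kcomp f g) h.
Proof.
by have /uhomP e := ucompA f g h; apply: khomP => k l; apply: e.
Qed.

Lemma kcomp1l X Y (f : khom X Y) : kcomp (kid Y) f = f.
Proof.
suff e : ucomp (kidem Y) f = f by apply: khomP => k l; rewrite /= -[in RHS]e.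
by rewrite -{2}(kmorP f) -{1}(kmorP f) ucompA kidemP.
Qed.

Lemma kcomp1r X Y (f : khom X Y) : kcomp f (kid X) = f.
Proof.
suff e : ucomp f (kidem X) = f by apply: khomP => k l; rewrite /= -[in RHS]e.
by rewrite -{2}(kmorP f) -{1}(kmorP f) -!ucompA kidemP.
Qed.

Lemma kcompDl X Y Z (f f' : khom Y Z) (g : khom X Y) :
  kcomp (f + f') g = kcomp f g + kcomp f' g.
Proof.
by have /uhomP e := ucompDl f f' g; apply: khomP => k l; apply: e.
Qed.

Lemma kcompDr X Y Z (f : khom Y Z) (g g' : khom X Y) :
  kcomp f (g + g') = kcomp f g + kcomp f g'.
Proof.
by have /uhomP e := ucompDr f g g'; apply: khomP => k l; apply: e.
Qed.

Lemma kcomp0l X Y Z (g : khom X Y) : kcomp (0 : khom Y Z) g = 0.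
Proof. by apply: (@addrI _ (kcomp 0 g)); rewrite -kcompDl !addr0. Qed.

Lemma kcomp0r X Y Z (f : khom Y Z) : kcomp f (0 : khom X Y) = 0.
Proof. by apply: (@addrI _ (kcomp f 0)); rewrite -kcompDr !addr0. Qed.

Lemma kcompNl X Y Z (f : khom Y Z) (g : khom X Y) : kcomp (- f) g = - kcomp f g.
Proof. by apply: (@addIr _ (kcomp f g)); rewrite -kcompDl !addNr kcomp0l. Qed.

Lemma kcompNr X Y Z (f : khom Y Z) (g : khom X Y) : kcomp f (- g) = - kcomp f g.
Proof. by apply: (@addIr _ (kcomp f g)); rewrite -kcompDr !addNr kcomp0r. Qed.

Lemma kcompMzl X Y Z (f : khom Y Z) (g : khom X Y) (z : int) :
  kcomp (f *~ z) g = kcomp f g *~ z.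
Proof.
have H n : kcomp (f *+ n) g = kcomp f g *+ n.
  by elim: n => [|n IH]; rewrite ?mulr0n ?kcomp0l // !mulrS kcompDl IH.
by case: z => n; rewrite /intmul ?kcompNl H.
Qed.

Lemma kcompMzr X Y Z (f : khom Y Z) (g : khom X Y) (z : int) :
  kcomp f (g *~ z) = kcomp f g *~ z.
Proof.
have H n : kcomp f (g *+ n) = kcomp f g *+ n.
  by elim: n => [|n IH]; rewrite ?mulr0n ?kcomp0r // !mulrS kcompDr IH.
by case: z => n; rewrite /intmul ?kcompNr H.
Qed.

Lemma kcomp_suml (I : Type) (r : seq I) X Y Z (F : I -> khom Y Z) (g : khom X Y) :
  kcomp (\sum_(i <- r) F i) g = \sum_(i <- r) kcomp (F i) g.
Proof. by elim/big_rec2: _ => [|i f f' _ <-]; rewrite ?kcomp0l ?kcompDl. Qed.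

Lemma kcomp_sumr (I : Type) (r : seq I) X Y Z (f : khom Y Z) (F : I -> khom X Y) :
  kcomp f (\sum_(i <- r) F i) = \sum_(i <- r) kcomp f (F i).
Proof. by elim/big_rec2: _ => [|i f' g _ <-]; rewrite ?kcomp0r ?kcompDr. Qed.

Lemma kiso_refl X : kiso X X.
Proof. by exists (kid X), (kid X); rewrite kcomp1l. Qed.

Lemma kiso_sym X Y : kiso X Y -> kiso Y X.
Proof. by case=> f [g [gf fg]]; exists g, f. Qed.

Lemma kiso_trans X Y Z : kiso X Y -> kiso Y Z -> kiso X Z.
Proof.
case=> f [g [gf fg]] [f' [g' [gf' fg']]]; exists (kcomp f' f), (kcomp g g').
by rewrite kcompA -(kcompA g) gf' kcomp1r gf kcompA -(kcompA f') fg kcomp1r.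
Qed.

Lemma kiso0P X : kiso X kzero <-> kid X = 0.
Proof.
split=> [[f [g [<- _]]]|X0].
  have -> : f = 0 by apply: khomP => k [].
  exact: kcomp0r.
exists 0, 0; rewrite !kcomp0r X0; split => //.
by apply: khomP => -[].
Qed.

(** * Biproducts *)

Definition biproduct X Y Z (iY : khom Y X) (pY : khom X Y) (iZ : khom Z X)
    (pZ : khom X Z) : Prop :=
  [/\ kcomp pY iY = kid Y, kcomp pZ iZ = kid Z, kcomp pY iZ = 0,
      kcomp pZ iY = 0 & kcomp iY pY + kcomp iZ pZ = kid X].

Section KSum.
Variables Y Z : kobj.

Definition uinl_ent (k : uidx (kbase Y)) (l : uidx (usum_obj (kbase Y) (kbase Z))) :
    hom (uword k) (uword l) :=
  match l with inl l => kidem Y k l | inr _ => 0 end.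
Definition uinr_ent (k : uidx (kbase Z)) (l : uidx (usum_obj (kbase Y) (kbase Z))) :
    hom (uword k) (uword l) :=
  match l with inl _ => 0 | inr l => kidem Z k l end.
Definition ufst_ent (k : uidx (usum_obj (kbase Y) (kbase Z))) (l : uidx (kbase Y)) :
    hom (uword k) (uword l) :=
  match k with inl k => kidem Y k l | inr _ => 0 end.
Definition usnd_ent (k : uidx (usum_obj (kbase Y) (kbase Z))) (l : uidx (kbase Z)) :
    hom (uword k) (uword l) :=
  match k with inl _ => 0 | inr k => kidem Z k l end.

Lemma uinl_homog k l : homog (ushift k - ushift l) (uinl_ent k l).
Proof. by case: l => l; [exact: (uhomog (kidem Y))|exact: homog_0]. Qed.
Lemma uinr_homog k l : homog (ushift k - ushift l) (uinr_ent k l).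
Proof. by case: l => l; [exact: homog_0|exact: (uhomog (kidem Z))]. Qed.
Lemma ufst_homog k l : homog (ushift k - ushift l) (ufst_ent k l).
Proof. by case: k => k; [exact: (uhomog (kidem Y))|exact: homog_0]. Qed.
Lemma usnd_homog k l : homog (ushift k - ushift l) (usnd_ent k l).
Proof. by case: k => k; [exact: homog_0|exact: (uhomog (kidem Z))]. Qed.

Definition uinl := UHom uinl_homog.
Definition uinr := UHom uinr_homog.
Definition ufst := UHom ufst_homog.
Definition usnd := UHom usnd_homog.

Lemma kidemE (X : kobj) k l :
  \sum_(m : uidx (kbase X)) (kidem X m l ∘ kidem X k m) = kidem X k l.
Proof. by have /uhomP/(_ k l) := kidemP X. Qed.

Lemma uinl_proj : ucomp ufst uinl = kidem Y.
Proof.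
apply/uhomP => k l; rewrite /= /ucomp_ent big_sumType /= kidemE.
by rewrite big1 ?addr0 // => m _; rewrite hcomp0l.
Qed.

Lemma uinr_proj : ucomp usnd uinr = kidem Z.
Proof.
apply/uhomP => k l; rewrite /= /ucomp_ent big_sumType /= kidemE.
by rewrite big1 ?add0r // => m _; rewrite hcomp0l.
Qed.

Lemma ufst_inr : ucomp ufst uinr = uzero_hom _ _.
Proof.
apply/uhomP => k l; rewrite /= /ucomp_ent big_sumType /=.
by rewrite !big1 ?addr0 // => m _; rewrite ?hcomp0l ?hcomp0r.
Qed.

Lemma usnd_inl : ucomp usnd uinl = uzero_hom _ _.
Proof.
apply/uhomP => k l; rewrite /= /ucomp_ent big_sumType /=.
by rewrite !big1 ?addr0 // => m _; rewrite ?hcomp0l ?hcomp0r.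
Qed.

Lemma uinl_fst_inr_snd :
  uadd (ucomp uinl ufst) (ucomp uinr usnd) = usum (kidem Y) (kidem Z).
Proof.
apply/uhomP => k l; rewrite /= /ucomp_ent.
case: k l => k [] l /=.
- by rewrite kidemE big1 ?addr0 // => m _; rewrite hcomp0l.
- by rewrite !big1 ?addr0 // => m _; rewrite ?hcomp0l ?hcomp0r.
- by rewrite !big1 ?addr0 // => m _; rewrite ?hcomp0l ?hcomp0r.
- by rewrite kidemE big1 ?add0r // => m _; rewrite hcomp0l.
Qed.

Lemma uinl_idem : ucomp (kidem (ksum Y Z)) (ucomp uinl (kidem Y)) = uinl.
Proof.
rewrite /= -uinl_fst_inr_snd ucompDl -!ucompA (ucompA ufst) (ucompA usnd).
rewrite uinl_proj usnd_inl ucomp0l ucomp0r kidemP.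
apply/uhomP => k l; rewrite /= addr0 /ucomp_ent /=.
by case: l => l; rewrite ?kidemE // big1 // => m _; rewrite hcomp0l.
Qed.

Lemma uinr_idem : ucomp (kidem (ksum Y Z)) (ucomp uinr (kidem Z)) = uinr.
Proof.
rewrite /= -uinl_fst_inr_snd ucompDl -!ucompA (ucompA ufst) (ucompA usnd).
rewrite ufst_inr uinr_proj ucomp0l ucomp0r kidemP.
apply/uhomP => k l; rewrite /= add0r /ucomp_ent /=.
by case: l => l; rewrite ?kidemE // big1 // => m _; rewrite hcomp0l.
Qed.

Lemma ufst_idem : ucomp (kidem Y) (ucomp ufst (kidem (ksum Y Z))) = ufst.
Proof.
rewrite /= -uinl_fst_inr_snd ucompDr !ucompA uinl_proj ufst_inr ucomp0l.
rewrite ucompDr ucomp0r ucompA kidemP.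
apply/uhomP => k l; rewrite /= addr0 /ucomp_ent /=.
by case: k => k; rewrite ?kidemE // big1 // => m _; rewrite hcomp0r.
Qed.

Lemma usnd_idem : ucomp (kidem Z) (ucomp usnd (kidem (ksum Y Z))) = usnd.
Proof.
rewrite /= -uinl_fst_inr_snd ucompDr !ucompA usnd_inl uinr_proj ucomp0l.
rewrite ucompDr ucomp0r ucompA kidemP.
apply/uhomP => k l; rewrite /= add0r /ucomp_ent /=.
by case: k => k; rewrite ?kidemE // big1 // => m _; rewrite hcomp0r.
Qed.

Lemma ksum_biproduct : exists iY pY iZ pZ, @biproduct (ksum Y Z) Y Z iY pY iZ pZ.
Proof.
exists (KHom uinl_idem), (KHom ufst_idem), (KHom uinr_idem), (KHom usnd_idem).
split; apply: khomP => k l.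
- by have /uhomP := uinl_proj; apply.
- by have /uhomP := uinr_proj; apply.
- by have /uhomP := ufst_inr; apply.
- by have /uhomP := usnd_inl; apply.
by have /uhomP := uinl_fst_inr_snd; apply.
Qed.
End KSum.

Lemma kcomp_mid U V W W' V' (i : khom V U) (q : khom W V) (j : khom W' W)
    (p : khom V' W') :
  kcomp (kcomp i q) (kcomp j p) = kcomp i (kcomp (kcomp q j) p).
Proof. by rewrite !kcompA. Qed.

Lemma biproduct_iso X Y Z iY pY iZ pZ :
  @biproduct X Y Z iY pY iZ pZ -> kiso X (ksum Y Z).
Proof.
have [jY [qY [jZ [qZ [q1 q2 q3 q4 q5]]]]] := ksum_biproduct Y Z.
case=> p1 p2 p3 p4 p5.
exists (kcomp jY pY + kcomp jZ pZ), (kcomp iY qY + kcomp iZ qZ); split.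
  rewrite kcompDl !kcompDr !kcomp_mid q1 q2 q3 q4.
  by rewrite !kcomp0l !kcomp0r !kcomp1l addr0 add0r.
rewrite kcompDl !kcompDr !kcomp_mid p1 p2 p3 p4.
by rewrite !kcomp0l !kcomp0r !kcomp1l addr0 add0r.
Qed.

Lemma kiso_biproduct X Y Z :
  kiso X (ksum Y Z) -> exists iY pY iZ pZ, @biproduct X Y Z iY pY iZ pZ.
Proof.
have [jY [qY [jZ [qZ [q1 q2 q3 q4 q5]]]]] := ksum_biproduct Y Z.
case=> f [g [gf fg]].
exists (kcomp g jY), (kcomp qY f), (kcomp g jZ), (kcomp qZ f).
have E U V (q : khom (ksum Y Z) U) (j : khom V (ksum Y Z)) :
    kcomp (kcomp q f) (kcomp g j) = kcomp q j.
  by rewrite kcomp_mid fg kcomp1l.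
split; rewrite ?E //.
by rewrite !kcomp_mid -kcompDr -kcompDl q5 kcomp1l.
Qed.

Lemma ksum_kiso Y Z Y' Z' : kiso Y Y' -> kiso Z Z' -> kiso (ksum Y Z) (ksum Y' Z').
Proof.
case=> f [g [gf fg]] [f' [g' [gf' fg']]].
have [jY [qY [jZ [qZ [q1 q2 q3 q4 q5]]]]] := ksum_biproduct Y Z.
apply: (@biproduct_iso _ _ _ (kcomp jY g) (kcomp f qY) (kcomp jZ g') (kcomp f' qZ)).
split; rewrite ?kcomp_mid ?q1 ?q2 ?q3 ?q4 ?kcomp0l ?kcomp0r ?kcomp1l //.
by rewrite gf gf' !kcomp1l.
Qed.

Lemma ksum0 X Z : kiso Z kzero -> kiso (ksum X Z) X.
Proof.
move=> /kiso0P Z0.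
have [jY [qY [jZ [qZ [q1 q2 q3 q4 q5]]]]] := ksum_biproduct X Z.
exists qY, jY; split => //; rewrite -q5 (_ : jZ = 0) ?kcomp0l ?addr0 //.
by rewrite -[jZ]kcomp1r Z0 kcomp0r.
Qed.

(** * Homs between the objects of B *)

Definition lword (p : label) : word :=
  (nseq (la p) (lnode p) ++ nseq (lb p) (~~ lnode p)) ++ nseq (lc p) (lnode p).

Lemma lwordE p : lword p = bword (lnode p) (la p) (lb p) (lc p).
Proof. by rewrite /bword catA. Qed.

Definition lidem (p : label) : hom (lword p) (lword p) :=
  dividem (lnode p) (la p) ⊗ dividem (~~ lnode p) (lb p) ⊗ dividem (lnode p) (lc p).

Definition llong (p : label) : hom (lword p) (lword p) :=
  longcross (lnode p) (la p) ⊗ longcross (~~ lnode p) (lb p)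
    ⊗ longcross (lnode p) (lc p).

Definition ldelta (p : label) : hom (lword p) (lword p) :=
  delta (lnode p) (la p) ⊗ delta (~~ lnode p) (lb p) ⊗ delta (lnode p) (lc p).

Definition half (a : nat) : int := ((a * a.-1) %/ 2)%N%:Z.

Definition lhalf (p : label) : int := half (la p) + half (lb p) + half (lc p).

Lemma ldeg_half a : ldeg a = - (half a *+ 2).
Proof.
suff e : ((a * a.-1) %/ 2 * 2 = a * a.-1)%N by rewrite /ldeg /half; lia.
by rewrite divnK // dvdn2 oddM; case: a => //= a; rewrite andNb.
Qed.

Lemma half_double a : half a *+ 2 = a%:Z * (a%:Z - 1).
Proof.
have := ldeg_half a; rewrite /ldeg => e.
suff : ((a * a.-1)%N)%:Z = a%:Z * (a%:Z - 1) by lia.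
by case: a {e} => // a; rewrite /= PoszM; lia.
Qed.

Lemma homog_llong p : homog (- (lhalf p *+ 2)) (llong p).
Proof.
have := homog_tens (homog_tens (homog_longcross (lnode p) (la p))
          (homog_longcross (~~ lnode p) (lb p))) (homog_longcross (lnode p) (lc p)).
by apply: homog_eq; rewrite !ldeg_half /lhalf; lia.
Qed.

Lemma homog_ldelta p : homog (lhalf p *+ 2) (ldelta p).
Proof.
have := homog_tens (homog_tens (homog_delta (lnode p) (la p))
          (homog_delta (~~ lnode p) (lb p))) (homog_delta (lnode p) (lc p)).
by apply: homog_eq; rewrite !ldeg_half /lhalf; lia.
Qed.

Lemma ldelta_llong p : ldelta p ∘ llong p = lidem p.
Proof. by rewrite /ldelta /llong !hinterchange. Qed.

Lemma llong_lidem p : llong p ∘ lidem p = llong p.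
Proof. by rewrite /lidem /llong !hinterchange !longcross_dividem. Qed.

Lemma idl_tens1 X X' (e : hom X X) (e' : hom X' X') :
  idl (sone 0 e) 0 1_X -> idl (sone 0 e') 0 1_X' ->
  idl (sone 0 (e ⊗ e')) 0 1_(X ++ X').
Proof.
move=> eX eX'; rewrite -htens1 -[0]addr0; apply: idl_tens eX eX'.
by move=> Y d g Y' d' g' [] []; apply: idl_mem; exact: SOne.
Qed.

Lemma idl_lidem p : idl (sone 0 (lidem p)) 0 1_(lword p).
Proof. by do 2?apply: idl_tens1; apply: idl_dividem. Qed.

Lemma idl_mulz0 X Y Z d (e : hom X X) (f : hom Y Z) (z : int) :
  idl (sone 0 e) d f -> e *~ z = 0 -> f *~ z = 0.
Proof.
move=> fe ez; elim: fe => {Y Z d f}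
  [Y Z d|Y Z d f f' _ IH _ IH'|Y W Z d1 d d2 g h k gh _ _].
- by rewrite mul0rz.
- by rewrite mulrzDl IH IH' addr0.
have {gh} hz : h *~ z = 0 by case: gh.
by rewrite -hcompMzl -hcompMzr hz hcomp0r hcomp0l.
Qed.

(** The identity of the word lies in the ideal of its idempotent, so torsion of the latter would be
    torsion of the former. *)
Lemma lidem_mulz0 p (z : int) : lidem p *~ z = 0 -> z = 0.
Proof.
by move=> /(idl_mulz0 (idl_lidem p)); exact: hid_mulz_eq0.
Qed.

Lemma llong_mulz0 p (z : int) : llong p *~ z = 0 -> z = 0.
Proof.
move=> lz; apply: (@lidem_mulz0 p).
by rewrite -ldelta_llong -hcompMzr lz hcomp0r.
Qed.

(** The idempotent is delta D, so f = delta (D f), and D f has degree lower by twice [lhalf q]. *)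
Lemma lowdeg_vanish p q M d (f : hom (lword p) (lword q)) :
  lowdeg (lword p) (lword q) M -> lidem q ∘ f = f -> homog d f ->
  (d - lhalf q *+ 2 < M)%R -> f = 0.
Proof.
move=> [low _] fE fd dM; rewrite -fE -ldelta_llong -hcompA.
by rewrite (low _ _ (homog_comp (homog_llong q) fd)) ?hcomp0r //; lia.
Qed.

Lemma lowdeg_cyclic p q M : lowdeg (lword p) (lword q) M ->
  exists2 u : hom (lword p) (lword q), homog (M + lhalf q *+ 2) u &
  forall f, lidem q ∘ f = f -> homog (M + lhalf q *+ 2) f ->
    exists z : int, f = u *~ z.
Proof.
move=> [_ [u ud uP]]; exists (ldelta q ∘ u) => [|f fE fd].
  by apply: homog_eq (homog_comp (homog_ldelta q) ud); rewrite addrC.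
have [|z lf] := uP (llong q ∘ f).
  by apply: homog_eq (homog_comp (homog_llong q) fd); lia.
by exists z; rewrite -hcompMzr -lf hcompA ldelta_llong.
Qed.

(* The generator u in the lowest degree is - or + D: D = m0 u, u delta u =    *)
(* m1 u and D delta D = D give m0 m1 = 1.                                     *)
Lemma lowdeg_endo p (f : hom (lword p) (lword p)) :
  lowdeg (lword p) (lword p) (- (lhalf p *+ 2)) ->
  lidem p ∘ f = f -> homog 0 f -> exists z : int, f = lidem p *~ z.
Proof.
move=> [_ [u ud uP]] fE f0.
have [m0 lm] := uP _ (homog_llong p).
have [|m1 um] := uP (u ∘ ldelta p ∘ u).
  by apply: homog_eq (homog_comp (homog_comp ud (homog_ldelta p)) ud); lia.
have [|m lf] := uP (llong p ∘ f).
  by apply: homog_eq (homog_comp (homog_llong p) f0); rewrite addr0.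
have mm : m0 * m1 = 1.
  have : llong p *~ (m0 * m1 - 1) = 0.
    rewrite mulrzBr mulr1z; apply/eqP; rewrite subr_eq0; apply/eqP.
    rewrite -{2}(llong_lidem p) -ldelta_llong hcompA.
    by rewrite lm !(hcompMzl, hcompMzr) um -!mulrzA; congr (_ *~ _); lia.
  by move/llong_mulz0 => /eqP; rewrite subr_eq0 => /eqP.
exists (m1 * m); rewrite -{1}fE -{1}ldelta_llong -hcompA lf -ldelta_llong lm.
by rewrite -!hcompMzr -mulrzA mulrA mm mul1r.
Qed.

Definition lcanon (p : label) : bool := canonical (lnode p) (la p) (lb p) (lc p).

Definition shape (p : label) := (lnode p, la p, lb p, lc p).

Lemma lcanon_calB p : lcanon p -> in_calB p.
Proof. by rewrite /lcanon /canonical /in_calB; case: ifP => // _; apply: ltnW. Qed.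

Lemma lowdeg_bound_same a b c : (a + c <= b)%N ->
  lowdeg_bound a b c a = - ((half a + half b + half c) *+ 2).
Proof.
move=> abc; rewrite /lowdeg_bound leqnn !mulrnDl !half_double; lia.
Qed.

(** With r = |a - a'| and s = b - (a + c), the bound exceeds the sum of the negated halves by r (r +
    s), which is at least 1. *)
Lemma lowdeg_bound_diff a b c a' c' : (a + c <= b)%N -> (a + c = a' + c')%N ->
  a != a' ->
  (1 - (half a + half b + half c) - (half a' + half b + half c')
   <= lowdeg_bound a b c a')%R.
Proof.
move=> abc ac aa'; rewrite /lowdeg_bound.
have := half_double a; have := half_double b; have := half_double c.
have := half_double a'; have := half_double c'.
move: (half a) (half b) (half c) (half a') (half c') => ha hb hc ha' hc'.
move=> ec' ea' ec eb ea.
have [le_a'a|lt_aa'] := leqP a' a.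
  have [r ra] : exists r, a = (a' + r)%N by exists (a - a')%N; lia.
  have [s sb] : exists s, b = (a + c + s)%N by exists (b - (a + c))%N; lia.
  have c'r : c' = (c + r)%N by lia.
  have r0 : (0 < r)%N by lia.
  by subst; nia.
have [r ra] : exists r, a' = (a + r)%N by exists (a' - a)%N; lia.
have [s sb] : exists s, b = (a + c + s)%N by exists (b - (a + c))%N; lia.
have c'r : c = (c' + r)%N by lia.
have r0 : (0 < r)%N by lia.
by subst; nia.
Qed.

Lemma nodeN (i : node) : i != ~~ i.
Proof. by case: i. Qed.

Lemma count_bword i a b c :
  count_mem i (bword i a b c) = (a + c)%N /\
  count_mem (~~ i) (bword i a b c) = b.
Proof.
by rewrite /bword; case: i; rewrite !count_cat !count_nseq /= !mul1n !mul0n ?addn0 ?add0n.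
Qed.

Lemma lowdeg_nperm X Y M : ~~ perm_eq X Y -> lowdeg X Y M.
Proof.
move=> XY; split=> [d f _ _|]; first exact: hom_perm.
by exists 0 => [|f _]; [exact: homog_0|exists 0; rewrite mulr0z; apply: hom_perm].
Qed.

Lemma lowdeg_self p : in_calB p ->
  lowdeg (lword p) (lword p) (- (lhalf p *+ 2)).
Proof.
rewrite /in_calB lwordE /lhalf => pB.
have := lowdeg_same (nodeN (lnode p)) (erefl (la p + lc p)%N) pB.
by rewrite lowdeg_bound_same.
Qed.

Lemma lowdeg_node p q : in_calB p -> in_calB q -> lnode p = lnode q ->
  shape p <> shape q -> lowdeg (lword p) (lword q) (1 - lhalf p - lhalf q).
Proof.
rewrite /in_calB /shape => pB qB pq npq; rewrite !lwordE -pq.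
have [per|] := boolP (perm_eq (bword (lnode p) (la p) (lb p) (lc p))
                              (bword (lnode p) (la q) (lb q) (lc q))); last first.
  exact: lowdeg_nperm.
have := count_bword (lnode p) (la p) (lb p) (lc p).
have := count_bword (lnode p) (la q) (lb q) (lc q).
rewrite !(permP per) => -[-> ->] [e1 e2].
rewrite /lhalf e2; rewrite e2 in qB npq *.
have := lowdeg_same (nodeN (lnode p)) (esym e1) pB.
apply: lowdeg_le; apply: lowdeg_bound_diff => //.
apply/eqP => aa; have cc : lc p = lc q by lia.
by apply: npq; rewrite -pq aa cc.
Qed.

(** Labels of different families have words with different letter counts: a canonical word of the
    first family has at most as many 1s as 2s, one of the second has more. *)
Lemma lowdeg_canon p q : lcanon p -> lcanon q -> shape p <> shape q ->
  lowdeg (lword p) (lword q) (1 - lhalf p - lhalf q).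
Proof.
move=> pc qc; have [pq npq|pq _] := eqVneq (lnode p) (lnode q).
  by apply: lowdeg_node => //; apply: lcanon_calB.
apply: lowdeg_nperm; apply/negP; rewrite !lwordE => per.
have [cp1 cp2] := count_bword (lnode p) (la p) (lb p) (lc p).
have [cq1 cq2] := count_bword (lnode q) (la q) (lb q) (lc q).
have qp : lnode p = ~~ lnode q by case: (lnode p) (lnode q) pq => [] [].
rewrite (permP per) qp cq2 in cp1; rewrite (permP per) qp negbK cq1 in cp2.
move: pc qc; rewrite /lcanon /canonical qp.
by case: (lnode q) => /=; lia.
Qed.

Definition lobj (p : label) : uidx (kbase (Bobj p)) := (tt, tt, tt).

Lemma lobj_all p (k : uidx (kbase (Bobj p))) : k = lobj p.
Proof. by case: k => [[[] []] []]. Qed.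

Lemma sum_lobj (V : zmodType) p (F : uidx (kbase (Bobj p)) -> V) :
  \sum_k F k = F (lobj p).
Proof.
by rewrite (bigD1 (lobj p)) //= big1 ?addr0 // => k; rewrite [k](lobj_all) eqxx.
Qed.

Lemma ushift_lobj p : ushift (lobj p) = lshift p - lhalf p.
Proof. by rewrite /= /lhalf /half; lia. Qed.

Lemma kidem_lobj p : kidem (Bobj p) (lobj p) (lobj p) = lidem p.
Proof. by []. Qed.

Lemma khomB_eq p q (f g : khom (Bobj p) (Bobj q)) :
  f (lobj p) (lobj q) = g (lobj p) (lobj q) -> f = g.
Proof. by move=> fg; apply: khomP => k l; rewrite (lobj_all k) (lobj_all l). Qed.

Lemma khomB_ent p q (f : khom (Bobj p) (Bobj q)) :
  lidem q ∘ f (lobj p) (lobj q) = f (lobj p) (lobj q) /\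
  homog (lshift p - lshift q - lhalf p + lhalf q) (f (lobj p) (lobj q)).
Proof.
have /uhomP/(_ (lobj p) (lobj q)) := congr1 (@kmor _ _) (kcomp1l f).
rewrite /= /ucomp_ent sum_lobj kidem_lobj => e; split => //.
by apply: homog_eq (uhomog f (lobj p) (lobj q)); rewrite !ushift_lobj; lia.
Qed.

Lemma khomB_vanish p q M (f : khom (Bobj p) (Bobj q)) :
  lowdeg (lword p) (lword q) M ->
  (lshift p - lshift q - lhalf p - lhalf q < M)%R -> f = 0.
Proof.
move=> low lt_M; have [fE fd] := khomB_ent f; apply: khomB_eq.
by apply: (lowdeg_vanish low fE fd); lia.
Qed.

Lemma khomB_shift p q (f : khom (Bobj p) (Bobj q)) :
  in_calB p -> shape p = shape q -> (lshift p < lshift q)%R -> f = 0.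
Proof.
move=> pB pq lt_pq; have low := lowdeg_self pB.
have [e1 e2] : lword p = lword q /\ lhalf p = lhalf q.
  by case: pq; rewrite /lword /lhalf => -> -> -> ->.
by rewrite {2}e1 in low; apply: khomB_vanish low _; lia.
Qed.

(** After composition with D, a hom has degree lshift p - lshift q - lhalf p - lhalf q, which is
    below the bound for distinct shapes as soon as lshift p <= lshift q. *)
Lemma khomB_canon p q (f : khom (Bobj p) (Bobj q)) :
  lcanon p -> lcanon q -> p <> q -> (lshift p <= lshift q)%R -> f = 0.
Proof.
move=> pc qc npq le_pq; have [pq|npq'] := pselect (shape p = shape q).
  apply: khomB_shift => //; first exact: lcanon_calB.
  rewrite lt_neqAle le_pq andbT; apply/eqP => e; apply: npq.
  by case: p q pq e {pc qc le_pq f} => [i a b c t] [i' a' b' c' t'] [-> -> -> ->] /= ->.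
by apply: khomB_vanish (lowdeg_canon pc qc npq') _; lia.
Qed.

Lemma khomB_endo p (f : khom (Bobj p) (Bobj p)) :
  in_calB p -> exists z : int, f = kid (Bobj p) *~ z.
Proof.
move=> pB; have [fE fd] := khomB_ent f.
have [|z fz] := lowdeg_endo (lowdeg_self pB) fE.
  by apply: homog_eq fd; lia.
by exists z; apply: khomB_eq; rewrite fz kmulzE.
Qed.

Lemma kidB_mulz0 p (z : int) : kid (Bobj p) *~ z = 0 -> z = 0.
Proof.
move=> /(congr1 (fun f : khom _ _ => f (lobj p) (lobj p))).
by rewrite kmulzE kidem_lobj; apply: lidem_mulz0.
Qed.

(** * Splitting integer idempotents *)

(** If N = L D R, idempotence reads D Q D = D with Q = R L, so each nonzero diagonal entry d_k
    satisfies d_k Q_kk = 1. The vectors are the k-th row of the inverse of L, scaled by Q_kk, and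
    the k-th column of the inverse of R. *)
Lemma idem_mx_split n (N : 'M[int]_n) : N *m N = N -> N != 0 ->
  exists (u : 'rV[int]_n) (v : 'cV[int]_n), u *m N *m v = 1%:M.
Proof.
move=> NN N0; have [L Lu [R Ru [d _ NE]]] := int_Smith_normal_form N.
set D := \matrix_(i, j) _ in NE.
have DE : D = invmx L *m N *m invmx R by rewrite NE !mulmxA mulVmx // mul1mx mulmxK.
pose Q := R *m L.
have DQD : D *m Q *m D = D.
  transitivity (invmx L *m (N *m N) *m invmx R); last by rewrite NN DE.
  by rewrite NE !mulmxA mulVmx // mul1mx mulmxK.
have [k dk] : exists k : 'I_n, d`_k != 0.
  apply/existsP; apply: contraNT N0; rewrite negb_exists => /forallP d0.
  rewrite NE (_ : D = 0) ?mulmx0 ?mul0mx //.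
  by apply/matrixP => i j; rewrite !mxE; have := d0 i; rewrite negbK => /eqP ->; rewrite mul0rn.
have dQ : d`_k * Q k k = 1.
  have DiE (A : 'M[int]_n) i j : (D *m A) i j = d`_i * A i j.
    rewrite mxE (bigD1 i) //= mxE eqxx mulr1n big1 ?addr0 // => l li.
    by rewrite mxE val_eqE eq_sym (negbTE li) mulr0n mul0r.
  have := congr1 (fun A : 'M[int]_n => A k k) DQD; rewrite /= -mulmxA DiE.
  rewrite mxE (bigD1 k) //= big1; last first.
    by move=> l lk; rewrite [D l k]mxE val_eqE (negbTE lk) mulr0n mulr0.
  rewrite addr0 [D k k]mxE eqxx mulr1n mulrA => e.
  by apply: (mulIf dk); rewrite mul1r.
move: (Q k k) dQ => c dc.
exists (c *: row k (invmx L)), (col k (invmx R)).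
have -> : row k (invmx L) = delta_mx 0 k *m invmx L by rewrite -rowE.
have -> : col k (invmx R) = invmx R *m delta_mx k 0 by rewrite -colE.
rewrite -!scalemxAl !mulmxA -(mulmxA _ (invmx L)) -(mulmxA _ _ (invmx R)) -DE.
rewrite -colE -rowE; apply/matrixP => i j; rewrite !ord1 !mxE !eqxx.
by rewrite mulr1n mulrC dc.
Qed.

(** The new matrix kills v, and its row space is contained in that of N, which does not kill v. *)
Lemma mxrank_split n (N : 'M[rat]_n) (u : 'rV_n) (v : 'cV_n) :
  u *m N *m v = 1%:M -> (\rank (N - N *m v *m (u *m N))%R < \rank N)%N.
Proof.
move=> uNv; set N' := N - _.
have N'N : (N' <= N)%MS.
  by rewrite /N' -[X in (X - _ <= _)%MS]mul1mx mulmxA -mulmxBl submxMl.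
rewrite ltn_neqAle (mxrankS N'N) andbT; apply/negP => /eqP e.
have [] := mxrank_leqif_sup N'N; rewrite e eqxx => _ /esym /submxP[A NA].
have : u *m N *m v = 0.
  have N'v : N' *m v = 0.
    by rewrite /N' mulmxBl -!mulmxA (mulmxA u) uNv mulmx1 subrr.
  by rewrite NA -!mulmxA N'v !mulmx0.
rewrite uNv => /matrixP/(_ 0 0); rewrite !mxE eqxx => /eqP.
by rewrite oner_eq0.
Qed.

(** For p in B this is the identification of the endomorphism ring with Z; the default 0 is then
    never taken. *)
Definition coef p (f : khom (Bobj p) (Bobj p)) : int :=
  if pselect (exists z : int, f = kid (Bobj p) *~ z) is left h
  then projT1 (cid h) else 0.

Lemma coefE p (f : khom (Bobj p) (Bobj p)) :
  in_calB p -> f = kid (Bobj p) *~ coef f.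
Proof.
move=> pB; rewrite /coef; case: pselect => [h|nh]; first by case: cid.
by case: nh; apply: khomB_endo.
Qed.

Lemma coef_uniq p (f : khom (Bobj p) (Bobj p)) (z : int) :
  f = kid (Bobj p) *~ z -> coef f = z.
Proof.
move=> fz; rewrite /coef; case: pselect => [h|nh]; last by case: nh; exists z.
case: cid => z' /= fz'; apply/eqP; rewrite -subr_eq0; apply/eqP.
by apply: (@kidB_mulz0 p); rewrite mulrzBr -fz -fz' subrr.
Qed.

Lemma coefB p (f g : khom (Bobj p) (Bobj p)) :
  in_calB p -> coef (f - g) = coef f - coef g.
Proof.
by move=> pB; apply: coef_uniq; rewrite {1}(coefE f pB) {1}(coefE g pB) mulrzBr.
Qed.

Lemma coefM p (f g : khom (Bobj p) (Bobj p)) :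
  in_calB p -> coef (kcomp f g) = coef f * coef g.
Proof.
move=> pB; apply: coef_uniq; rewrite {1}(coefE f pB) {1}(coefE g pB).
by rewrite kcompMzl kcompMzr kcomp1l -mulrzA mulrC.
Qed.

Lemma coef0 p : coef (0 : khom (Bobj p) (Bobj p)) = 0.
Proof. by apply: coef_uniq; rewrite mulr0z. Qed.

Lemma coefD p (f g : khom (Bobj p) (Bobj p)) :
  in_calB p -> coef (f + g) = coef f + coef g.
Proof.
by move=> pB; apply: coef_uniq; rewrite {1}(coefE f pB) {1}(coefE g pB) mulrzDr.
Qed.

Lemma coef_sum p (I : Type) (r : seq I) (F : I -> khom (Bobj p) (Bobj p)) :
  in_calB p -> coef (\sum_(i <- r) F i) = \sum_(i <- r) coef (F i).
Proof.
by move=> pB; elim/big_rec2: _ => [|i f f' _ <-]; rewrite ?coef0 ?coefD.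
Qed.

(** Whichever of the two shifts is larger, [khomB_canon] makes one of the factors vanish. *)
Lemma khomB_orth p q (f : khom (Bobj p) (Bobj q)) (g : khom (Bobj q) (Bobj p)) :
  lcanon p -> lcanon q -> p <> q -> kcomp g f = 0.
Proof.
move=> pc qc npq; have [le_pq|lt_qp] := lerP (lshift p) (lshift q).
  by rewrite (khomB_canon f pc qc npq le_pq) kcomp0r.
by rewrite (khomB_canon g qc pc (nesym npq) (ltW lt_qp)) kcomp0l.
Qed.

Lemma split_idem X (phi : khom X X) : kcomp phi phi = phi ->
  exists X' (i : khom X' X) (r : khom X X'), kcomp r i = kid X' /\ kcomp i r = phi.
Proof.
move=> pp; have pp' : ucomp phi phi = phi by have := congr1 (@kmor _ _) pp.
pose X' := KObj pp'.
have iP : ucomp (kidem X) (ucomp phi (kidem X')) = phi.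
  rewrite /= pp'; have := congr1 (@kmor _ _) (kcomp1l phi); exact.
have rP : ucomp (kidem X') (ucomp phi (kidem X)) = phi.
  have -> : ucomp phi (kidem X) = phi by have := congr1 (@kmor _ _) (kcomp1r phi).
  exact: pp'.
exists X', (@KHom X' X phi iP), (@KHom X X' phi rP).
by have /uhomP e := pp'; split; apply: khomP => k l; apply: e.
Qed.

(** Terms with a label other than p0 are replaced by 0, so that all blocks are n by n and no subset
    of indices has to be chosen. *)
Definition into p0 n (p : 'I_n -> label) X (a : forall k, khom (Bobj (p k)) X)
    (k : 'I_n) : khom (Bobj p0) X :=
  if pselect (p k = p0) is left e then ecast q (khom (Bobj q) X) e (a k) else 0.

Definition outof p0 n (p : 'I_n -> label) X (b : forall k, khom X (Bobj (p k)))
    (k : 'I_n) : khom X (Bobj p0) :=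
  if pselect (p k = p0) is left e then ecast q (khom X (Bobj q)) e (b k) else 0.

Lemma into_comp p0 n (p : 'I_n -> label) X X' (a : forall k, khom (Bobj (p k)) X)
    (f : khom X X') k :
  into p0 (fun k => kcomp f (a k)) k = kcomp f (into p0 a k).
Proof.
by rewrite /into; case: pselect => [e|_]; [case: _ / e|rewrite kcomp0r].
Qed.

Lemma outof_comp p0 n (p : 'I_n -> label) X X' (b : forall k, khom X (Bobj (p k)))
    (f : khom X' X) k :
  outof p0 (fun k => kcomp (b k) f) k = kcomp (outof p0 b k) f.
Proof.
by rewrite /outof; case: pselect => [e|_]; [case: _ / e|rewrite kcomp0l].
Qed.

Lemma outof_self n (p : 'I_n -> label) X (b : forall k, khom X (Bobj (p k))) k :
  outof (p k) b k = b k.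
Proof.
rewrite /outof; case: pselect => // e.
by rewrite (Prop_irrelevance e erefl).
Qed.

Lemma into_outof p0 n (p : 'I_n -> label) X (a : forall k, khom (Bobj (p k)) X)
    (b : forall k, khom X (Bobj (p k))) k :
  kcomp (into p0 a k) (outof p0 b k)
  = if pselect (p k = p0) is left _ then kcomp (a k) (b k) else 0.
Proof.
rewrite /into /outof; case: pselect => [e|_]; last by rewrite kcomp0l.
by case: _ / e.
Qed.

(* The block at p0 of the matrix of the b_l a_m, whose entries are integers.  *)
Definition block p0 n (p : 'I_n -> label) X (a : forall k, khom (Bobj (p k)) X)
    (b : forall k, khom X (Bobj (p k))) : 'M[int]_n :=
  \matrix_(l, m) coef (kcomp (outof p0 b l) (into p0 a m)).

(** The identity of X is inserted between b_l and a_m; the terms through labels other than p0 vanish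
    by [khomB_orth]. *)
Lemma block_idem p0 n (p : 'I_n -> label) X (a : forall k, khom (Bobj (p k)) X)
    (b : forall k, khom X (Bobj (p k))) :
  lcanon p0 -> (forall k, lcanon (p k)) ->
  kid X = \sum_k kcomp (a k) (b k) ->
  block p0 a b *m block p0 a b = block p0 a b.
Proof.
move=> p0c pc ab; have p0B := lcanon_calB p0c.
apply/matrixP => l m; rewrite !mxE.
rewrite -[into p0 a m]kcomp1l ab kcomp_suml kcomp_sumr coef_sum //.
apply: eq_bigr => k _; rewrite !mxE -coefM // kcomp_mid into_outof.
case: pselect => [e|np]; first by rewrite !kcompA.
rewrite kcomp0l kcomp0r -(kcompA (a k)) kcompA.
by rewrite (khomB_orth _ _ p0c (pc k)) //; apply: nesym.
Qed.

(** The measure that decreases when a summand is split off. A block is counted once for every index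
    carrying its label, which is harmless. *)
Definition block_rank n (p : 'I_n -> label) X (a : forall k, khom (Bobj (p k)) X)
    (b : forall k, khom X (Bobj (p k))) : nat :=
  \sum_k \rank (map_mx (intr : int -> rat) (block (p k) a b)).

(** In b_k = sum of the b_k a_l b_l, the terms with the label of k vanish by assumption and those of
    other labels vanish unless the shift at l is strictly larger. Descending induction on the shift
    gives b_k = 0. *)
Lemma block0_kid0 n (p : 'I_n -> label) X (a : forall k, khom (Bobj (p k)) X)
    (b : forall k, khom X (Bobj (p k))) :
  (forall k, lcanon (p k)) -> kid X = \sum_k kcomp (a k) (b k) ->
  (forall k, block (p k) a b = 0) -> kid X = 0.
Proof.
move=> pc ab N0; have pB k := lcanon_calB (pc k).
pose M : nat := \max_k `|lshift (p k)|%N.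
have Mk k : (lshift (p k) <= M%:Z)%R.
  have : (`|lshift (p k)| <= M)%N by apply: leq_bigmax.
  by lia.
suff b0 d k : (M%:Z - lshift (p k) < d%:Z)%R -> b k = 0.
  rewrite ab big1 // => k _; rewrite (b0 (absz (M%:Z - lshift (p k) + 1)%R)) ?kcomp0r //.
  by have := Mk k; lia.
elim: d k => [|d IH] k kd; first by have := Mk k; lia.
rewrite -[b k]kcomp1r ab kcomp_sumr big1 // => l _.
have [pkl|npkl] := pselect (p l = p k).
  have -> : kcomp (a l) (b l) = kcomp (into (p k) a l) (outof (p k) b l).
    by rewrite into_outof; case: pselect.
  have := coefE (kcomp (outof (p k) b k) (into (p k) a l)) (pB k).
  have := congr1 (fun A : 'M[int]_n => A k l) (N0 k); rewrite !mxE => ->.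
  by rewrite mulr0z (outof_self b k) kcompA => ->; rewrite kcomp0l.
rewrite kcompA.
have [le_lk|lt_kl] := lerP (lshift (p l)) (lshift (p k)).
  by rewrite (khomB_canon (kcomp (b k) (a l)) (pc l) (pc k) npkl le_lk) kcomp0l.
by rewrite (IH l) ?kcomp0r //; lia.
Qed.

Lemma kcompBl X Y Z (f f' : khom Y Z) (g : khom X Y) :
  kcomp (f - f') g = kcomp f g - kcomp f' g.
Proof. by rewrite kcompDl kcompNl. Qed.

Lemma kcompBr X Y Z (f : khom Y Z) (g g' : khom X Y) :
  kcomp f (g - g') = kcomp f g - kcomp f g'.
Proof. by rewrite kcompDr kcompNr. Qed.

Lemma split_off X C (alpha : khom C X) (beta : khom X C) :
  kcomp beta alpha = kid C ->
  exists X' (i : khom X' X) (r : khom X X'),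
  [/\ kcomp r i = kid X', kcomp i r = kid X - kcomp alpha beta
    & kiso X (ksum C X')].
Proof.
move=> ba; pose phi := kid X - kcomp alpha beta.
have pa : kcomp phi alpha = 0 by rewrite kcompBl kcomp1l -kcompA ba kcomp1r subrr.
have bp : kcomp beta phi = 0 by rewrite kcompBr kcomp1r kcompA ba kcomp1l subrr.
have pp : kcomp phi phi = phi.
  by rewrite {1}/phi kcompBl kcomp1l -kcompA bp kcomp0r subr0.
have [X' [i [r [ri ir]]]] := split_idem pp; exists X', i, r; split=> //.
apply: (@biproduct_iso _ _ _ alpha beta i r); split => //.
- by rewrite -[i]kcomp1r -ri !kcompA -(kcompA beta) ir bp kcomp0l.
- by rewrite -[r]kcomp1l -ri -!kcompA (kcompA i) ir pa kcomp0r.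
by rewrite ir /phi addrCA subrr addr0.
Qed.

(** A nonzero block of label p0 yields alpha and beta with beta alpha = 1, so [Bobj p0] splits off;
    the complement is again a retract, of smaller block rank. *)
Lemma kdirect_sum_retract n (p : 'I_n -> label) d X
    (a : forall k, khom (Bobj (p k)) X) (b : forall k, khom X (Bobj (p k))) :
  (forall k, lcanon (p k)) -> kid X = \sum_k kcomp (a k) (b k) ->
  (block_rank a b < d)%N ->
  exists s : seq label, all lcanon s /\ kiso X (kdirect_sum (map Bobj s)).
Proof.
move=> pc; elim: d X a b => // d IH X a b ab rd.
have pB k := lcanon_calB (pc k).
have [N0|] := pselect (forall k, block (p k) a b = 0).
  by exists [::]; split => //; apply/kiso0P/(block0_kid0 pc ab).
move=> /existsNP[k0 /eqP N0]; set p0 := p k0 in N0.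
have [u [v uNv]] := idem_mx_split (block_idem (pc k0) pc ab) N0.
rewrite -/p0 in uNv; set N := block p0 a b in N0 uNv.
pose A := into p0 a; pose B := outof p0 b.
have BA l m : kcomp (B l) (A m) = kid (Bobj p0) *~ N l m.
  by rewrite (coefE (kcomp (B l) (A m)) (pB k0)) mxE.
pose alpha := \sum_m A m *~ v m 0.
pose beta := \sum_l B l *~ u 0 l.
have Ba l : kcomp (B l) alpha = kid (Bobj p0) *~ (N *m v) l 0.
  rewrite kcomp_sumr mxE mulrz_sumr; apply: eq_bigr => m _.
  by rewrite kcompMzr BA -mulrzA.
have bA m : kcomp beta (A m) = kid (Bobj p0) *~ (u *m N) 0 m.
  rewrite kcomp_suml mxE mulrz_sumr; apply: eq_bigr => l _.
  by rewrite kcompMzl BA -mulrzA mulrC.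
have ba : kcomp beta alpha = kid (Bobj p0).
  rewrite kcomp_sumr -[RHS]mulr1z.
  have <- : (u *m N *m v) 0 0 = 1 by rewrite uNv mxE eqxx.
  rewrite mxE mulrz_sumr; apply: eq_bigr => m _.
  by rewrite kcompMzr bA -mulrzA.
have [X' [i [r [ri ir XX']]]] := split_off ba.
have [||s [sc X's]] := IH X' (fun k => kcomp r (a k)) (fun k => kcomp (b k) i).
- transitivity (kcomp r (kcomp (\sum_k kcomp (a k) (b k)) i)).
    by rewrite -ab kcomp1l ri.
  rewrite kcomp_suml kcomp_sumr; apply: eq_bigr => k _.
  by rewrite !kcompA.
(* Passing to the complement replaces the identity by id - alpha beta, which subtracts (b_l
   alpha)(beta a_m): a rank one correction at p0, and zero at the other labels. *)
- have N' l m : kcomp i r = kid X - kcomp alpha beta ->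
      forall q, lcanon q -> block q (fun k => kcomp r (a k)) (fun k => kcomp (b k) i) l m
        = block q a b l m - coef (kcomp (kcomp (outof q b l) alpha)
                                        (kcomp beta (into q a m))).
    move=> _ q qc; rewrite !mxE into_comp outof_comp kcomp_mid ir.
    rewrite kcompBl kcomp1l kcompBr coefB; last exact: lcanon_calB.
    by rewrite !kcompA.
  have lt0 : (\rank (map_mx (intr : int -> rat)
       (block p0 (fun k => kcomp r (a k)) (fun k => kcomp (b k) i)))
     < \rank (map_mx (intr : int -> rat) N))%N.
    have -> : block p0 (fun k => kcomp r (a k)) (fun k => kcomp (b k) i)
            = N - N *m v *m (u *m N).
      apply/matrixP => l m; rewrite (N' l m ir _ (pc k0)) -/N Ba bA.
      have E : (N *m v *m (u *m N)) l m = (N *m v) l 0 * (u *m N) 0 m.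
        by rewrite mxE big_ord1.
      rewrite kcompMzl kcompMzr kcomp1l -mulrzA (coef_uniq erefl).
      by rewrite [RHS]mxE; congr (_ + _); rewrite [RHS]mxE E mulrC.
    rewrite map_mxB !map_mxM; apply: mxrank_split.
    by rewrite -!map_mxM uNv map_mx1.
  have eq_rk q : lcanon q -> q <> p0 ->
      block q (fun k => kcomp r (a k)) (fun k => kcomp (b k) i) = block q a b.
    move=> qc qp0; apply/matrixP => l m; rewrite (N' l m ir q qc).
    by rewrite (khomB_orth _ _ qc (pc k0) qp0) coef0 subr0.
  move: rd; rewrite ltnS; apply: leq_trans; rewrite /block_rank (bigD1 k0) //=.
  rewrite [X in (_ < X)%N](bigD1 k0) //= -addSn leq_add //.
  apply: leq_sum => k _.
  have [e|ne] := pselect (p k = p0); last by rewrite eq_rk.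
  by rewrite e; apply: ltnW.
exists (p0 :: s); split; first by rewrite /= sc pc.
by apply: kiso_trans XX' (ksum_kiso (kiso_refl _) X's).
Qed.

(** * Factorizations of identities *)

Lemma kproj_subproof X Y (f : uhom (kbase X) (kbase Y)) :
  ucomp (kidem Y) (ucomp (ucomp (kidem Y) (ucomp f (kidem X))) (kidem X))
  = ucomp (kidem Y) (ucomp f (kidem X)).
Proof. by rewrite -!ucompA kidemP ucompA kidemP. Qed.

Definition kproj X Y (f : uhom (kbase X) (kbase Y)) : khom X Y :=
  KHom (kproj_subproof f).

Lemma kprojD X Y (f g : uhom (kbase X) (kbase Y)) :
  kproj (f + g) = kproj f + kproj g.
Proof.
suff /uhomP e : ucomp (kidem Y) (ucomp (uadd f g) (kidem X))
    = uadd (ucomp (kidem Y) (ucomp f (kidem X))) (ucomp (kidem Y) (ucomp g (kidem X))).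
  by apply: khomP => k l; apply: e.
by rewrite ucompDl ucompDr.
Qed.

Lemma kproj0 X Y : kproj (0 : uhom (kbase X) (kbase Y)) = 0.
Proof. by apply: (@addrI _ (kproj 0)); rewrite -kprojD !addr0. Qed.

Lemma kproj_sum (I : Type) (r : seq I) X Y (F : I -> uhom (kbase X) (kbase Y)) :
  kproj (\sum_(i <- r) F i) = \sum_(i <- r) kproj (F i).
Proof. by elim/big_rec2: _ => [|i f f' _ <-]; rewrite ?kproj0 ?kprojD. Qed.

Lemma kproj_uid X : kproj (uid (kbase X)) = kid X.
Proof.
suff /uhomP e : ucomp (kidem X) (ucomp (uid (kbase X)) (kidem X)) = kidem X.
  by apply: khomP => k l; apply: e.
by rewrite ucomp1l kidemP.
Qed.

Lemma kproj_comp X Y Z (f : uhom (kbase Y) (kbase Z)) (g : uhom (kbase X) (kbase Y)) :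
  kcomp (kproj f) (kproj g) = kproj (ucomp f (ucomp (kidem Y) g)).
Proof.
suff /uhomP e : ucomp (ucomp (kidem Z) (ucomp f (kidem Y)))
      (ucomp (kidem Y) (ucomp g (kidem X)))
    = ucomp (kidem Z) (ucomp (ucomp f (ucomp (kidem Y) g)) (kidem X)).
  by apply: khomP => k l; apply: e.
by rewrite -!ucompA (ucompA (kidem Y)) kidemP.
Qed.

Local Notation lshape := (node * nat * nat * nat)%type.

(** Only the shape is constrained: the shift is fixed later, from the degrees of the two factors. *)
Inductive sidem (P : lshape -> Prop) : eset :=
  SIdem p : P (shape p) -> sidem P 0 (lidem p).

Record factor (P : lshape -> Prop) w w' (d : int) := Factor {
  fac_lab : label;
  fac_P : P (shape fac_lab);
  fac_in : hom (lword fac_lab) w';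
  fac_out : hom w (lword fac_lab);
  fac_deg : int;
  fac_inP : homog (d - fac_deg) fac_in;
  fac_outP : homog fac_deg fac_out }.

Lemma idl_factors P w w' d (f : hom w w') : idl (sidem P) d f ->
  exists s : seq (factor P w w' d),
    f = \sum_(x <- s) (fac_in x ∘ lidem (fac_lab x) ∘ fac_out x).
Proof.
elim=> {w w' d f} [w w' d|w w' d f f' _ [s ->] _ [s' ->]|w y w' d1 d d2 g e h].
- by exists [::]; rewrite big_nil.
- by exists (s ++ s'); rewrite big_cat.
move=> Se; case: y d e / Se g h => p Pp g h gd hd.
have gd' : homog (d1 + 0 + d2 - d2) g by apply: homog_eq gd; lia.
by exists [:: Factor Pp gd' hd]; rewrite big_seq1.
Qed.

Record kfactor (P : lshape -> Prop) X := KFactor {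
  kfac_lab : label;
  kfac_P : P (shape kfac_lab);
  kfac_in : khom (Bobj kfac_lab) X;
  kfac_out : khom X (Bobj kfac_lab) }.

Lemma into_homog X (k : uidx (kbase X)) p d (g : hom (lword p) (uword k))
    (j : uidx (kbase (Bobj p))) (m : uidx (kbase X)) :
  homog (0 - d) g -> lshift p = ushift k - d + lhalf p ->
  homog (ushift j - ushift m) (uid_ent k m ∘ g : hom (uword j) (uword m)).
Proof.
move=> gd pE; rewrite (lobj_all j) ushift_lobj pE.
by apply: homog_eq (homog_comp (uid_homog k m) gd); lia.
Qed.

Lemma outof_homog X (k : uidx (kbase X)) p d (h : hom (uword k) (lword p))
    (m : uidx (kbase X)) (j : uidx (kbase (Bobj p))) :
  homog d h -> lshift p = ushift k - d + lhalf p ->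
  homog (ushift m - ushift j) (h ∘ uid_ent m k : hom (uword m) (uword j)).
Proof.
move=> hd pE; rewrite (lobj_all j) ushift_lobj pE.
by apply: homog_eq (homog_comp hd (uid_homog m k)); lia.
Qed.

Lemma diag_homog X (k m m' : uidx (kbase X)) :
  homog (ushift m - ushift m') (uid_ent k m' ∘ uid_ent m k).
Proof.
by apply: homog_eq (homog_comp (uid_homog k m') (uid_homog m k)); lia.
Qed.

(** The diagonal matrix unit at k; composing two identity entries avoids casting between
    summands. *)
Definition udiag X (k : uidx (kbase X)) : uhom (kbase X) (kbase X) :=
  UHom (diag_homog k).

Lemma sum_udiag X : \sum_k udiag k = uid (kbase X).
Proof.
apply/uhomP => m m'; rewrite usum_ent_seq /=.
have /uhomP/(_ m m') := ucomp1l (uid (kbase X)).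
by rewrite /= /ucomp_ent => <-; apply: eq_bigr => k _.
Qed.

Lemma udiag_factors P X (k : uidx (kbase X)) :
  idl (sidem P) 0 1_(uword k) ->
  exists s : seq (kfactor P X),
    kproj (udiag k) = \sum_(x <- s) kcomp (kfac_in x) (kfac_out x).
Proof.
move=> /idl_factors[s sE].
have kf (x : factor P (uword k) (uword k) 0) : exists y : kfactor P X,
    exists E : uhom (kbase X) (kbase X),
    (forall m m', E m m' = uid_ent k m' ∘ (fac_in x ∘ lidem (fac_lab x) ∘ fac_out x)
                           ∘ uid_ent m k) /\
    kcomp (kfac_in y) (kfac_out y) = kproj E.
  case: x => -[i a b c t0] Pp g h d gd hd /=.
  (* The shift for which both factors become homs of degree 0. *)
  pose p := Label i a b c (ushift k - d + lhalf (Label i a b c t0)).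
  have pE : lshift p = ushift k - d + lhalf p by [].
  pose G : uhom (kbase (Bobj p)) (kbase X) :=
    @UHom (kbase (Bobj p)) (kbase X) _ (fun j m => @into_homog X k p d g j m gd pE).
  pose H : uhom (kbase X) (kbase (Bobj p)) :=
    @UHom (kbase X) (kbase (Bobj p)) _ (fun m j => @outof_homog X k p d h m j hd pE).
  exists (@KFactor P X p Pp (kproj G) (kproj H)).
  exists (ucomp G (ucomp (kidem (Bobj p)) H)); split; last exact: kproj_comp.
  move=> m m'.
  have inner : ucomp (kidem (Bobj p)) H m (lobj p) = lidem p ∘ (h ∘ uid_ent m k).
    exact: (sum_lobj (fun j => kidem (Bobj p) j (lobj p) ∘ H m j)).
  etransitivity.
    exact: (sum_lobj (fun j => G j m' ∘ ucomp (kidem (Bobj p)) H m j)).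
  by rewrite inner !hcompA.
have [F FP] := choice kf; have [E EP] := choice FP.
exists (map F s); rewrite big_map.
transitivity (kproj (\sum_(x <- s) E x)).
  congr kproj; apply/uhomP => m m'; rewrite usum_ent_seq /=.
  under eq_bigr do rewrite (EP _).1.
  transitivity (uid_ent k m' ∘ 1_(uword k) ∘ uid_ent m k); first by rewrite hcomp1r.
  rewrite sE; elim: (s) => [|x r IH]; first by rewrite !big_nil hcomp0r hcomp0l.
  by rewrite !big_cons hcompDr hcompDl IH.
by rewrite kproj_sum; apply: eq_bigr => x _; rewrite (EP x).2.
Qed.

Lemma kid_factors P X :
  (forall k : uidx (kbase X), idl (sidem P) 0 1_(uword k)) ->
  exists s : seq (kfactor P X),
    kid X = \sum_(x <- s) kcomp (kfac_in x) (kfac_out x).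
Proof.
move=> XP.
have kf (k : uidx (kbase X)) := udiag_factors (XP k).
have [S SE] := choice kf.
exists (flatten [seq S k | k <- enum (uidx (kbase X))]).
rewrite big_flatten big_map big_enum /= -kproj_uid -sum_udiag kproj_sum.
by apply: eq_bigr => k _.
Qed.

Lemma idl_sidem (P : lshape -> Prop) (W : word -> Prop) w :
  idl (swords W) 0 1_w ->
  (forall Y, W Y -> exists i a b c, P (i, a, b, c) /\ Y = bword i a b c) ->
  idl (sidem P) 0 1_w.
Proof.
move=> wW WP; apply: idl_trans wW _ => Y d e [Y' WY'].
have [i [a [b [c [Pp ->]]]]] := WP _ WY'.
rewrite -[bword _ _ _ _](lwordE (Label i a b c 0)).
apply: idl_trans (idl_lidem _) _ => Z d' e' [] {Z d' e'}.
exact/idl_mem/(SIdem (p := Label i a b c 0)).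
Qed.

Lemma kdirect_sum_ex X : exists s : seq label,
  all lcanon s /\ kiso X (kdirect_sum (map Bobj s)).
Proof.
pose P (s : lshape) := canonical s.1.1.1 s.1.1.2 s.1.2 s.2 : Prop.
have XP (k : uidx (kbase X)) : idl (sidem P) 0 1_(uword k).
  apply: idl_sidem (idl_canon _) _ => Y [i [a [b [c [iabc ->]]]]].
  by exists i, a, b, c.
have [S SE] := kid_factors XP.
rewrite big_tnth in SE.
pose p k := kfac_lab (tnth (in_tuple S) k).
have pc k : lcanon (p k) by exact: (kfac_P (tnth (in_tuple S) k)).
exact: (kdirect_sum_retract (a := fun k => kfac_in (tnth (in_tuple S) k))
   (b := fun k => kfac_out (tnth (in_tuple S) k)) pc SE (ltnSn _)).
Qed.

(** * The exceptional isomorphisms *)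

Lemma lowdeg_cross (i : node) a c m n t t' : (m + n = a + c)%N ->
  let p := Label i a (a + c) c t in
  let q := Label (~~ i) m (a + c) n t' in
  lowdeg (lword p) (lword q) ((m != c)%:Z - lhalf p - lhalf q).
Proof.
move=> mn p q; rewrite !lwordE /p /q /=.
have := lowdeg_split a c m n (nodeN i); rewrite mn /bword negbK.
apply: lowdeg_le; rewrite /lhalf /= -mn.
have := half_double a; have := half_double c; have := half_double (m + n).
have := half_double m; have := half_double n.
move: (half a) (half c) (half _) (half m) (half n) => ha hc hb hm hn en em eb ec ea.
(* The bound of [lowdeg_split] exceeds the sum of the negated halves by exactly (m - c)^2; only its
   positivity for m != c is kept. *)
have sq : ((m != c)%:Z <= (m%:Z - c%:Z) * (m%:Z - c%:Z))%R.
  have [->|mc] := eqVneq m c; first by rewrite subrr.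
  have [d dE] : exists d, m = (c + d.+1)%N \/ c = (m + d.+1)%N.
    exists ((m - c) + (c - m)).-1%N; lia.
  by case: dE => ->; rewrite [X in (X <= _)%R]/=; lia.
have aE : a%:Z = m%:Z + n%:Z - c%:Z by lia.
move: ((m != c)%:Z) sq => s sq.
by rewrite aE in ea *; lia.
Qed.

(** For equal shifts, homs between the two objects sit exactly in the lowest degree, where
    [lowdeg_cyclic] gives one generator. *)
Lemma khomB_cyclic p q :
  lowdeg (lword p) (lword q) (- lhalf p - lhalf q) -> lshift p = lshift q ->
  exists f0 : khom (Bobj p) (Bobj q), forall f, exists z : int, f = f0 *~ z.
Proof.
move=> low e; have [u ud uP] := lowdeg_cyclic low.
have uh (k : uidx (kbase (Bobj p))) (l : uidx (kbase (Bobj q))) :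
    homog (ushift k - ushift l) (u : hom (uword k) (uword l)).
  rewrite (lobj_all k) (lobj_all l) !ushift_lobj.
  by apply: homog_eq ud; lia.
pose U : uhom (kbase (Bobj p)) (kbase (Bobj q)) := UHom uh.
exists (kproj U) => f; have [fE fd] := khomB_ent f.
have [|z fz] := uP _ fE; first by apply: homog_eq fd; lia.
exists z; have <- : kproj f = f.
  suff /uhomP H : ucomp (kidem (Bobj q)) (ucomp f (kidem (Bobj p))) = f.
    by apply: khomP => k l; apply: H.
  exact: kmorP.
have fU : (f : uhom _ _) = U *~ z.
  apply/uhomP => k l; rewrite (lobj_all k) (lobj_all l) fz.
  have H n : (U *+ n) (lobj p) (lobj q) = u *+ n.
    by elim: n => [|n IH]; rewrite ?mulr0n // !mulrS -IH.
  by case: z {fz} => n; rewrite /intmul -H.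
have H n : kproj (U *+ n) = kproj U *+ n.
  by elim: n => [|n IH]; rewrite ?mulr0n ?kproj0 // !mulrS kprojD IH.
rewrite fU; case: (z) => n; rewrite /intmul ?H //.
by apply: (@addIr _ (kproj (U *+ n.+1))); rewrite -kprojD addNr kproj0 H addNr.
Qed.

Lemma kidB_neq0 p : kid (Bobj p) <> 0.
Proof.
by move=> p0; have := @kidB_mulz0 p 1; rewrite mulr1z p0 => /(_ erefl) /eqP.
Qed.

Lemma khomB_idem p (f : khom (Bobj p) (Bobj p)) :
  in_calB p -> kcomp f f = f -> f = 0 \/ f = kid (Bobj p).
Proof.
move=> pB ff; have [k kE] := khomB_endo f pB.
have : kid (Bobj p) *~ (k * (k - 1)) = 0.
  rewrite mulrBr mulr1 mulrzBr mulrzA -kE -{2}ff kE kcompMzl kcompMzr kcomp1l.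
  by rewrite subrr.
move/kidB_mulz0/eqP; rewrite mulf_eq0 subr_eq0 kE.
by case/orP => /eqP ->; rewrite ?mulr0z ?mulr1z; [left|right].
Qed.

(* By [idl_three_blocks] the identity of the left-hand side is a sum of       *)
(* composites through the E_j^(m) E_i^(a+c) E_j^(n), m + n = a + c; by the    *)
(* degree bound (m - c)^2 only m = c contributes, through a single pair of    *)
(* generators f0, g0.                                                         *)
Lemma kiso_cross (i : node) (a c : nat) (t : int) :
  kiso (Bobj (Label i a (a + c) c t)) (Bobj (Label (~~ i) c (a + c) a t)).
Proof.
set F := Label i a (a + c) c t; set G := Label (~~ i) c (a + c) a t.
pose P (s : lshape) := exists m n, (m + n = a + c)%N /\ s = (~~ i, m, (a + c)%N, n).
have FP (k : uidx (kbase (Bobj F))) : idl (sidem P) 0 1_(uword k).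
  rewrite (lobj_all k); have := idl_three_blocks a (a + c) c [::] (nodeN i).
  rewrite cats0 => H; rewrite -[uword _]/(lword F) lwordE.
  apply: idl_sidem H _ => Y [m [n [mn ->]]].
  exists (~~ i), m, (a + c)%N, n; split; first by exists m, n.
  by rewrite /bword negbK cats0.
have [S SE] := kid_factors FP.
have low_FG := lowdeg_cross i t t (addnC c a).
have low_GF : lowdeg (lword G) (lword F) (- lhalf G - lhalf F).
  have := lowdeg_cross (~~ i) t t (addnC a c : (a + c = c + a)%N).
  by rewrite /= negbK eqxx sub0r addnC.
rewrite /= eqxx sub0r -/F -/G in low_FG.
have [f0 f0P] := khomB_cyclic low_FG erefl.
have [g0 g0P] := khomB_cyclic low_GF erefl.
have [z idF] : exists z : int, kid (Bobj F) = kcomp g0 f0 *~ z.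
  rewrite SE; elim: S {SE} => [|x S [z IH]].
    by exists 0; rewrite big_nil mulr0z.
  suff [z' xE] : exists z' : int, kcomp (kfac_in x) (kfac_out x) = kcomp g0 f0 *~ z'.
    by exists (z' + z); rewrite big_cons IH xE mulrzDr.
  case: x => p [m [n [mn pE]]] f g /=.
  have {pE} pE : p = Label (~~ i) m (a + c) n (lshift p).
    by case: p pE {f g} => i' m' b n' s [-> -> -> ->].
  move: (lshift p) pE => s pE; case: _ / (esym pE) in f g *.
  have low : lowdeg (lword F) (lword (Label (~~ i) m (a + c) n s))
      ((m != c)%:Z - lhalf F - lhalf (Label (~~ i) m (a + c) n s)).
    exact: lowdeg_cross.
  have low' : lowdeg (lword (Label (~~ i) m (a + c) n s)) (lword F)
      ((a != n)%:Z - lhalf (Label (~~ i) m (a + c) n s) - lhalf F).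
    by have := lowdeg_cross (~~ i) s t (esym mn); rewrite /= negbK mn.
  (* The factor into F vanishes if s < t and the factor out of F if s > t; for s = t the latter also
     vanishes unless m = c. *)
  have [st|ts|st] := ltgtP s t.
  - exists 0; rewrite mulr0z (khomB_vanish f low') ?kcomp0l //=.
    by case: eqP => _; lia.
  - exists 0; rewrite mulr0z (khomB_vanish g low) ?kcomp0r //=.
    by case: eqP => _; lia.
  have [mc|mc] := eqVneq m c; last first.
    by exists 0; rewrite mulr0z (khomB_vanish g low) ?kcomp0r //= mc; lia.
  have na : n = a by lia.
  case: _ / (esym mc) in f g mn low low' pE *.
  case: _ / (esym na) in f g mn low low' pE *.
  case: _ / (esym st) in f g low low' pE *.
  have [z1 ->] := f0P g; have [z2 ->] := g0P f.
  by exists (z1 * z2); rewrite kcompMzl kcompMzr -mulrzA.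
have GB : in_calB G by rewrite /in_calB /= addnC.
(* h is a left inverse of f0. So f0 h is an idempotent of G, hence 0 or 1, and 0 would make the
   identity of F vanish. *)
pose h := g0 *~ z.
have hf : kcomp h f0 = kid (Bobj F) by rewrite kcompMzl idF.
have fh2 : kcomp (kcomp f0 h) (kcomp f0 h) = kcomp f0 h.
  by rewrite kcomp_mid hf kcomp1l.
have [fh|fh] := khomB_idem GB fh2; last by exists f0, h.
case: (@kidB_neq0 F); rewrite -[LHS]kcomp1l -{1}hf -hf kcomp_mid fh.
by rewrite kcomp0l kcomp0r.
Qed.

(** * Indecomposability and the classification *)

Lemma indecomposable_Bobj p : in_calB p -> indecomposable (Bobj p).
Proof.
move=> pB; split=> [/kiso0P|Y Z]; first exact: kidB_neq0.
case/kiso_biproduct => iY [pY [iZ [pZ [p1 p2 p3 p4 p5]]]].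
have zero U (i : khom U (Bobj p)) (r : khom (Bobj p) U) :
    kcomp r i = kid U -> kcomp i r = 0 -> kiso U kzero.
  move=> ri ir; apply/kiso0P.
  by rewrite -[kid U]kcomp1l -{1}ri -ri kcomp_mid ir kcomp0l kcomp0r.
have ii : kcomp (kcomp iY pY) (kcomp iY pY) = kcomp iY pY.
  by rewrite kcomp_mid p1 kcomp1l.
have [YY|YY] := khomB_idem pB ii; first by left; apply: zero p1 YY.
right; apply: zero p2 _; apply: (@addrI _ (kcomp iY pY)).
by rewrite p5 YY addr0.
Qed.

Lemma indecomposable_kiso X Y : kiso X Y -> indecomposable Y -> indecomposable X.
Proof.
move=> XY [Y0 YI]; split=> [X0|U V XUV].
  exact/Y0/(kiso_trans (kiso_sym XY)).
exact/YI/(kiso_trans (kiso_sym XY)).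
Qed.

(** The labels of B that are not canonical are those of the second family with b = a + c, and
    [kiso_cross] exchanges them with canonical ones. *)
Lemma lcanon_ex p : in_calB p -> exists p', [/\ lcanon p', kiso (Bobj p) (Bobj p')
  & p = p' \/ exists (a c : nat) (t : int),
      p = Label false a (a + c) c t /\ p' = Label true c (a + c) a t].
Proof.
case: p => i a b c t pB.
have [pc|npc] := boolP (lcanon (Label i a b c t)).
  by exists (Label i a b c t); split => //; [exact: kiso_refl|left].
have [-> bE] : i = false /\ b = (a + c)%N.
  by move: pB npc; rewrite /in_calB /lcanon /canonical; case: (i) => /=; lia.
exists (Label true c (a + c) a t); rewrite bE; split.
- by rewrite /lcanon /= addnC.
- exact: (kiso_cross false).
by right; exists a, c, t.
Qed.

(** Otherwise the identity of the first object would be a composite through the second and vanish by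
    [khomB_orth]. *)
Lemma kiso_canon p q : lcanon p -> lcanon q -> kiso (Bobj p) (Bobj q) -> p = q.
Proof.
move=> pc qc [f [g [gf _]]]; apply: contrapT => npq.
by apply: (@kidB_neq0 p); rewrite -gf (khomB_orth f g pc qc npq).
Qed.

Theorem theorem4 :
  (forall X : kobj,
     indecomposable X <-> exists p : label, in_calB p /\ kiso X (Bobj p)) /\
  (forall p q : label, in_calB p -> in_calB q ->
     (kiso (Bobj p) (Bobj q) <->
        p = q \/
        exists (i : node) (a c : nat) (t : int),
          p = Label i a (a + c) c t /\ q = Label (~~ i) c (a + c) a t)) /\
  (forall X : kobj, exists s : seq label,
     all in_calB s /\ kiso X (kdirect_sum (map Bobj s))).
Proof.
split; [|split] => [X|p q pB qB|X].
- split=> [[X0 XI]|[p [pB Xp]]]; last first.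
    exact: indecomposable_kiso Xp (indecomposable_Bobj pB).
  (* An empty decomposition would make X zero. Otherwise X is its first summand, which is nonzero,
     so the remaining sum is zero. *)
  have [[|p s] [/= sc Xs]] := kdirect_sum_ex X; first by case: X0.
  move: sc => /andP[pc _]; have pB := lcanon_calB pc.
  exists p; split=> //; have [p0|s0] := XI _ _ Xs.
    by case: (@kidB_neq0 p); apply/kiso0P.
  exact: kiso_trans Xs (ksum0 _ s0).
- split=> [pq|[->|[i [a [c [t [-> ->]]]]]]]; last 2 first.
  + exact: kiso_refl.
  + exact: kiso_cross.
  have [p' [p'c pp' pE]] := lcanon_ex pB; have [q' [q'c qq' qE]] := lcanon_ex qB.
  have p'q' : p' = q'.
    apply: kiso_canon => //.
    exact: kiso_trans (kiso_trans (kiso_sym pp') pq) qq'.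
  (* Both labels have the same canonical form; each equals it or is its mirror image, and two mirror
     images of one label coincide. *)
  subst q'; case: pE qE => [->|[a [c [t [-> ->]]]]] [->|[a' [c' [t' [-> e]]]]].
  + by left.
  + by right; exists true, c', a', t'; rewrite e addnC.
  + by right; exists false, a, c, t.
  by left; case: e => -> _ -> ->.
have [s [sc Xs]] := kdirect_sum_ex X; exists s; split=> //.
by apply: sub_all sc => p; apply: lcanon_calB.
Qed.
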